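(* Let $\mathcal{N}$ be a network with $k$ asymmetric inputs, $\mu$ a network eigenvalue, $f\in\mathcal{V}_\mu(\mathcal{N})$ generic, and $\Delta$ a synchrony subspace of $\mathcal{N}$ which is $\mu$-semisimple with multiplicity $m$ and $\mu$-submaximal of order $2^m-1$. Suppose that the bifurcation problem on each $\mu$-maximal synchrony subspace of $\mathcal{N}$ contained in $\Delta$ is $2$-determined. Let $g:\mathbb{R}^m\times\mathbb{R}\to\mathbb{R}^m$ be the Lyapunov–Schmidt reduction of $f^{\mathcal{N}}|_{\Delta\times\mathbb{R}}$ at the origin and let $h=(h_1,\dots,h_m)$ be its second-order Taylor expansion at the origin. Assume that: 1. $D_{(y,\lambda)}h(\tilde y,1)$ has rank $m$ for each $\tilde y\in\mathbb{R}^m\setminus\{0\}$ such that $h(\tilde y\lambda,\lambda)=0$; 2. the homogeneous quadratic polynomials $h_1,\dots,h_m$ in $(x_1,\dots,x_m,\lambda)$ do not share a common factor. Then there is no bifurcation branch of $f^{\mathcal{N}}$ with synchrony $\Delta$.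
   Context: **Networks.** An $n$-cell network $\mathcal{N}$ with $k$ asymmetric inputs has cells $1,\dots,n$ and edges of $k$ types, such that each cell receives exactly one edge of each type. It is given by $n\times n$ adjacency matrices $A_1,\dots,A_k$, where $(A_l)_{ij}=1$ if the edge of type $l$ ending at cell $i$ starts at cell $j$, and $(A_l)_{ij}=0$ otherwise. All networks are assumed connected (there is an undirected path between any two cells). **Coupled cell systems.** Each cell has phase space $\mathbb{R}$. A smooth $f:\mathbb{R}\times\mathbb{R}^k\times\mathbb{R}\to\mathbb{R}$ defines $f^{\mathcal{N}}:\mathbb{R}^n\times\mathbb{R}\to\mathbb{R}^n$, $f^{\mathcal{N}}_i(x,\lambda)=f(x_i,x_{i_1},\dots,x_{i_k},\lambda)$, where $i_j$ is the source of the type-$j$ edge ending at cell $i$. Write $f_j$ ($0\le j\le k$) for the derivative of $f$ at the origin with respect to its $(j+1)$-th variable. The Jacobian at the origin is $J_f^{\mathcal{N}}=f_0\,\mathrm{Id}_n+\sum_{j=1}^k f_jA_j$. **Network eigenvalues.** These are continuous functions $\mu_1,\dots,\mu_s:\mathbb{R}^{k+1}\to\mathbb{C}$ such that $\mu_i(f_0,\dots,f_k)$ are the distinct eigenvalues of $J_f^{\mathcal{N}}$ ($f$ generic). A network eigenvalue is *semisimple with multiplicity $m$* if, for generic $f$, it is a semisimple eigenvalue of the Jacobian of multiplicity $m$; *simple* means semisimple with multiplicity $1$. **Synchrony subspaces.** A polydiagonal (subspace of $\mathbb{R}^n$ defined by equalities $x_i=x_j$) is a synchrony subspace if it is invariant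 under all admissible vector fields, equivalently under $A_1,\dots,A_k$. The restriction of $f^{\mathcal{N}}$ to a synchrony subspace $\Delta$ is the coupled cell system defined by the same $f$ on the quotient network determined by $\Delta$ (cells are the classes of synchronized cells, edge types preserved). Network eigenvalues of the quotient are called eigenvalues of $\Delta$; $\Delta$ is called $\mu$-simple, or $\mu$-semisimple with multiplicity $m$, if $\mu$ has that property as an eigenvalue of the quotient network. For a synchrony subspace $\Delta$ having $\mu$ as an eigenvalue: - $\Delta$ is *$\mu$-maximal* if $\mu$ is not an eigenvalue of any synchrony subspace $\overline\Delta\subsetneq\Delta$; - $\Delta$ is *$\mu$-submaximal of order $j\ge1$* if there are $j$ $\mu$-simple and $\mu$-maximal synchrony subspaces $\Delta_1,\dots,\Delta_j\subsetneq\Delta$ and, for any generic $f\in\mathcal{V}_\mu(\mathcal{N})$ and any synchrony subspace $\overline\Delta\subsetneq\Delta$, $\ \overline\Delta\cap\bigcup_l\ker((J_f^{\mathcal{N}})^l)\subsetneq\Delta\cap\bigcup_l\ker((J_f^{\mathcal{N}})^l)$. **Bifurcation problems.** $\mathcal{V}_\mu(\mathcal{N})$ is the set of such $f$ with $\mu(f_0,\dots,f_k)=0$, $(f_0,\dots,f_k)\in\mathrm{int}(\mu^{-1}(\mathbb{R}))$ and $f(0,\lambda)=0$ for all $\lambda$. *Generic* $f$ means: $f$ satisfies a suitable finite number of non-degeneracy conditions, i.e. non-trivial inequalities ($\neq$) on the derivatives of $f$ at the origin (not involving $f_0$, determined by $\mu=0$) not contradicting the bifurcation condition. **Branches.** A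 bifurcation branch of $f^{\mathcal{N}}$ is a function $b:R\to\mathbb{R}^n$, $b\not\equiv0$, with $f^{\mathcal{N}}(b(\lambda),\lambda)=0$ for $\lambda\in R$, where $R\subseteq\mathbb{R}$ is a (nondegenerate) connected region containing $0$. Bifurcation is local at $(0,0)$: $b$ is continuous with $b(0)=0$, and $R$ may be shrunk. The branch has synchrony $\Delta$ if $\Delta$ is the smallest synchrony subspace containing $b(R)$. **Lyapunov–Schmidt reduction.** Identify $\Delta$ with a Euclidean space via the cell coordinates of its quotient network, and let $F=f^{\mathcal{N}}|_{\Delta\times\mathbb{R}}$ and $J=D_xF(0,0)$. Choose $v_1,\dots,v_m$ spanning $\ker J$ and $v_1^*,\dots,v_m^*$ spanning $(\mathrm{range}\,J)^\perp$ with $\langle v_i^*,v_j\rangle=\delta_{ij}$. Let $W(x,\lambda)$, with values in a fixed complement of $\ker J$, be the function near the origin obtained from the implicit function theorem by solving $PF(\sum_j x_jv_j+W(x,\lambda),\lambda)=0$, where $P$ is the orthogonal projection onto $\mathrm{range}\,J$. Then $g_i(x,\lambda)=\langle v_i^*,F(\sum_j x_jv_j+W(x,\lambda),\lambda)\rangle$, $i=1,\dots,m$. Its second-order Taylor expansion has the form $h(x,\lambda)=\mu(f_{0\lambda},\dots,f_{k\lambda})\,\lambda x+Q(x)$, with $f_{j\lambda}$ the mixed second derivatives of $f$ at the origin and $Q$ having homogeneous quadratic components. **$r$-determined.** For a $\mu$-simple, $\mu$-maximal synchrony subspace the same reduction on that subspace gives a scalar function $g(x,\lambda)$ of one variable $x$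 and $\lambda$; the bifurcation problem on it is *$r$-determined* if $r$ is the minimum integer such that $\partial^r g/\partial x^r(0,0)\ne0$ for generic $f$.
   Formalization: Synchrony of a branch is taken locally: Δ must be the smallest synchrony subspace containing b(R') for every nondegenerate connected R' in R containing 0, one-sided ones too, as two branches glued at 0 refute the literal claim; in ''μ-maximal'', ''μ is not an eigenvalue'' is meant for generic f. *)

(* Defs.v *)
From HB Require Import structures.
From mathcomp Require Import all_boot all_order all_algebra.
From mathcomp Require Import complex.
From mathcomp Require Import all_classical all_reals all_analysis.
From mathcomp Require Import -(notations) mpoly.

Set Implicit Arguments.
Unset Strict Implicit.
Unset Printing Implicit Defensive.

Import Order.TTheory GRing.Theory Num.Theory.
Import numFieldNormedType.Exports.

Local Open Scope classical_set_scope.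
Local Open Scope ring_scope.

(* Notations of mpoly clash with those of mathcomp-analysis. *)
Notation mpolynomial n R := (mpoly n R) (only parsing).
Notation mvar R i := (mpolyX R (mnm1 i)) (only parsing).

Definition partial (R : realType) d (j : 'I_d) (f : 'rV[R]_d -> R) :
  'rV[R]_d -> R := fun x => 'D_(delta_mx 0 j) f x.

Definition mpartial (R : realType) d (alpha : {ffun 'I_d -> nat})
    (f : 'rV[R]_d -> R) : 'rV[R]_d -> R :=
  foldr (fun j g => iter (alpha j) (partial j) g) f (enum 'I_d).

Fixpoint Ck_on (R : realType) d (U : set 'rV[R]_d) (r : nat)
    (f : 'rV[R]_d -> R) : Prop :=
  {in U, continuous f} /\
  if r is r'.+1 then
    forall j : 'I_d, {in U, forall x, derivable f x (delta_mx 0 j)} /\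
                     Ck_on U r' (partial j f)
  else True.

Definition smooth_on (R : realType) d (U : set 'rV[R]_d) (f : 'rV[R]_d -> R) :=
  forall r, Ck_on U r f.

Definition smooth (R : realType) d : set ('rV[R]_d -> R) :=
  [set f | smooth_on setT f].

(* [N l i] is the source of the unique edge of type [l] ending at cell [i]. *)
Definition network (n k : nat) := 'I_k -> 'I_n -> 'I_n.

Definition adjacency (R : realType) n k (N : network n k) (l : 'I_k) :
  'M[R]_n := \matrix_(i, j) (N l i == j)%:R.

Definition connected_network n k (N : network n k) : Prop :=
  forall i j : 'I_n,
    connect (fun i j => [exists l, (N l i == j) || (N l j == i)]) i j.

(* An argument of [f : R * R^k * R -> R] is a row vector: coordinate 0 is the
   state of the cell, coordinates 1, ..., k are the inputs and [ord_max] is the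
   parameter lambda. *)
Definition cell_args (R : realType) k (x0 : R) (u : 'I_k -> R) (lam : R) :
    'rV[R]_k.+2 :=
  \row_j if unlift ord_max j is Some i
         then (if unlift ord0 i is Some l then u l else x0) else lam.

Definition coupled (R : realType) n k (N : network n k)
    (f : 'rV[R]_k.+2 -> R) (x : 'cV[R]_n) (lam : R) : 'cV[R]_n :=
  \col_i f (cell_args (x i 0) (fun l => x (N l i) 0) lam).

Definition linear_part (R : realType) k (f : 'rV[R]_k.+2 -> R) : 'rV[R]_k.+1 :=
  \row_j partial (lift ord_max j) f 0.

Definition jacobian (R : realType) n k (N : network n k) (a : 'rV[R]_k.+1) :
    'M[R]_n :=
  (a 0 ord0)%:M + \sum_(l < k) a 0 (lift ord0 l) *: adjacency R N l.

Definition jacobianC (R : realType) n k (N : network n k) (a : 'rV[R]_k.+1) :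
    'M[R[i]]_n :=
  map_mx (real_complex R) (jacobian N a).

(* A non-trivial inequality on the derivatives of [f] at the origin, with
   polynomial left-hand side in pairwise distinct partial derivatives.  The
   derivatives f_0 (fixed by mu = 0) and d^a f / d lambda^a (zero because
   f(0, lambda) = 0) are excluded; the remaining ones range over an open set
   when the bifurcation condition holds, so that a nonzero polynomial never
   contradicts it. *)
Record nondegeneracy (R : realType) (k : nat) := Nondegeneracy {
  nd_size : nat;
  nd_index : 'I_nd_size -> {ffun 'I_k.+2 -> nat};
  nd_index_inj : injective nd_index;
  nd_index_not_f0 : forall i, nd_index i <> [ffun j => nat_of_bool (j == ord0)];
  nd_index_not_lambda : forall i, exists j, j != ord_max /\ nd_index i j <> 0%N;
  nd_poly : mpolynomial nd_size R;
  nd_poly_neq0 : nd_poly <> 0 }.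

Arguments nd_index {R k} _ _.

Definition nd_holds (R : realType) k (c : nondegeneracy R k)
    (f : 'rV[R]_k.+2 -> R) : Prop :=
  meval (fun i => mpartial (nd_index c i) f 0) (nd_poly c) <> 0.

Definition generically (R : realType) k (V : set ('rV[R]_k.+2 -> R))
    (P : ('rV[R]_k.+2 -> R) -> Prop) : Prop :=
  exists (q : nat) (c : 'I_q -> nondegeneracy R k),
    forall f, V f -> (forall i, nd_holds (c i) f) -> P f.

Definition network_eigenvalues (R : realType) n k (N : network n k)
    s (mus : 'I_s -> 'rV[R]_k.+1 -> R[i]) : Prop :=
  (forall i, continuous (fun a => complex.Re (mus i a)) /\
             continuous (fun a => complex.Im (mus i a))) /\
  generically (@smooth R k.+2) (fun f =>
    injective (fun i => mus i (linear_part f)) /\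
    forall z, eigenvalue (jacobianC N (linear_part f)) z <->
              exists i, z = mus i (linear_part f)).

Definition network_eigenvalue (R : realType) n k (N : network n k)
    (mu : 'rV[R]_k.+1 -> R[i]) : Prop :=
  exists s (mus : 'I_s -> 'rV[R]_k.+1 -> R[i]),
    network_eigenvalues N mus /\ exists i, mus i = mu.

Definition semisimple_eigenvalue (F : fieldType) n (A : 'M[F]_n) (z : F)
    (m : nat) : Prop :=
  eigenvalue A z /\ mup z (char_poly A) = m /\ \rank (eigenspace A z) = m.

Definition network_semisimple (R : realType) n k (N : network n k)
    (mu : 'rV[R]_k.+1 -> R[i]) (m : nat) : Prop :=
  network_eigenvalue N mu /\
  generically (@smooth R k.+2) (fun f =>
    semisimple_eigenvalue (jacobianC N (linear_part f)) (mu (linear_part f)) m).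

Definition polydiagonal (R : realType) n p (c : 'I_n -> 'I_p) : set 'cV[R]_n :=
  [set x | forall i j, c i = c j -> x i 0 = x j 0].

(* [cell_class] numbers the classes of synchronized cells.  Two records may have
   the same underlying subspace, so they are compared through [sync_set]. *)
Record synchrony (R : realType) n k (N : network n k) := Synchrony {
  nclass : nat;
  cell_class : 'I_n -> 'I_nclass;
  class_surj : forall c, exists i, cell_class i = c;
  class_invariant : forall (l : 'I_k) (x : 'cV[R]_n),
    polydiagonal cell_class x ->
    polydiagonal cell_class (adjacency R N l *m x) }.

Arguments cell_class {R n k N} _ _.

Definition sync_set (R : realType) n k (N : network n k) (D : synchrony R N) :
  set 'cV[R]_n := polydiagonal (cell_class D).

(* By invariance the choice of a cell [i] in the class [c] is irrelevant. *)
Definition quotient (R : realType) n k (N : network n k) (D : synchrony R N) :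
    network (nclass D) k :=
  fun l c => if [pick i | cell_class D i == c] is Some i
             then cell_class D (N l i) else c.

Arguments quotient {R n k N} D _ _.

Definition sync_eigenvalue (R : realType) n k (N : network n k)
    (D : synchrony R N) (mu : 'rV[R]_k.+1 -> R[i]) : Prop :=
  network_eigenvalue (quotient D) mu.

Definition mu_semisimple (R : realType) n k (N : network n k)
    (mu : 'rV[R]_k.+1 -> R[i]) (D : synchrony R N) (m : nat) : Prop :=
  network_semisimple (quotient D) mu m.

Definition mu_simple (R : realType) n k (N : network n k)
    (mu : 'rV[R]_k.+1 -> R[i]) (D : synchrony R N) : Prop :=
  mu_semisimple mu D 1.

(* Like every spectral property, "mu is not an eigenvalue of D'" is about
   generic f.  A continuous branch can follow different algebraic factors of
   the characteristic polynomial, e.g. f_0 + max(f_1, f_2); the bare negation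
   of [sync_eigenvalue] would then allow mu to be an eigenvalue of D' for all
   f in an open set. *)
Definition mu_maximal (R : realType) n k (N : network n k)
    (mu : 'rV[R]_k.+1 -> R[i]) (D : synchrony R N) : Prop :=
  sync_eigenvalue D mu /\
  forall D' : synchrony R N, sync_set D' `<` sync_set D ->
    generically (@smooth R k.+2) (fun f =>
      ~~ eigenvalue (jacobianC (quotient D') (linear_part f))
                    (mu (linear_part f))).

Definition bifurcation_problems (R : realType) k
    (mu : 'rV[R]_k.+1 -> R[i]) : set ('rV[R]_k.+2 -> R) :=
  [set f | [/\ smooth f,
               mu (linear_part f) = 0,
               interior [set a | complex.Im (mu a) = 0] (linear_part f) &
               forall lam, f (cell_args 0 (fun=> 0) lam) = 0]].

Definition generalized_kernel (R : realType) n (A : 'M[R]_n) : set 'cV[R]_n :=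
  [set x | exists l : nat, A ^+ l *m x = 0].

Definition mu_submaximal (R : realType) n k (N : network n k)
    (mu : 'rV[R]_k.+1 -> R[i]) (D : synchrony R N) (j : nat) : Prop :=
  [/\ (1 <= j)%N,
      sync_eigenvalue D mu,
      exists Ds : 'I_j -> synchrony R N,
        (forall i i', i != i' -> sync_set (Ds i) <> sync_set (Ds i')) /\
        (forall i, [/\ mu_simple mu (Ds i), mu_maximal mu (Ds i) &
                       sync_set (Ds i) `<` sync_set D]) &
      generically (bifurcation_problems mu) (fun f =>
        forall D' : synchrony R N, sync_set D' `<` sync_set D ->
          let K := generalized_kernel (jacobian N (linear_part f)) in
          sync_set D' `&` K `<` sync_set D `&` K)].

(* Intervals containing 0, possibly one-sided. *)
Definition branch_domain (R : realType) (I : set R) : Prop :=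
  [/\ connected I, I 0 & exists2 t, I t & t != 0].

Definition bifurcation_branch (R : realType) n k (N : network n k)
    (f : 'rV[R]_k.+2 -> R) (I : set R) (b : R -> 'cV[R]_n) : Prop :=
  [/\ branch_domain I,
      {within I, continuous b} /\ b 0 = 0,
      exists2 t, I t & b t != 0 &
      forall t, I t -> coupled N f (b t) t = 0].

(* Local notion: D is the smallest synchrony subspace containing b(I'), however
   I is shrunk to I'.  As I' may be one-sided, two different branches glued
   at 0 do not count as a branch with the join of their synchronies. *)
Definition branch_synchrony (R : realType) n k (N : network n k)
    (I : set R) (b : R -> 'cV[R]_n) (D : synchrony R N) : Prop :=
  forall I' : set R, I' `<=` I -> branch_domain I' ->
    b @` I' `<=` sync_set D /\
    forall D' : synchrony R N,
      b @` I' `<=` sync_set D' -> sync_set D `<=` sync_set D'.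

(* A point (x, lambda) of R^m * R is a row vector whose last coordinate is
   lambda. *)
Definition append (R : realType) m (x : 'rV[R]_m) (lam : R) : 'rV[R]_m.+1 :=
  \row_j if unlift ord_max j is Some i then x 0 i else lam.

Definition state_part (R : realType) m (z : 'rV[R]_m.+1) : 'cV[R]_m :=
  \col_i z 0 (lift ord_max i).

Definition param_part (R : realType) m (z : 'rV[R]_m.+1) : R := z 0 ord_max.

(* [g] is a reduction of the system defined by [f] on the network [Q] (the
   quotient determined by Delta).  The columns of [V] and [Vs] are the v_j and
   the v_j^*, [C] is the chosen complement of ker J (as a row space), and
   [P] the orthogonal projection onto range J.  By uniqueness in the implicit
   function theorem the conditions determine [W] near the origin. *)
Definition lyapunov_schmidt (R : realType) p k (Q : network p k)
    (f : 'rV[R]_k.+2 -> R) m (g : 'I_m -> 'rV[R]_m.+1 -> R) : Prop :=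
  let J := jacobian Q (linear_part f) in
  exists (V Vs : 'M[R]_(p, m)) (C P : 'M[R]_p) (W : 'rV[R]_m.+1 -> 'cV[R]_p),
  let F z := coupled Q f (V *m state_part z + W z) (param_part z) in
  [/\ (forall y : 'cV[R]_p, J *m y = 0 <-> exists c, y = V *m c) /\
      (forall y : 'cV[R]_p, y^T *m J = 0 <-> exists c, y = Vs *m c) /\
      Vs^T *m V = 1%:M,
      (V^T + C :=: 1%:M)%MS /\ (V^T :&: C)%MS = 0,
      [/\ P *m P = P, P^T = P & (P^T :=: J^T)%MS],
      [/\ (exists U : set 'rV[R]_m.+1, [/\ open U, U 0 &
             forall i : 'I_p, smooth_on U (fun z => W z i 0)]),
          W 0 = 0,
          \forall z \near (0 : 'rV[R]_m.+1), ((W z)^T <= C)%MS &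
          \forall z \near (0 : 'rV[R]_m.+1), P *m F z = 0] &
      forall i z, g i z = (Vs^T *m F z) i 0].

(* For a mu-simple, mu-maximal D.  The nonvanishing of the first nonzero
   d^r g / dx^r does not depend on the data chosen in the reduction. *)
Definition determined (R : realType) n k (N : network n k)
    (mu : 'rV[R]_k.+1 -> R[i]) (D : synchrony R N) (r : nat) : Prop :=
  let nonzero q :=
    generically (bifurcation_problems mu) (fun f =>
      exists g : 'I_1 -> 'rV[R]_2 -> R, lyapunov_schmidt (quotient D) f g /\
        iter q (partial ord0) (g ord0) 0 <> 0) in
  nonzero r /\ forall q, (q < r)%N -> ~ nonzero q.

Definition taylor2 (R : realType) d (g : 'rV[R]_d -> R) : mpolynomial d R :=
  mpolyC d (g 0) + \sum_j partial j g 0 *: mvar R j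
  + 2^-1 *: \sum_i \sum_j partial i (partial j g) 0 *: (mvar R i * mvar R j).

Definition peval (R : realType) d (p : mpolynomial d R) (x : 'rV[R]_d) : R :=
  meval (fun j => x 0 j) p.

Definition poly_jacobian (R : realType) m d (h : 'I_m -> mpolynomial d R)
    (x : 'rV[R]_d) : 'M[R]_(m, d) :=
  \matrix_(i, j) peval (mderiv j (h i)) x.

Definition common_factor (R : realType) m d (h : 'I_m -> mpolynomial d R) :
    Prop :=
  exists q : mpolynomial d R,
    (forall c, q <> mpolyC d c) /\ forall i, exists r, h i = q * r.

(* Main.v *)
(** The [2^m - 1] maximal subspaces [Delta_i] meet [ker J] in lines; restricted to
    such a line the quadratic map [h(., 1)] is [x (A x + 2 B)], with [A <> 0] by
    2-determinacy and [B <> 0] generically, which gives a nonzero zero [y_i] of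
    [h(., 1)].  Distinct subspaces give distinct zeros because [mu] is not an
    eigenvalue of their intersection.  By the rank hypothesis the projective
    points [(y_i, 1)] are regular zeros of the [m] quadrics [h].  A Bezout count
    (deform [h_i] to [h_i + eps x_i^2] and reduce monomials to squarefree ones)
    shows that [(0, 1)] is regular as well and that there is no other zero, even
    at infinity.  Hence every branch is tangent to some [Y_i] in
    [{0, y_1, y_2, ...}] on a half-interval.  Regularity makes
    [J + lambda B] of size at least [c lambda] along [Y_i], so zeros of the system
    close to [lambda Y_i] are locally unique modulo [Delta_i]: they lie in
    [Delta_i], in any [Delta_j] if [Y_i = 0].  Thus the synchrony of the branch is
    smaller than [Delta]. *)

From HB Require Import structures.
Require Import Defs.
From mathcomp Require Import all_boot all_order all_algebra.
From mathcomp Require Import complex.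
From mathcomp Require Import all_classical all_reals all_analysis.
From mathcomp Require Import -(notations) mpoly.
From mathcomp Require Import ring lra.

Set Implicit Arguments.
Unset Strict Implicit.
Unset Printing Implicit Defensive.

Import Order.TTheory GRing.Theory Num.Theory.
Import numFieldNormedType.Exports.

Local Open Scope classical_set_scope.
Local Open Scope ring_scope.

(** * Counting zeros of quadratic forms *)

(** Only an upper bound on the number of zeros is needed, so the count stays over the ground field:
    a regular zero lifts to a solution of the deformed equations modulo any power of the deformation
    parameter, and a nontrivial linear relation between more than 2^m evaluations is refuted by
    products of linear forms. The zero to be excluded may be singular and need not lift; it is
    therefore moved to the coordinate point [e0], which the added terms x_i^2 leave in place. The
    inequality B <> 0 is the delicate genericity statement: eigenvectors are not polynomial in the
    derivatives of [f], and f_0 is barred from nondegeneracy conditions, so B is expressed by traces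
    of adjugates and f_0 is eliminated. Since J + lambda B degenerates as lambda tends to 0,
    uniqueness of zeros is measured on cones |x - lambda Y| <= r |lambda|, where the error between
    two points is a small multiple of |lambda| times their distance. *)

Lemma idomain_dependent (A : idomainType) (n p : nat) (B : 'I_n -> 'I_p -> A) :
  (p < n)%N ->
  exists u : 'I_n -> A, (exists j, u j != 0) /\ forall l, \sum_j u j * B j l = 0.
Proof.
elim: p n B => [|p IHp] [//|n] B lt_pn.
  by exists (fun=> 1); split=> [|[]//]; exists ord0; rewrite oner_neq0.
have [/existsP[i0 Bi0]|/existsPn B0] := boolP [exists i, B i ord0 != 0]; last first.
  have [u [unz uB]] := IHp n.+1 (fun i l => B i (lift ord0 l)) (ltnW lt_pn).
  exists u; split=> // l; case: (unliftP ord0 l) => [l'|] -> //.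
  by rewrite big1 // => j _; rewrite (eqP (negbNE (B0 j))) mulr0.
(* Fraction-free Gaussian elimination: the 2 by 2 minors on the pivot [B i0 ord0] clear the first
   equation without leaving the domain, and [u0] is chosen to restore it. *)
pose B' j l := B i0 ord0 * B (lift i0 j) (lift ord0 l)
               - B (lift i0 j) ord0 * B i0 (lift ord0 l).
have [u [[j0 uj0] uB]] := IHp n B' lt_pn.
pose u0 := - \sum_j u j * B (lift i0 j) ord0.
exists (fun j => if unlift i0 j is Some j' then B i0 ord0 * u j' else u0).
split=> [|l].
  by exists (lift i0 j0); rewrite liftK mulf_neq0.
rewrite (bigD1 i0) //= unlift_none.
rewrite (reindex_omap (lift i0) (unlift i0)) /=; last first.
  by move=> j; case: unliftP => [j' ->|->] //=; rewrite eqxx.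
under eq_big => [j|j _].
  rewrite eq_sym neq_lift liftK eqxx; over.
  rewrite liftK; over.
case: (unliftP ord0 l) => [l'|] ->; last first.
  rewrite /u0 mulNr mulr_suml addrC -sumrB big1 // => j _.
  by rewrite -mulrA [X in X - _]mulrC subrr.
rewrite -[RHS](uB l') /u0 mulNr mulr_suml addrC -sumrB.
apply: eq_bigr => j _; rewrite /B' mulrBr !mulrA; congr (_ * _ - _).
by rewrite mulrC.
Qed.

Definition qform (K : comNzRingType) n (q : 'M[K]_n) (z : 'rV[K]_n) : K :=
  (z *m q *m z^T) 0 0.

(** The polar form without the factor 1/2: the differential of [qform q] at [y] in the direction
    [z], whether or not [q] is symmetric. *)
Definition bform (K : comNzRingType) n (q : 'M[K]_n) (y z : 'rV[K]_n) : K :=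
  (y *m q *m z^T + z *m q *m y^T) 0 0.

Lemma qformD (K : comNzRingType) n (q : 'M[K]_n) (y z : 'rV[K]_n) :
  qform q (y + z) = qform q y + bform q y z + qform q z.
Proof. by rewrite /qform /bform linearD !mulmxDl !mulmxDr !mxE; ring. Qed.

Lemma qformZ (K : comNzRingType) n (q : 'M[K]_n) a (z : 'rV[K]_n) :
  qform q (a *: z) = a ^+ 2 * qform q z.
Proof.
by rewrite /qform linearZ /= -scalemxAr -!scalemxAl 2!mxE mulrA expr2.
Qed.

Lemma bformZ (K : comNzRingType) n (q : 'M[K]_n) a (y z : 'rV[K]_n) :
  bform q y (a *: z) = a * bform q y z.
Proof.
rewrite /bform linearZ /= -scalemxAr -!scalemxAl -scalerDr.
by rewrite [LHS]mxE.
Qed.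

Lemma bformD (K : comNzRingType) n (q : 'M[K]_n) (y z z' : 'rV[K]_n) :
  bform q y (z + z') = bform q y z + bform q y z'.
Proof. by rewrite /bform linearD !mulmxDl !mulmxDr !mxE; ring. Qed.

Lemma bform_diag (K : comNzRingType) n (q : 'M[K]_n) (z : 'rV[K]_n) :
  bform q z z = 2%:R * qform q z.
Proof. by rewrite /bform /qform mxE -mulr2n mulr_natl. Qed.

Lemma qformE (K : comNzRingType) n (q : 'M[K]_n) (z : 'rV[K]_n) :
  qform q z = \sum_a \sum_b q a b * (z 0 a * z 0 b).
Proof.
rewrite /qform exchange_big mxE /=; apply: eq_bigr => b _.
by rewrite !mxE mulr_suml; apply: eq_bigr => a _; ring.
Qed.

Lemma bformE (K : comNzRingType) n (q : 'M[K]_n) (y z : 'rV[K]_n) :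
  bform q y z = \sum_b (\sum_a y 0 a * (q a b + q b a)) * z 0 b.
Proof.
rewrite /bform mxE [X in _ + X](_ : _ = (y *m q^T *m z^T) 0 0); last first.
  transitivity (((z *m q *m y^T)^T) 0 0); first by rewrite [RHS]mxE.
  by rewrite !trmx_mul trmxK mulmxA.
rewrite !mxE -big_split /=; apply: eq_bigr => b _.
rewrite !mxE -mulrDl -big_split /=; congr (_ * _).
by apply: eq_bigr => a _; rewrite !mxE mulrDr.
Qed.

Lemma map_qform (K L : comNzRingType) (f : {rmorphism K -> L}) n
    (q : 'M[K]_n) z : f (qform q z) = qform (map_mx f q) (map_mx f z).
Proof. by rewrite /qform matrix.map_trmx -!map_mxM [RHS]mxE. Qed.

Lemma map_bform (K L : comNzRingType) (f : {rmorphism K -> L}) n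
    (q : 'M[K]_n) y z :
  f (bform q y z) = bform (map_mx f q) (map_mx f y) (map_mx f z).
Proof. by rewrite /bform !matrix.map_trmx -!map_mxM -map_mxD [RHS]mxE. Qed.

(* The adjugate of ['X + N] turns the congruences into ['X^L %| chi * e w], where
   [chi] is the characteristic polynomial of [- N]. *)
Lemma char_poly_divides (F : fieldType) (T : finType) (N : T -> T -> F) :
  exists L, forall e : T -> {poly F},
    (forall w, 'X^L %| 'X * e w + \sum_t (N w t)%:P * e t) ->
    forall w, (e w).[0] = 0.
Proof.
pose A : 'M[F]_#|T| := \matrix_(i, j) - N (enum_val i) (enum_val j).
(* This exponent exceeds the degree of [chi], so 'X^L does not divide [chi]; it would have to if [(e
   w).[0]] were nonzero, as [e w] would be coprime to 'X. *)
exists (size (char_poly A)) => e He w.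
pose E : 'cV[{poly F}]_#|T| := \col_j e (enum_val j).
have div : 'X^(size (char_poly A)) %| char_poly A * e w.
  suff -> : char_poly A * e w =
      (\adj (char_poly_mx A) *m (char_poly_mx A *m E)) (enum_rank w) 0.
    rewrite mxE; apply: (big_ind (fun p => _ %| p)); first exact: dvdp0.
      by move=> x y; apply: dvdp_add.
    move=> i _; apply: dvdp_mull; rewrite mxE (bigD1 i) //=.
    have := He (enum_val i); congr (_ %| _).
    rewrite (bigD1 (enum_val i)) //= addrA; congr (_ + _).
      by rewrite !mxE eqxx -mulrDl /= polyCN opprK.
    rewrite (reindex_omap enum_val (fun t => Some (enum_rank t))) /=; last first.
      by move=> t _; rewrite enum_rankK.
    apply: eq_big => [j|j /andP[nji _]].
      by rewrite enum_valK eqxx andbT (inj_eq enum_val_inj).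
    rewrite !mxE eq_sym -(inj_eq enum_val_inj) (negbTE nji).
    by rewrite mulr0n sub0r polyCN opprK.
  by rewrite mulmxA mul_adj_mx -/(char_poly A) mul_scalar_mx !mxE enum_rankK.
apply/eqP/negPn/negP => ew0.
have cop : coprimep 'X^(size (char_poly A)) (e w).
  apply: coprimep_expl; rewrite coprimep_sym (_ : 'X = 'X - 0%:P).
    by rewrite coprimep_XsubC.
  by rewrite polyC0 subr0.
rewrite mulrC Gauss_dvdpr // in div.
have := dvdp_leq (monic_neq0 (char_poly_monic A)) div.
by rewrite size_polyXn ltnn.
Qed.

(** Hensel lifting: the differential of the forms at [z] is onto, so the error at each order in 'X
    can be cancelled by a correction of that order. The coordinate [ord0] is the one whose square is
    not added. *)
Lemma newton_lift (F : fieldType) m (Q : 'I_m -> 'M[F]_m.+1) (z : 'rV[F]_m.+1) :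
  (forall i, qform (Q i) z = 0) ->
  (forall r : 'I_m -> F, exists w, forall i, bform (Q i) z w = r i) ->
  forall L, exists Y : 'rV[{poly F}]_m.+1,
    (forall a, (Y 0 a).[0] = z 0 a) /\
    forall i : 'I_m, 'X^L %| 'X * Y 0 (lift ord0 i) ^+ 2
                      + qform (map_mx polyC (Q i)) Y.
Proof.
move=> hz surj; elim=> [|L [Y [Y0 divY]]].
  exists (map_mx polyC z); split=> [a|i]; first by rewrite mxE hornerC.
  by rewrite expr0 dvd1p.
(* Order 1 is reached by the constant lift; a correction with factor 'X^0 would change the value at
   'X = 0. *)
case: L divY => [_|L divY].
  exists (map_mx polyC z); split=> [a|i]; first by rewrite mxE hornerC.
  by rewrite -map_qform hz rmorph0 addr0 expr1 dvdp_mulr.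
have Q0 (i : 'I_m) : exists r : {poly F}, 'X * Y 0 (lift ord0 i) ^+ 2
    + qform (map_mx polyC (Q i)) Y = r * 'X^(L.+1) by apply/dvdpP; exact: divY.
have [r Hr] := fin_all_exists Q0.
(* [w] cancels the coefficient of 'X^(L+1); its quadratic contribution has order 2L + 2, which is at
   least L + 2. *)
have [w Hw] := surj (fun i => - (r i).[0]).
pose W : 'rV[{poly F}]_m.+1 := map_mx polyC w.
exists (Y + 'X^(L.+1) *: W); split=> [a|i].
  by rewrite !mxE !hornerE Y0 exprS mul0r mul0r addr0.
rewrite qformD qformZ bformZ.
set q := map_mx _ _; pose y := Y 0 (lift ord0 i).
have -> : 'X * (Y + 'X^(L.+1) *: W) 0 (lift ord0 i) ^+ 2 +
   (qform q Y + 'X^(L.+1) * bform q Y W + ('X^(L.+1)) ^+ 2 * qform q W) =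
   'X^(L.+1) * (r i + bform q Y W) +
   'X^(L.+2) * (2%:R * y * W 0 (lift ord0 i) +
      'X^L * ('X * W 0 (lift ord0 i) ^+ 2 + qform q W)).
  rewrite mulrDr [_ * r i]mulrC -Hr -/q -/y [(Y + _) _ _]mxE [('X^(L.+1) *: W) _ _]mxE -/y.
  by rewrite -[L.+2]addn2 -[L.+1]addn1 !exprD; ring.
apply: dvdp_add; last by rewrite dvdp_mulr.
rewrite [in X in X %| _]exprSr; apply: dvdp_mul => //.
rewrite (_ : 'X = 'X - 0%:P); last by rewrite polyC0 subr0.
rewrite dvdp_XsubCl rootE hornerD.
have -> : (bform q Y W).[0] = bform (Q i) z w.
  rewrite -[LHS]/(horner_eval 0 _) map_bform; congr bform.
  - by apply/matrixP => a b; rewrite /q !mxE; exact: hornerC.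
  - by apply/rowP => a; rewrite !mxE; exact: Y0.
  - by apply/rowP => a; rewrite /W !mxE; exact: hornerC.
by rewrite Hw subrr.
Qed.

(** Dividing out the common power of 'X makes a relation with polynomial coefficients survive the
    specialisation 'X = 0 nontrivially. *)
Lemma factor_polyX (F : fieldType) s (u : 'I_s -> {poly F}) :
  (exists j, u j != 0) ->
  exists v (u' : 'I_s -> {poly F}),
    (forall j, u j = 'X^v * u' j) /\ exists j, (u' j).[0] != 0.
Proof.
case=> j0; move: {2}(size (u j0)) (leqnn (size (u j0))) => N.
elim: N u => [|N IHN] u.
  by rewrite leqn0 size_poly_eq0 => -> .
move=> szu unz.
have [/existsP[j uj]|/existsPn u0] := boolP [exists j, (u j).[0] != 0].
  exists 0, u; split; last by exists j.
  by move=> i; rewrite expr0 mul1r.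
have Xu j : exists p : {poly F}, u j = p * 'X.
  apply/dvdpP; rewrite (_ : 'X = 'X - 0%:P); last by rewrite polyC0 subr0.
  by rewrite dvdp_XsubCl; exact: negbNE (u0 j).
have [p Hp] := fin_all_exists Xu.
have pnz : p j0 != 0 by apply: contraNneq unz => p0; rewrite Hp p0 mul0r.
have [|//|v [u' [Hu' nz]]] := IHN p.
  by move: szu; rewrite Hp size_mulX.
exists v.+1, u'; split=> // j.
by rewrite Hp Hu' exprSr -!mulrA ['X * _]mulrC.
Qed.

(* Monomials of degree [#|P|] in [m.+1] variables are handled as words with
   positions in [P]; different words may denote the same monomial. *)
Section Words.
Variables (P : finType) (m : nat).
Notation word := {ffun P -> 'I_m.+1}.
Implicit Types (w : word).

(** Only the letters [lift ord0 i] count: no equation rewrites the square of the coordinate [ord0],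
    which may occur any number of times. *)
Definition repeated w : option (P * P * 'I_m) :=
  [pick t | [&& t.1.1 != t.1.2, w t.1.1 == lift ord0 t.2
                              & w t.1.2 == lift ord0 t.2]].

Definition subst2 w l l' a b : word :=
  [ffun x => if x == l then a else if x == l' then b else w x].

Definition letters w : {set 'I_m} :=
  [set i | [exists l, w l == lift ord0 i]].

Definition word_eval (K : comNzRingType) (z : 'rV[K]_m.+1) w : K :=
  \prod_l z 0 (w l).

Lemma word_evalE (K : comNzRingType) (z : 'rV[K]_m.+1) w :
  word_eval z w = \prod_a z 0 a ^+ #|[pred l | w l == a]|.
Proof.
rewrite /word_eval (partition_big w predT) //=; apply: eq_bigr => a _.
by rewrite -prodr_const; apply: eq_big => // l /eqP ->.
Qed.

(** Without repetition each x_i occurs at most once, so the set of letters fixes its exponent; all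
    other positions carry [ord0], and their number is fixed by the common length [#|P|]. *)
Lemma word_eval_letters (K : comNzRingType) (z : 'rV[K]_m.+1) w w' :
  repeated w = None -> repeated w' = None -> letters w = letters w' ->
  word_eval z w = word_eval z w'.
Proof.
have count_lift w1 i : repeated w1 = None ->
    #|[pred l | w1 l == lift ord0 i]| = (i \in letters w1).
  rewrite /repeated; case: pickP => // none _.
  rewrite inE; case: existsP => [[l wl]|nex].
    rewrite (fintype.eq_card1 (x := l)) // => l'; rewrite !inE.
    apply/idP/eqP => [wl'|-> //]; apply/eqP/negbNE/negP => nl.
    by move: (none (l', l, i)); rewrite /= nl wl wl'.
  by apply: eq_card0 => l; rewrite !inE; apply/negP => wl; apply: nex; exists l.
have count0 w1 : repeated w1 = None ->
    #|[pred l | w1 l == ord0]| = (#|P| - #|letters w1|)%N.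
  move=> rep; have : (\sum_a #|[pred l | w1 l == a]| = #|P|)%N.
    rewrite -[RHS]sum1_card (partition_big w1 predT) //=.
    by apply: eq_bigr => a _; rewrite sum1_card.
  rewrite big_ord_recl /=.
  under [X in (_ + X)%N]eq_bigr do rewrite count_lift //.
  have -> : (\sum_i (i \in letters w1) = #|letters w1|)%N.
    by rewrite -sum1_card [RHS]big_mkcond.
  by move=> Ed; rewrite -[in RHS]Ed addnK.
move=> rep rep' eq_let; rewrite !word_evalE; apply: eq_bigr => a _.
by case: (unliftP ord0 a) => [i|] ->; rewrite ?count_lift ?count0 // eq_let.
Qed.

(** The factor [c] is the product of the letters outside the two repeated positions: the deformed
    equation number [t.2] is multiplied by it. *)
Lemma word_eval_repeated (K : comNzRingType) (q : 'I_m -> 'M[K]_m.+1)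
    (z : 'rV[K]_m.+1) (x : K) w t : repeated w = Some t ->
  exists c, x * word_eval z w
    + \sum_a \sum_b q t.2 a b * word_eval z (subst2 w t.1.1 t.1.2 a b) =
    c * (x * z 0 (lift ord0 t.2) ^+ 2 + qform (q t.2) z).
Proof.
rewrite /repeated; case: pickP => // t' /and3P[nl wl wl'] [<-] {t}.
move: t' nl wl wl' => [[l l'] i] /= nl /eqP wl /eqP wl'.
exists (\prod_(y | (y != l) && (y != l')) z 0 (w y)).
rewrite mulrDr qformE; congr (_ + _).
  rewrite /word_eval (bigD1 l) //= (bigD1 l') 1?eq_sym //= wl wl'.
  by ring.
rewrite mulr_sumr; apply: eq_bigr => a _; rewrite mulr_sumr.
apply: eq_bigr => b _.
rewrite /word_eval (bigD1 l) //= (bigD1 l') 1?eq_sym //= !ffunE !eqxx.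
rewrite eq_sym (negbTE nl).
under [X in q i a b * (_ * (_ * X))]eq_bigr => y /andP[/negbTE yl /negbTE yl'].
  rewrite ffunE yl yl'; over.
by ring.
Qed.

(* A repeated letter [x_i] of a word can be eliminated with the equation
   [h_i = - 'X x_i^2], so at ['X = 0] everything is determined by the words
   without repetition, that is by the [2 ^ m] possible sets of letters. *)
Lemma words_dependent (F : fieldType) (Q : 'I_m -> 'M[F]_m.+1) :
  exists L, forall (J : finType) (e : J -> word -> {poly F}),
    (2 ^ m < #|J|)%N ->
    (forall j w t, repeated w = Some t ->
       'X^L %| 'X * e j w + \sum_a \sum_b
          (Q t.2 a b)%:P * e j (subst2 w t.1.1 t.1.2 a b)) ->
    (forall j w w', repeated w = None -> repeated w' = None ->
       letters w = letters w' -> e j w = e j w') ->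
    exists c : J -> F, (exists j, c j != 0) /\
      forall w, \sum_j c j * (e j w).[0] = 0.
Proof.
(* Row [w] of [N] expands the word after replacing a repeated x_i^2 by h_i; it is zero when [w] has
   no repetition. *)
pose N w w' : F := if repeated w is Some t then
  \sum_a \sum_b Q t.2 a b * (subst2 w t.1.1 t.1.2 a b == w')%:R else 0.
have [L HL] := char_poly_divides N.
exists L => J e' lt_s erep' elet'.
pose s := #|J|; pose e (j : 'I_s) := e' (enum_val j).
have erep j := erep' (enum_val j); have elet j := elet' (enum_val j).
clear erep' elet'.
suff [c [[j cj] Hc]] : exists c : 'I_s -> F, (exists j, c j != 0) /\
    forall w, \sum_j c j * (e j w).[0] = 0.
  exists (c \o enum_rank); split; first by exists (enum_val j); rewrite /= enum_valK.
  move=> w; rewrite (reindex (fun i : 'I_s => enum_val i)) /=; last first.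
    by exists enum_rank => i _; rewrite ?enum_valK ?enum_rankK.
  by rewrite -[RHS](Hc w); apply: eq_bigr => i _; rewrite enum_valK.
(* The common value of [e j] on the words without repetition whose set of letters is [S]; 0 if there
   is none, for instance when [S] has more elements than a word has positions. *)
pose val j S := if [pick w | (repeated w == None) && (letters w == S)]
                is Some w then e j w else 0.
have card_S : (#|{set 'I_m}| < s)%N by rewrite -cardsT -powersetT card_powerset cardsT card_ord.
have [u [unz Hu]] := idomain_dependent (fun j l => val j (enum_val l)) card_S.
have [v [c [Hc [j0 cj0]]]] := factor_polyX unz.
exists (fun j => (c j).[0]); split; first by exists j0.
(* The relation between more than 2^m families holds on every word without repetition, and still
   does after division by the power of 'X. *)
have He w : repeated w = None -> \sum_j c j * e j w = 0.
  move=> rep; apply/eqP.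
  have : 'X^v * (\sum_j c j * e j w) == 0.
    rewrite mulr_sumr -[X in _ == X](Hu (enum_rank (letters w))).
    apply/eqP/eq_bigr => j _; rewrite mulrA -Hc enum_rankK /val.
    case: pickP => [w' /andP[/eqP rep' /eqP]|/(_ w)]; last by rewrite rep !eqxx.
    by move=> eq_let; congr (_ * _); apply: elet.
  by rewrite mulf_eq0 expf_eq0 polyX_eq0 andbF.
(* The combined family satisfies the congruences of [char_poly_divides]: they are combinations of
   the given ones on words with a repetition, and trivial on the others. *)
move=> w; rewrite -[RHS](HL (fun w => \sum_j c j * e j w) _ w).
  by rewrite horner_sum; apply: eq_bigr => j _; rewrite hornerM.
move=> {}w; have [rep|rep] := eqVneq (repeated w) None; last first.
  case Ew: (repeated w) rep => [r|//] _.
  have NE w' : N w w' = \sum_a \sum_b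
      Q r.2 a b * (subst2 w r.1.1 r.1.2 a b == w')%:R by rewrite /N Ew.
  have -> : 'X * (\sum_j c j * e j w) + \sum_w' (N w w')%:P * \sum_j c j * e j w'
    = \sum_j c j * ('X * e j w + \sum_a \sum_b
          (Q r.2 a b)%:P * e j (subst2 w r.1.1 r.1.2 a b)).
    under [RHS]eq_bigr do rewrite mulrDr mulrCA.
    rewrite big_split /= -mulr_sumr; congr (_ + _).
    under eq_bigr do rewrite mulr_sumr.
    rewrite exchange_big /=; apply: eq_bigr => j _.
    under eq_bigr do rewrite mulrCA; rewrite -mulr_sumr; congr (_ * _).
    transitivity (\sum_w' \sum_a \sum_b
        (Q r.2 a b * (subst2 w r.1.1 r.1.2 a b == w')%:R)%:P * e j w').
      apply: eq_bigr => w' _; rewrite NE rmorph_sum mulr_suml.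
      by apply: eq_bigr => a _; rewrite rmorph_sum mulr_suml.
    rewrite exchange_big /=; apply: eq_bigr => a _.
    rewrite exchange_big /=; apply: eq_bigr => b _.
    rewrite (bigD1 (subst2 w r.1.1 r.1.2 a b)) //= eqxx mulr1.
    rewrite big1 ?addr0 // => w' /negbTE; rewrite eq_sym => ->.
    by rewrite mulr0 polyC0 mul0r.
  apply: (big_ind (fun p => _ %| p)); first exact: dvdp0.
    by move=> x y; apply: dvdp_add.
  by move=> j _; apply: dvdp_mull; apply: erep.
rewrite He // mulr0 add0r big1 ?dvdp0 // => w' _.
by rewrite /N rep polyC0 mul0r.
Qed.
End Words.

(** Over a field: [y] is not a multiple of [x]. The relation is not symmetric, and [y] may be a
    tangent direction at [x] as well as another point. *)
Definition separated (K : comNzRingType) n (x y : 'rV[K]_n) : Prop :=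
  exists l : 'cV[K]_n, (x *m l) 0 0 = 0 /\ (y *m l) 0 0 <> 0.

Definition regular_zero (K : comNzRingType) m (q : 'I_m -> 'M[K]_m.+1)
    (z : 'rV[K]_m.+1) : Prop :=
  (forall i, qform (q i) z = 0) /\
  forall r : 'I_m -> K, exists w, forall i, bform (q i) z w = r i.

(** A product of linear forms is a combination of words, so a relation between evaluations on all
    words can be tested on such products, with one form for each position. *)
Lemma word_eval_pairing (K : comNzRingType) (P : finType) m
    (l : P -> 'cV[K]_m.+1) (z : 'rV[K]_m.+1) :
  \sum_(w : {ffun P -> 'I_m.+1}) (\prod_p l p (w p) 0) * word_eval z w =
  \prod_p (z *m l p) 0 0.
Proof.
under [RHS]eq_bigr do rewrite mxE.
rewrite (bigA_distr_bigA (fun p a => z 0 a * l p a 0)) /=.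
by apply: eq_bigr => w _; rewrite big_split mulrC.
Qed.

Lemma horner_word_eval (K : comNzRingType) (P : finType) m
    (Y : 'rV[{poly K}]_m.+1) (z : 'rV[K]_m.+1) (w : {ffun P -> 'I_m.+1}) :
  (forall a, (Y 0 a).[0] = z 0 a) -> (word_eval Y w).[0] = word_eval z w.
Proof.
by move=> HY; rewrite horner_prod; apply: eq_bigr => p _.
Qed.

Lemma mulmx_e0 (K : comNzRingType) n (l : 'cV[K]_n.+1) :
  (delta_mx 0 0 *m l : 'M[K]_1) 0 0 = l 0 0.
Proof. by rewrite -rowE mxE. Qed.

Section Bezout.
Variables (F : fieldType) (m : nat) (Q : 'I_m -> 'M[F]_m.+1).
Let e0 : 'rV[F]_m.+1 := delta_mx 0 0.

Lemma lift_word_dvd L (P : finType) (Y : 'rV[{poly F}]_m.+1)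
    (w : {ffun P -> 'I_m.+1}) t : repeated w = Some t ->
  (forall i : 'I_m, 'X^L %| 'X * Y 0 (lift ord0 i) ^+ 2
                      + qform (map_mx polyC (Q i)) Y) ->
  'X^L %| 'X * word_eval Y w + \sum_a \sum_b
     (Q t.2 a b)%:P * word_eval Y (subst2 w t.1.1 t.1.2 a b).
Proof.
move=> rep HY.
have [c] := word_eval_repeated (fun i => map_mx polyC (Q i)) Y 'X rep.
under eq_bigr do under eq_bigr do rewrite mxE.
by move=> ->; apply: dvdp_mull.
Qed.

(** The deformation terms vanish at [e0], so this point is an exact zero for every value of 'X and
    needs no regularity. *)
Let e0_lift L (i : 'I_m) : qform (Q i) e0 = 0 ->
  'X^L %| 'X * (map_mx polyC e0 : 'rV_m.+1) 0 (lift ord0 i) ^+ 2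
                      + qform (map_mx polyC (Q i)) (map_mx polyC e0).
Proof.
move=> q0; rewrite -map_qform q0 rmorph0 addr0 !mxE /= expr0n mulr0 .
exact: dvdp0.
Qed.

Lemma bezout_e0 r (z : 'I_r -> 'rV[F]_m.+1) : r = (2 ^ m)%N ->
  (forall j, regular_zero Q (z j)) -> (forall i, qform (Q i) e0 = 0) ->
  (forall j j', j != j' -> separated (z j) (z j')) ->
  (forall j, separated (z j) e0 /\ separated e0 (z j)) -> False.
Proof.
move=> Er zreg e0z sepz sepe.
have [L HL] := words_dependent (option 'I_r) Q.
have lift_z j := newton_lift (zreg j).1 (zreg j).2 L.
have [Y HY] := fin_all_exists lift_z.
pose Y' (j : option 'I_r) := if j is Some j' then Y j' else map_mx polyC e0.
pose z' (j : option 'I_r) := if j is Some j' then z j' else e0.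
have Y'0 j a : (Y' j 0 a).[0] = z' j 0 a.
  by case: j => [j|] /=; [exact: (HY j).1|rewrite mxE hornerC].
have [||w w' rep rep' el|c [[j0 cj0] Hc]] := HL _ (fun j => word_eval (Y' j)).
- by rewrite card_option card_ord Er.
- move=> j w t rep; apply: lift_word_dvd => // i.
  by case: j => [j|] /=; [exact: (HY j).2|exact: e0_lift].
- exact: word_eval_letters.
have sep' i j : i != j -> separated (z' i) (z' j).
  case: i j => [i|] [j|] // nij; rewrite /z'; first exact: sepz.
    exact: (sepe i).1.
  exact: (sepe j).2.
have ex_l p : exists l : 'cV[F]_m.+1,
   (p != j0 -> (z' p *m l) 0 0 = 0) /\ (z' j0 *m l) 0 0 <> 0.
  have [->|np] := eqVneq p j0; last by have [l [? ?]] := sep' _ _ np; exists l.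
  (* At position [j0] any form not vanishing at [z' j0] will do; it is borrowed from another
     point. *)
  have [q nq] : exists q, q != j0.
    have : (0 < #|predC1 j0|)%N.
      have r_gt0 : (0 < r)%N by rewrite Er expn_gt0.
      by have := cardC1 j0; rewrite card_option card_ord => ->.
    by case/card_gt0P => q; rewrite inE => ?; exists q.
  by have [l [_ ?]] := sep' _ _ nq; exists l.
have [l Hl] := fin_all_exists ex_l.
have : \sum_(w : {ffun option 'I_r -> 'I_m.+1})
    (\prod_p l p (w p) 0) * (\sum_j c j * (word_eval (Y' j) w).[0]) = 0.
  by rewrite big1 // => w _; rewrite Hc mulr0.
under eq_bigr do rewrite mulr_sumr.
rewrite exchange_big /= (bigD1 j0) //= [X in _ + X]big1 => [|j nj].
  under eq_bigr do rewrite mulrCA (horner_word_eval _ (Y'0 j0)).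
  rewrite -mulr_sumr word_eval_pairing addr0 => /eqP.
  rewrite mulf_eq0 (negbTE cj0) /= => /prodf_eq0[p _ /eqP].
  exact: (Hl p).2.
under eq_bigr do rewrite mulrCA (horner_word_eval _ (Y'0 j)).
rewrite -mulr_sumr word_eval_pairing (bigD1 j) //= (Hl j).1 //.
by rewrite mul0r mulr0.
Qed.

(* The second point at [e0] is replaced by the derivative [D] of the evaluation
   at [e0] in the direction [v]: as [e0 + 'X^(L+1) v] is a zero up to
   ['X^(2L+2)], [D] satisfies the same congruences as an evaluation. *)
Lemma bezout_double_e0 r (z : 'I_r -> 'rV[F]_m.+1) v : r.+1 = (2 ^ m)%N ->
  (forall j, regular_zero Q (z j)) -> (forall i, qform (Q i) e0 = 0) ->
  (forall i, bform (Q i) e0 v = 0) -> separated e0 v ->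
  (forall j j', j != j' -> separated (z j) (z j')) ->
  (forall j, separated (z j) e0 /\ separated e0 (z j)) -> False.
Proof.
move=> Er zreg e0z e0v sepv sepz sepe.
pose J := option (option 'I_r).
have [L HL] := words_dependent J Q.
have lift_z j := newton_lift (zreg j).1 (zreg j).2 L.
have [Y HY] := fin_all_exists lift_z.
pose E0 : 'rV[{poly F}]_m.+1 := map_mx polyC e0.
pose V : 'rV[{poly F}]_m.+1 := map_mx polyC v.
pose Yv := E0 + 'X^(L.+1) *: V.
have E0i (i : 'I_m) : E0 0 (lift ord0 i) = 0 by rewrite !mxE.
have dvdv (w : {ffun J -> 'I_m.+1}) : exists D : {poly F},
    word_eval Yv w - word_eval E0 w = D * 'X^(L.+1).
  apply/dvdpP; apply: (big_rec2 (fun a b => 'X^(L.+1) %| a - b)).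
    by rewrite subrr dvdp0.
  move=> p a b _ dvd_ab; rewrite [Yv _ _]mxE.
  have -> : (E0 0 (w p) + ('X^(L.+1) *: V) 0 (w p)) * a - E0 0 (w p) * b =
      E0 0 (w p) * (a - b) + 'X^(L.+1) * (V 0 (w p) * a).
    by rewrite [('X^(L.+1) *: V) _ _]mxE; ring.
  by apply: dvdp_add; [apply: dvdp_mull|apply: dvdp_mulr].
have [D HD] := fin_all_exists dvdv.
have XL0 : 'X^(L.+1) != 0 :> {poly F} by rewrite expf_eq0 polyX_eq0 andbF.
pose e (j : J) : {ffun J -> 'I_m.+1} -> {poly F} :=
  if j is Some j' then if j' is Some j'' then word_eval (Y j'') else D
  else word_eval E0.
have [||j w w' rep rep' el|c [[j0 cj0] Hc]] := HL _ e.
- by rewrite !card_option card_ord Er.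
- case=> [[j|]|] w t rep.
  + by apply: lift_word_dvd => // i; exact: (HY j).2.
  + suff : 'X^(L.+1) %| 'X * D w + \sum_a \sum_b
       (Q t.2 a b)%:P * D (subst2 w t.1.1 t.1.2 a b).
      by apply: dvdp_trans; apply: dvdp_exp2l.
    (* The congruence for [D] comes from subtracting those of [Yv] and [E0], valid to order 2L + 2,
       and cancelling 'X^(L+1). *)
    have Yv_dvd (i : 'I_m) : 'X^(L.+1 + L.+1) %| 'X * Yv 0 (lift ord0 i) ^+ 2
                      + qform (map_mx polyC (Q i)) Yv.
      rewrite qformD qformZ bformZ -map_qform e0z -map_bform e0v !rmorph0.
      rewrite mulr0 !add0r [Yv _ _]mxE E0i add0r [(_ *: V) _ _]mxE exprMn.
      rewrite mulrCA -mulrDr -exprM muln2 -addnn.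
      exact: dvdp_mulr.
    have dYv := lift_word_dvd rep Yv_dvd.
    have dE0 := lift_word_dvd rep (fun i => e0_lift (L.+1 + L.+1) (e0z i)).
    rewrite -(dvdp_mul2r _ _ XL0) -exprD; have := dvdp_sub dYv dE0.
    congr (_ %| _); rewrite mulrDl opprD addrACA; congr (_ + _).
      by rewrite -mulrA -HD mulrBr.
    rewrite mulr_suml -sumrB; apply: eq_bigr => a _.
    rewrite mulr_suml -sumrB; apply: eq_bigr => b _.
    by rewrite -mulrA -HD mulrBr.
  + by apply: lift_word_dvd => // i; exact: e0_lift.
- case: j => [[j|]|] /=; [exact: word_eval_letters| |exact: word_eval_letters].
  apply: (mulIf XL0); rewrite -!HD.
  by rewrite !(word_eval_letters _ rep rep' el).
pose pair (l : J -> 'cV[F]_m.+1) j :=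
  \sum_(w : {ffun J -> 'I_m.+1}) (\prod_p l p (w p) 0) * (e j w).[0].
have pair0 l : \sum_j c j * pair l j = 0.
  transitivity (\sum_(w : {ffun J -> 'I_m.+1})
      (\prod_p l p (w p) 0) * (\sum_j c j * (e j w).[0])); last first.
    by rewrite big1 // => w _; rewrite Hc mulr0.
  under [RHS]eq_bigr do rewrite mulr_sumr.
  rewrite exchange_big /=; apply: eq_bigr => j _.
  by rewrite mulr_sumr; apply: eq_bigr => w _; rewrite mulrCA.
have pairz l j : pair l (Some (Some j)) = \prod_p (z j *m l p) 0 0.
  rewrite -word_eval_pairing; apply: eq_bigr => w _; congr (_ * _).
  exact: horner_word_eval (HY j).1.
have paire l : pair l None = \prod_p (e0 *m l p) 0 0.
  rewrite -word_eval_pairing; apply: eq_bigr => w _; congr (_ * _).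
  by apply: horner_word_eval => a; rewrite mxE hornerC.
(* Leibniz rule: when the form at [p1] vanishes at [e0], only the term differentiating this factor
   survives. *)
have pairD l p1 : (e0 *m l p1) 0 0 = 0 -> pair l (Some None) =
    (v *m l p1) 0 0 * \prod_(p | p != p1) (e0 *m l p) 0 0.
  move=> l1; pose lP p : 'cV[{poly F}]_m.+1 := map_mx polyC (l p).
  have EP (x : 'rV[F]_m.+1) p :
      (map_mx polyC x *m lP p) 0 0 = ((x *m l p) 0 0)%:P.
    by rewrite -map_mxM mxE.
  have YvP p : (Yv *m lP p) 0 0 =
      ((e0 *m l p) 0 0)%:P + 'X^(L.+1) * ((v *m l p) 0 0)%:P.
    by rewrite mulmxDl -scalemxAl mxE EP [X in _ + X]mxE EP.
  have : (\sum_(w : {ffun J -> 'I_m.+1}) (\prod_p lP p (w p) 0) * D w) * 'X^(L.+1) =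
     \prod_p (Yv *m lP p) 0 0 - \prod_p (E0 *m lP p) 0 0.
    rewrite -!word_eval_pairing -sumrB mulr_suml; apply: eq_bigr => w _.
    by rewrite -mulrA -HD mulrBr.
  rewrite [X in X - _](bigD1 p1) //= [X in _ - X](bigD1 p1) //=.
  rewrite EP l1 YvP l1 polyC0 mul0r subr0 add0r -mulrA [RHS]mulrC => /(mulIf XL0).
  move/(congr1 (horner_eval 0)); rewrite /horner_eval horner_sum hornerM hornerC.
  rewrite horner_prod => Esum; transitivity ((v *m l p1) 0 0 *
      \prod_(p | p != p1) ((Yv *m lP p) 0 0).[0]).
    rewrite -Esum; apply: eq_bigr => w _; rewrite hornerM horner_prod; congr (_ * _).
    by apply: eq_bigr => p _; rewrite mxE hornerC.
  congr (_ * _); apply: eq_bigr => p _; rewrite YvP !hornerE.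
  by rewrite exprS mul0r mul0r addr0.
(* The forms at the two positions [None] and [Some None] both vanish at [e0]: a double zero there
   kills the evaluation and the derivative together. *)
have cz j : c (Some (Some j)) = 0.
  have ex_l (p : J) : exists l : 'cV[F]_m.+1, (z j *m l) 0 0 <> 0 /\
     match p with Some (Some j') => j' != j -> (z j' *m l) 0 0 = 0
                | _ => (e0 *m l) 0 0 = 0 end.
    have [l [le lz]] := (sepe j).2.
    case: p => [[j'|]|]; [|by exists l..].
    have [_|/sepz[l' [? ?]]] := eqVneq j' j; first by exists l.
    by exists l'.
  have [l Hl] := fin_all_exists ex_l.
  have := pair0 l; rewrite (bigD1 (Some (Some j))) //= big1 => [|[[j'|]|] nj].
  - rewrite addr0 pairz => /eqP; rewrite mulf_eq0 => /orP[/eqP //|].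
    by move=> /prodf_eq0[p _ /eqP]; case: (Hl p).
  - rewrite pairz (bigD1 (Some (Some j'))) //=.
    rewrite (Hl (Some (Some j'))).2 ?mul0r ?mulr0 //.
  - rewrite (pairD l None (Hl None).2) (bigD1 (Some None)) //=.
    by rewrite (Hl (Some None)).2 mul0r !mulr0.
  - by rewrite paire (bigD1 None) //= (Hl None).2 mul0r mulr0.
have [lv [lve lvv]] := sepv.
(* With [b] true the product of forms vanishes at [e0] but its derivative along [v] does not, which
   isolates [D]; with [b] false it does not vanish at [e0]. *)
pose good_l b (p : J) (l : 'cV[F]_m.+1) : Prop :=
  if b && (p == None) then (e0 *m l) 0 0 = 0 /\ (v *m l) 0 0 <> 0
  else (e0 *m l) 0 0 <> 0.
have ex_l b p : exists l, good_l b p l.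
  rewrite /good_l; case: (b && _); first by exists lv.
  exists (delta_mx 0 0); rewrite mulmx_e0 mxE !eqxx.
  by apply/eqP; rewrite oner_neq0.
have [l Hl] : exists l, forall p, good_l true p (l p).
  exact: fin_all_exists (ex_l true).
have cD : c (Some None) = 0.
  have := pair0 l; rewrite (bigD1 (Some None)) //= big1 => [|[[j'|]|] nj //].
  - rewrite addr0 (pairD l None (Hl None).1) => /eqP.
    rewrite mulf_eq0 => /orP[/eqP //|]; rewrite mulf_eq0.
    move=> /orP[/eqP /(Hl None).2 //|/prodf_eq0[p np /eqP]].
    by have := Hl p; rewrite /good_l (negbTE np).
  - by rewrite cz mul0r.
  - by rewrite paire (bigD1 None) //= (Hl None).1 mul0r mulr0.
have [l' Hl'] : exists l, forall p, good_l false p (l p).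
  exact: fin_all_exists (ex_l false).
have c0 : c None = 0.
  have := pair0 l'; rewrite (bigD1 None) //= big1 => [|[[j'|]|] nj //].
  - rewrite addr0 paire => /eqP; rewrite mulf_eq0 => /orP[/eqP //|].
    by move=> /prodf_eq0[p _ /eqP /(Hl' p)].
  - by rewrite cz mul0r.
  - by rewrite cD mul0r.
by case: j0 cj0 => [[j|]|]; rewrite ?cz ?cD ?c0 eqxx.
Qed.
End Bezout.

(** Serves to move an arbitrary zero to [e0] by a linear change of coordinates; the rank one
    decomposition of [z] provides the matrix. *)
Lemma row_complete (F : fieldType) n (z : 'rV[F]_n.+1) : z != 0 ->
  exists2 T : 'M[F]_n.+1, T \in unitmx & z = delta_mx 0 0 *m T.
Proof.
move=> z0; have rk : \rank z = 1 by rewrite rank_rV z0.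
exists (col_ebase z 0 0 *: row_ebase z).
  rewrite unitmxZ ?row_ebase_unit // unitfE.
  have := col_ebase_unit z; rewrite unitmxE det_mx11 unitfE.
  by [].
rewrite -[LHS]mulmx_ebase rk [col_ebase z]mx11_scalar mul_scalar_mx.
rewrite -scalemxAl -scalemxAr mxE eqxx mulr1n; congr (_ *: (_ *m _)).
by apply/rowP => j; rewrite !mxE eqxx [in RHS]eq_sym andbT.
Qed.

Section BezoutTransform.
Variables (F : fieldType) (m : nat) (Q : 'I_m -> 'M[F]_m.+1) (T : 'M[F]_m.+1).
Hypothesis uT : T \in unitmx.
Let Q' i := T *m Q i *m T^T.

Let qformT i z : qform (Q' i) z = qform (Q i) (z *m T).
Proof. by rewrite /qform trmx_mul !mulmxA. Qed.

Let bformT i y z : bform (Q' i) y z = bform (Q i) (y *m T) (z *m T).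
Proof. by rewrite /bform !trmx_mul !mulmxA. Qed.

Let regT z : regular_zero Q z -> regular_zero Q' (z *m invmx T).
Proof.
case=> z0 surj; split=> [i|r]; first by rewrite qformT mulmxKV.
have [w Hw] := surj r; exists (w *m invmx T) => i.
by rewrite bformT !mulmxKV.
Qed.

Let sepT (x y : 'rV[F]_m.+1) :
  separated x y -> separated (x *m invmx T) (y *m invmx T).
Proof. by case=> l Hl; exists (T *m l); rewrite !mulmxA !mulmxKV. Qed.

Lemma bezout_transform r (z : 'I_r -> 'rV[F]_m.+1) (z0 := delta_mx 0 0 *m T) :
  r = (2 ^ m)%N ->
  (forall j, regular_zero Q (z j)) -> (forall i, qform (Q i) z0 = 0) ->
  (forall j j', j != j' -> separated (z j) (z j')) ->
  (forall j, separated (z j) z0 /\ separated z0 (z j)) -> False.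
Proof.
move=> Er zreg zz sepz sep0.
apply: (@bezout_e0 F m Q' r (fun j => z j *m invmx T)) => // [j|i|j j' nj|j].
- exact: regT.
- by rewrite qformT.
- by apply: sepT; exact: sepz.
- rewrite (_ : delta_mx 0 0 = z0 *m invmx T); last by rewrite mulmxK.
  by have [? ?] := sep0 j; split; apply: sepT.
Qed.

Lemma bezout_double_transform r (z : 'I_r -> 'rV[F]_m.+1) v
    (z0 := delta_mx 0 0 *m T) :
  r.+1 = (2 ^ m)%N ->
  (forall j, regular_zero Q (z j)) -> (forall i, qform (Q i) z0 = 0) ->
  (forall i, bform (Q i) z0 v = 0) -> separated z0 v ->
  (forall j j', j != j' -> separated (z j) (z j')) ->
  (forall j, separated (z j) z0 /\ separated z0 (z j)) -> False.
Proof.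
move=> Er zreg zz zv sepv sepz sep0.
have Ez0 : delta_mx 0 0 = z0 *m invmx T by rewrite mulmxK.
apply: (@bezout_double_e0 F m Q' r (fun j => z j *m invmx T) (v *m invmx T))
    => // [j|i|i||j j' nj|j].
- exact: regT.
- by rewrite qformT.
- by rewrite bformT mulmxKV.
- by rewrite Ez0; apply: sepT.
- by apply: sepT; exact: sepz.
- by rewrite Ez0; have [? ?] := sep0 j; split; apply: sepT.
Qed.
End BezoutTransform.

Lemma bezout (F : fieldType) m (Q : 'I_m -> 'M[F]_m.+1) r
    (z : 'I_r -> 'rV[F]_m.+1) (z0 : 'rV[F]_m.+1) :
  r = (2 ^ m)%N -> z0 != 0 ->
  (forall j, regular_zero Q (z j)) -> (forall i, qform (Q i) z0 = 0) ->
  (forall j j', j != j' -> separated (z j) (z j')) ->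
  (forall j, separated (z j) z0 /\ separated z0 (z j)) -> False.
Proof. by move=> Er /row_complete[T uT ->]; exact: bezout_transform. Qed.

Lemma bezout_double (F : fieldType) m (Q : 'I_m -> 'M[F]_m.+1) r
    (z : 'I_r -> 'rV[F]_m.+1) (z0 v : 'rV[F]_m.+1) :
  r.+1 = (2 ^ m)%N -> z0 != 0 ->
  (forall j, regular_zero Q (z j)) -> (forall i, qform (Q i) z0 = 0) ->
  (forall i, bform (Q i) z0 v = 0) -> separated z0 v ->
  (forall j j', j != j' -> separated (z j) (z j')) ->
  (forall j, separated (z j) z0 /\ separated z0 (z j)) -> False.
Proof. by move=> Er /row_complete[T uT ->]; exact: bezout_double_transform. Qed.

Section AffinePoints.
Variables (K : fieldType) (m : nat).
Implicit Types (x y : 'rV[K]_m.+1).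

(** The form u_a - x_a u_max vanishes at [x] because [x] is normalised. Leaving the last coordinate
    of [y] free covers points at infinity and tangent directions. *)
Lemma separated_affine x y a : x 0 ord_max = 1 ->
  y 0 a <> y 0 ord_max * x 0 a -> separated x y.
Proof.
move=> x1 ya; have na : a != ord_max.
  by apply/eqP => Ea; apply: ya; rewrite Ea x1 mulr1.
exists (delta_mx a 0 - x 0 a *: delta_mx ord_max 0).
have E u : (u *m (delta_mx a 0 - x 0 a *: delta_mx ord_max 0) : 'M[K]_1) 0 0 =
    u 0 a - x 0 a * u 0 ord_max.
  by rewrite mulmxBr -scalemxAr -!colE !mxE.
rewrite !E x1 mulr1 subrr; split=> // /eqP; rewrite subr_eq0 => /eqP.
by rewrite mulrC => /ya.
Qed.

Lemma separated_infinity x y : x 0 ord_max = 0 -> y 0 ord_max = 1 ->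
  separated x y.
Proof.
move=> x0 y1; exists (delta_mx ord_max 0); rewrite -!colE !mxE x0 y1.
by split=> //; apply/eqP; rewrite oner_neq0.
Qed.
End AffinePoints.

(** * The lambda-derivative of a simple eigenvalue *)

(** There are [size chi] products, and their remainders modulo [chi] have only [size chi - 1]
    coefficients. As [chi] is monic, the division takes place over the domain [A] itself. *)
Lemma powers_dependent (A : idomainType) (chi a b : {poly A}) :
  chi \is monic ->
  exists u : 'I_(size chi) -> A, (exists i, u i != 0) /\
    exists g, \sum_i (u i)%:P * (b ^+ i * a ^+ (size chi - i)) = g * chi.
Proof.
move=> mchi; set s := size chi.
have chi0 : chi != 0 by exact: monic_neq0.
have s_gt0 : (0 < s)%N by rewrite lt0n size_poly_eq0.
pose y (i : 'I_s) := b ^+ i * a ^+ (s - i).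
pose rem i := Pdiv.Ring.rmodp (y i) chi.
have sz_rem i : (size (rem i) <= s.-1)%N.
  by rewrite -ltnS prednK // Pdiv.Ring.ltn_rmodpN0.
have [|u [unz Hu]] := @idomain_dependent A s s.-1 (fun i l => (rem i)`_l).
  by rewrite prednK.
exists u; split=> //; exists (\sum_i (u i)%:P * Pdiv.Ring.rdivp (y i) chi).
under eq_bigr do rewrite -/(y _) (Pdiv.RingMonic.rdivp_eq mchi (y _)) mulrDr mulrA.
rewrite big_split /= -mulr_suml -[RHS]addr0; congr (_ + _).
apply/polyP => l; rewrite coef0 coef_sum.
have [lt_l|le_l] := ltnP l s.-1.
  by rewrite -[RHS](Hu (Ordinal lt_l)); apply: eq_bigr => i _; rewrite coefCM.
rewrite big1 // => i _; rewrite coefCM [_`_l]nth_default ?mulr0 //.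
exact: leq_trans (sz_rem i) le_l.
Qed.

Lemma meval_mwiden (R : comNzRingType) n (v : 'I_n.+1 -> R)
    (q : mpolynomial n R) :
  meval v (mwiden q) = meval (fun i => v (widen_ord (leqnSn n) i)) q.
Proof.
rewrite [q in LHS]mpolyE [q in RHS]mpolyE.
rewrite (raddf_sum (@mwiden n R)) !raddf_sum; apply: eq_bigr => m _ /=.
rewrite mwidenZ mwidenX !mevalZ !mevalX big_ord_recr /= mnmwiden_ordmax.
rewrite expr0 mulr1; congr (_ * _); apply: eq_bigr => i _.
by rewrite mnmwiden_widen.
Qed.

Lemma muni_mwiden (R : comNzRingType) n (q : mpolynomial n R) :
  muni (mwiden q) = q%:P.
Proof.
rewrite [q in LHS]mpolyE [q in RHS]mpolyE.
rewrite (raddf_sum (@mwiden n R)) !raddf_sum; apply: eq_bigr => m _ /=.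
rewrite mwidenZ muniZ mwidenX muniE msuppX big_seq1 mcoeffX eqxx scale1r.
rewrite mnmwiden_ordmax expr0 alg_polyC -mul_mpolyC polyCM mul_polyC; congr (_ *: (mpolyX R _)%:P).
by apply/mnmP => i; rewrite mnmE mnmwiden_widen.
Qed.

Lemma muni_mvar_max (R : comNzRingType) n :
  muni (mvar R ord_max : mpolynomial n.+1 R) = 'X.
Proof.
rewrite muniE msuppX big_seq1 mcoeffX eqxx scale1r mnm1E eqxx expr1.
rewrite [X in mpolyX R X](_ : _ = @mnm0 n) ?mpolyX0 ?scale1r //.
apply/mnmP => i; rewrite mnmE mnm1E mnmE.
by case: eqP => // /(congr1 val) /= Ei; have := ltn_ord i; rewrite -Ei ltnn.
Qed.

(* [powers_dependent] gives a relation between the [b ^ i * a ^ (s - i)] modulo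
   [chi], hence one between the powers of [v ord_max = - b / a]. *)
Lemma elimination (R : idomainType) n (chi a b : {poly mpolynomial n R}) :
  chi \is monic ->
  exists2 P : mpolynomial n.+1 R, P != 0 &
    forall (v : 'I_n.+1 -> R) (x : R),
      let ev p := (map_poly (meval (fun i => v (widen_ord (leqnSn n) i))) p).[x] in
      ev chi = 0 -> ev a != 0 -> ev a * v ord_max + ev b = 0 -> meval v P = 0.
Proof.
move=> mchi; have [u [[i0 ui0] [g Hg]]] := powers_dependent a b mchi.
exists (\sum_i mwiden (u i) * (- mvar R ord_max) ^+ i).
  (* Read as a polynomial in the last variable, it has coefficient [u i0] in degree [i0], up to
     sign. *)
  apply/eqP => /(congr1 (@muni n R)); rewrite raddf_sum raddf0 /= => /polyP/(_ i0).
  rewrite coef0 coef_sum (bigD1 i0) //= big1 => [|i ni].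
    rewrite rmorphM rmorphXn rmorphN /= muni_mwiden muni_mvar_max addr0 coefCM.
    rewrite exprNn -polyC1 -polyCN -polyC_exp coefCM coefXn eqxx mulr1.
    by move/eqP; rewrite mulf_eq0 (negbTE ui0) signr_eq0.
  rewrite rmorphM rmorphXn rmorphN /= muni_mwiden muni_mvar_max coefCM.
  rewrite exprNn -polyC1 -polyCN -polyC_exp coefCM coefXn eq_sym.
  by rewrite -val_eqE /= in ni; rewrite (negbTE ni) !mulr0.
move=> v x ev chi0 a0 aby.
have evM p q : ev (p * q) = ev p * ev q by rewrite /ev rmorphM hornerM.
have evX p i : ev (p ^+ i) = ev p ^+ i by rewrite /ev rmorphXn horner_exp.
have evC c : ev c%:P = meval (fun i => v (widen_ord (leqnSn n) i)) c.
  by rewrite /ev map_polyC hornerC.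
apply: (mulfI (expf_neq0 (size chi) a0)); rewrite mulr0 raddf_sum mulr_sumr /=.
have : ev (g * chi) = 0 by rewrite evM chi0 mulr0.
have evS (p : 'I_(size chi) -> _) : ev (\sum_i p i) = \sum_i ev (p i).
  by rewrite /ev rmorph_sum horner_sum.
rewrite -Hg evS => E0; rewrite -[RHS]E0; apply: eq_bigr => i _.
rewrite !evM !evX evC rmorphM rmorphXn rmorphN /= mevalXU meval_mwiden.
have -> : ev b = - v ord_max * ev a.
  by apply/eqP; rewrite -subr_eq0 mulNr opprK addrC mulrC aby.
have -> : ev a ^+ size chi = ev a ^+ i * ev a ^+ (size chi - i).
  by rewrite -exprD subnKC // ltnW.
rewrite exprMn.
by ring.
Qed.

(** At a simple eigenvalue 0 the adjugate of [- J] is a nonzero multiple of the projection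
    [v *m vs^T]. This expresses the entry of [J'] through traces that are polynomial in [J] and
    [J'], without eigenvectors. *)
Lemma simple_adj (F : fieldType) p (J J' : 'M[F]_p) (v vs : 'cV[F]_p) :
  (forall y : 'cV[F]_p, J *m y = 0 -> exists c : 'M[F]_1, y = v *m c) ->
  (forall y : 'cV[F]_p, y^T *m J = 0 -> exists c : 'M[F]_1, y = vs *m c) ->
  vs^T *m v = 1%:M -> vs^T *m J = 0 -> mup 0 (char_poly J) = 1%N ->
  \tr (\adj (- J)) != 0 /\
  \tr (\adj (- J) *m J') = \tr (\adj (- J)) * (vs^T *m J' *m v) 0 0.
Proof.
move=> kerJ kerJT vsv vsJ mup1; set A := \adj (- J).
pose b := map_mx polyC vs^T *m \adj (char_poly_mx J) *m map_mx polyC v.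
(* As [vs^T] is killed by [J], it multiplies 'X - J to 'X times itself, so 'X splits off from the
   characteristic polynomial. The cofactor at 0 is the scalar [kap] below; its vanishing would make
   the root 0 multiple. *)
have chiE : char_poly J = b 0 0 * 'X.
  have : map_mx polyC vs^T *m char_poly_mx J *m \adj (char_poly_mx J)
      *m map_mx polyC v = (char_poly J)%:M.
    rewrite -[_ *m _ *m \adj _]mulmxA mul_mx_adj -/(char_poly J).
    by rewrite mul_mx_scalar -scalemxAl -map_mxM vsv map_mx1 scale_scalar_mx mulr1.
  rewrite /char_poly_mx mulmxBr -map_mxM vsJ map_mx0 subr0 mul_mx_scalar.
  rewrite -!scalemxAl -/(char_poly_mx J) -/b => /(congr1 (fun M : 'M[{poly F}]_1 => M 0 0)).
  by rewrite !mxE eqxx mulr1n mulrC.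
have b0 : (b 0 0).[0] = (vs^T *m A *m v) 0 0.
  rewrite -[LHS]/(horner_eval 0 (b 0 0)).
  transitivity ((map_mx (horner_eval 0) b) 0 0); first by rewrite [RHS]mxE.
  rewrite !map_mxM map_mx_adj /A; congr ((_ *m \adj _ *m _) 0 0).
  - by apply/matrixP => i j; rewrite !mxE /= /horner_eval hornerC.
  - apply/matrixP => i j; rewrite !mxE /= /horner_eval !hornerE.
    by rewrite hornerMn hornerX mul0rn sub0r.
  - by apply/matrixP => i j; rewrite !mxE /= /horner_eval hornerC.
have detJ : \det (- J) = 0.
  apply/eqP/det0P; exists vs^T; last by rewrite mulmxN vsJ oppr0.
  apply/eqP => vs0; move: vsv; rewrite vs0 mul0mx => /matrixP/(_ 0 0)/eqP.
  by rewrite !mxE eq_sym oner_eq0.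
have JA : J *m A = 0.
  have := mul_mx_adj (- J); rewrite detJ mulNmx => /eqP.
  by rewrite raddf0 oppr_eq0 => /eqP.
have AJ : A *m J = 0.
  have := mul_adj_mx (- J); rewrite detJ mulmxN => /eqP.
  by rewrite raddf0 oppr_eq0 => /eqP.
(* [J A = 0] puts the columns of [A] on the line of [v], and [A J = 0] its rows on that of [vs]. *)
have AE : A = v *m (vs^T *m A).
  have colA j : col j A = v *m (vs^T *m col j A).
    have /kerJ[c ->] : J *m col j A = 0 by rewrite colE mulmxA JA mul0mx.
    by rewrite [vs^T *m _]mulmxA vsv mul1mx.
  apply/matrixP => i j; transitivity (col j A i 0); first by rewrite [RHS]mxE.
  transitivity (col j (v *m (vs^T *m A)) i 0); last by rewrite [LHS]mxE.
  by rewrite colA !colE !mulmxA.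
have AE' : A = A *m v *m vs^T.
  have rowA i : row i A = row i A *m v *m vs^T.
    have /kerJT[c /(congr1 trmx)] : (row i A)^T^T *m J = 0.
      by rewrite trmxK rowE -mulmxA AJ mulmx0.
    by rewrite trmxK trmx_mul => ->; rewrite -[_ *m v]mulmxA vsv mulmx1.
  apply/matrixP => i j; transitivity (row i A 0 j); first by rewrite [RHS]mxE.
  transitivity (row i (A *m v *m vs^T) 0 j); last by rewrite [LHS]mxE.
  by rewrite rowA !rowE !mulmxA.
pose kap := (vs^T *m A *m v) 0 0.
have AK : A = kap *: (v *m vs^T).
  rewrite {1}AE scalemxAr; congr (_ *m _).
  rewrite {1}AE' !mulmxA [vs^T *m A *m v]mx11_scalar -/kap.
  by rewrite mul_scalar_mx.
have trK : \tr A = kap.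
  by rewrite AK mxtraceZ mxtrace_mulC vsv mxtrace1 mulr1.
rewrite trK; split; last first.
  rewrite AK -scalemxAl mxtraceZ -mulmxA mxtrace_mulC; congr (_ * _).
  by rewrite (mulmxA J') mxtrace_mulC [X in \tr X]mx11_scalar mxtrace_scalar mulr1n.
apply/eqP => kap0; have : (1 < mup 0 (char_poly J))%N.
  rewrite mup_geq ?monic_neq0 ?char_poly_monic // polyC0 subr0 chiE expr2.
  rewrite dvdp_mul2r ?polyX_eq0 // (_ : 'X = 'X - 0%:P).
    by rewrite dvdp_XsubCl rootE b0 -/kap kap0.
  by rewrite polyC0 subr0.
by rewrite mup1.
Qed.

(* [(j, b)] stands for the partial derivative in the argument [j], followed by
   one in [lambda] when [b] holds. *)
Definition lambda_index k (jb : 'I_k.+1 * bool) : {ffun 'I_k.+2 -> nat} :=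
  [ffun j => ((j == lift ord_max jb.1) + (jb.2 && (j == ord_max)))%N].

Lemma lambda_index_inj k : injective (@lambda_index k).
Proof.
move=> [i b] [j c] /ffunP E; have := E ord_max; rewrite !ffunE !eqxx /=.
rewrite !(negbTE (neq_lift _ _)) !andbT !add0n => Ebc.
have -> : b = c by case: b c Ebc {E} => [] [].
congr pair; have := E (lift ord_max i); rewrite !ffunE /= eqxx.
rewrite [_ == ord_max]eq_sym (negbTE (neq_lift _ _)) !andbF !addn0.
by case: eqP => // /lift_inj.
Qed.

Lemma widen_lift n (i : 'I_n) : widen_ord (leqnSn n) i = lift ord_max i.
Proof. by apply: val_inj; rewrite /= /bump leqNgt ltn_ord. Qed.

(** [ord_max] comes last in the enumeration, hence innermost in the fold: the derivative in lambda
    is taken first, as in [lambda_part]. *)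
Lemma mpartial_lambda_index (R : realType) k (i : 'I_k.+1) b
    (f : 'rV[R]_k.+2 -> R) :
  mpartial (lambda_index (i, b)) f =
  partial (lift ord_max i) (if b then partial ord_max f else f).
Proof.
rewrite /mpartial enum_ordSr -cats1 foldr_cat /= ffunE eqxx andbT.
rewrite (negbTE (neq_lift _ _)) add0n.
set g := iter b _ _; have -> : (if b then partial ord_max f else f) = g.
  by rewrite /g {g}; case: b.
rewrite foldr_map.
have Eidx (j : 'I_k.+1) : lambda_index (i, b) (widen_ord (leqnSn k.+1) j) = (j == i).
  rewrite ffunE widen_lift (inj_eq lift_inj) [_ == ord_max]eq_sym.
  by rewrite (negbTE (neq_lift _ _)) andbF addn0.
have fold0 s : i \notin s -> foldr (fun x z =>
    iter (lambda_index (i, b) (widen_ord (leqnSn k.+1) x))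
      (partial (widen_ord (leqnSn k.+1) x)) z) g s = g.
  elim: s => //= j s IHs; rewrite inE negb_or => /andP[ij /IHs ->].
  by rewrite Eidx eq_sym (negbTE ij).
have : i \in enum 'I_k.+1 by rewrite mem_enum.
have : uniq (enum 'I_k.+1) by exact: enum_uniq.
elim: (enum _) => //= j s IHs /andP[js us]; rewrite inE Eidx => /predU1P[ij|i_s].
  by rewrite -ij eqxx fold0 ?ij //= widen_lift.
rewrite IHs //; case: eqP => // ji; by rewrite ji i_s in js.
Qed.

Definition lambda_part (R : realType) k (f : 'rV[R]_k.+2 -> R) : 'rV[R]_k.+1 :=
  \row_j partial (lift ord_max j) (partial ord_max f) 0.

Section SimpleDerivative.
Variables (R : realType) (k p : nat) (Q : network p k).

(** The first [k] variables stand for f_1, ..., f_k and the last [k] for their lambda-derivatives.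
    The indeterminate of [{poly A}] is f_0, so that [PS] is the Jacobian with f_0 left free. *)
Let A := mpolynomial (k + k) R.
Let var (t : 'I_(k + k)) : A := mvar R t.
Let S (sh : 'I_k -> 'I_(k + k)) : 'M[A]_p :=
  \sum_l var (sh l) *: map_mx (@mpolyC (k + k) R) (adjacency R Q l).
Let PS : 'M[{poly A}]_p := char_poly_mx (- S (@lshift k k)).

(** The last index is f_0lambda, the variable that [elimination] adds. *)
Let index (t : 'I_(k + k).+1) : 'I_k.+1 * bool :=
  if unlift ord_max t is Some t' then
    match fintype.split (t' : 'I_(k + k)) with inl l => (lift ord0 l, false)
                      | inr l => (lift ord0 l, true) end
  else (ord0, true).

Let index_inj : injective index.
Proof.
move=> t u; rewrite /index; case: unliftP => [t'|] ->; case: unliftP => [u'|] ->.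
- case: fintype.splitP => i Ei; case: fintype.splitP => j Ej // /(congr1 fst)/lift_inj Eij;
  by congr lift; apply: val_inj; rewrite /= Ei Ej Eij.
- by case: fintype.split.
- by case: fintype.split.
- by [].
Qed.

(* If the entry vanishes, then [tr (adj (- J)) f_0lambda + tr (adj (- J) S') = 0],
   where [f_0lambda + S'] is the jacobian of [lambda_part f], [J = f_0 + S] and
   [- f_0] is a root of the characteristic polynomial of [S].  Eliminating [f_0],
   which no nondegeneracy condition may involve, gives a polynomial relation
   between [f_0lambda] and the other derivatives. *)
Lemma simple_derivative_generic : exists c : nondegeneracy R k, forall f,
  nd_holds c f -> let J := Defs.jacobian Q (linear_part f) in
  forall v vs : 'cV[R]_p,
  (forall y : 'cV[R]_p, J *m y = 0 -> exists c : 'M[R]_1, y = v *m c) ->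
  (forall y : 'cV[R]_p, y^T *m J = 0 -> exists c : 'M[R]_1, y = vs *m c) ->
  vs^T *m v = 1%:M -> vs^T *m J = 0 -> mup 0 (char_poly J) = 1%N ->
  (vs^T *m Defs.jacobian Q (lambda_part f) *m v) 0 0 <> 0.
Proof.
have [P P0 HP] := elimination (\tr (\adj (- PS)))
  (\tr (\adj (- PS) *m map_mx polyC (S (@rshift k k))))
  (char_poly_monic (- S (@lshift k k))).
pose nd t := lambda_index (index t).
have nd_inj : injective nd by move=> t u /lambda_index_inj /index_inj.
have nd_f0 t : nd t <> [ffun j => nat_of_bool (j == ord0)].
  rewrite /nd /index => /ffunP E; have := E (lift ord_max (index t).1).
  rewrite /index; case: unliftP E => [t' _|_] E; last first.
    by have := E ord_max; rewrite !ffunE !eqxx /=.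
  case: fintype.splitP => l _ {E}; rewrite !ffunE eqxx;
  by rewrite -[X in _ = nat_of_bool X]val_eqE /= /bump leqNgt ltnS ltn_ord.
have nd_lam t : exists j, j != ord_max /\ nd t j <> 0%N.
  exists (lift ord_max (index t).1); rewrite eq_sym neq_lift; split=> //.
  by rewrite ffunE eqxx.
exists (Nondegeneracy nd_inj nd_f0 nd_lam (elimN eqP P0)) => f.
rewrite /nd_holds /=; set val := (X in meval X _) => nz v vs.
set J := Defs.jacobian Q _ => kerJ kerJT vsv vsJ mup1 c0; apply: nz.
pose w (t : 'I_(k + k)) := val (widen_ord (leqnSn (k + k)) t).
pose x := linear_part f 0 ord0.
pose ev : {rmorphism {poly A} -> R} := horner_eval x \o map_poly (meval w).
have valE t : val t = mpartial (nd t) f 0 by [].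
have wl l : w (lshift k l) = linear_part f 0 (lift ord0 l).
  rewrite /w valE /nd /index widen_lift liftK (unsplitK (inl l)).
  by rewrite mpartial_lambda_index mxE.
have wr l : w (rshift k l) = lambda_part f 0 (lift ord0 l).
  rewrite /w valE /nd /index widen_lift liftK (unsplitK (inr l)).
  by rewrite mpartial_lambda_index mxE.
have valmax : val ord_max = lambda_part f 0 ord0.
  by rewrite valE /nd /index unlift_none mpartial_lambda_index mxE.
have evC (c : A) : ev c%:P = meval w c.
  by rewrite /= map_polyC /horner_eval hornerC.
have evS sh : map_mx ev (map_mx polyC (S sh)) =
    \sum_l w (sh l) *: adjacency R Q l.
  apply/matrixP => i j; rewrite 2!mxE evC !summxE raddf_sum.
  apply: eq_bigr => l _.
  by rewrite !mxE /= mevalM mevalXU mevalC.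
have evPS : map_mx ev PS = J.
  rewrite /PS /char_poly_mx map_mxN opprK map_mxD map_scalar_mx evS.
  rewrite /J /Defs.jacobian /= map_polyX /horner_eval hornerX; congr (_ + _).
  by apply: eq_bigr => l _; rewrite wl.
have ev_adj : map_mx ev (\adj (- PS)) = \adj (- J).
  by rewrite map_mx_adj map_mxN evPS.
have E1 : ev (\tr (\adj (- PS))) = \tr (\adj (- J)) by rewrite -trace_map_mx ev_adj.
have E2 : ev (\tr (\adj (- PS) *m map_mx polyC (S (@rshift k k)))) =
    \tr (\adj (- J) *m \sum_l lambda_part f 0 (lift ord0 l) *: adjacency R Q l).
  rewrite -trace_map_mx map_mxM ev_adj evS; congr (\tr (_ *m _)).
  by apply: eq_bigr => l _; rewrite wr.
have [trJ trJ'] := simple_adj (Defs.jacobian Q (lambda_part f))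
  kerJ kerJT vsv vsJ mup1.
have detJ : \det J = 0.
  apply/eqP/det0P; exists vs^T => //; apply/eqP => vs0.
  move: vsv; rewrite vs0 mul0mx => /matrixP/(_ 0 0)/eqP.
  by rewrite !mxE eq_sym oner_eq0.
apply: (HP val x).
- by rewrite -[LHS]/(ev (\det PS)) -det_map_mx evPS.
- by rewrite -[X in X != 0]/(ev (\tr (\adj (- PS)))) E1.
- rewrite -[X in X * _]/(ev (\tr (\adj (- PS)))) E1.
  rewrite -[X in _ + X]/(ev (\tr (\adj (- PS) *m _))) E2 valmax.
  transitivity (\tr (\adj (- J) *m Defs.jacobian Q (lambda_part f))).
    by rewrite /Defs.jacobian mulmxDr mul_mx_scalar mxtraceD mxtraceZ mulrC.
  by rewrite trJ' c0 mulr0.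
Qed.
End SimpleDerivative.

(** * Differential calculus *)

Lemma is_derive_line (R : realType) (V : normedModType R) (f : V -> R)
    (a v : V) (t : R) :
  derivable f (a + t *: v) v ->
  is_derive t 1 (fun s : R => f (a + s *: v)) ('D_v f (a + t *: v)).
Proof.
move=> df.
have E : (fun h : R => h^-1 *: (((fun s : R => f (a + s *: v)) \o shift t) (h *: 1)
    - f (a + t *: v))) =
   (fun h => h^-1 *: ((f \o shift (a + t *: v)) (h *: v) - f (a + t *: v))).
  by apply/funext => h /=; rewrite [h *: 1]mulr1 scalerDl addrCA.
by apply: DeriveDef; rewrite /derivable /derive E.
Qed.

Lemma mvt_line (R : realType) (V : normedModType R) (f : V -> R) (a v : V) c :
  (forall t, derivable f (a + t *: v) v) ->
  exists2 t : R, 0 <= t <= 1 &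
    f (a + c *: v) - f a = 'D_v f (a + (t * c) *: v) * c.
Proof.
move=> df; pose g (t : R) := f (a + (t * c) *: v).
have dg (t : R) : is_derive t (1 : R) g ('D_v f (a + (t * c) *: v) * c).
  apply: (@is_derive1_comp _ (fun s => f (a + s *: v)) ( *%R^~ c)).
    exact: is_derive_line.
  have := is_deriveM (is_derive_id t (1 : R)) (is_derive_cst c t (1 : R)).
  by rewrite scaler0 add0r [c *: 1]mulr1.
have [|t t01] := @MVT_segment R g _ 0 1 ler01 (fun t _ => dg t).
  by apply: derivable_within_continuous => t _; exact: (@ex_derive _ _ _ _ _ _ _ (dg t)).
rewrite /g mul1r mul0r scale0r addr0 subr0 mulr1 => ->; exists t => //.
Qed.

Lemma mx_coord_le_norm (R : realType) m n (x : 'M[R]_(m, n)) i j : `|x i j| <= `|x|.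
Proof.
by rewrite [leRHS]/Num.Def.normr/= mx_normrE; exact: (le_bigmax _ _ (i, j)).
Qed.

Lemma mx_norm_le_coord (R : realType) m n (x : 'M[R]_(m, n)) (e : R) : 0 <= e ->
  (forall i j, `|x i j| <= e) -> `|x| <= e.
Proof.
move=> e0 xe; rewrite [leLHS]/Num.Def.normr/= mx_normrE.
by apply: bigmax_le => // -[i j] _ /=.
Qed.

(* Changing the coordinates one at a time needs the partial derivatives only. *)
Lemma mvt_coord (R : realType) d (f : 'rV[R]_d -> R) (a b : 'rV[R]_d) :
  (forall i x, derivable f x (delta_mx 0 i)) ->
  exists xi : 'I_d -> 'rV[R]_d,
    (forall i, `|xi i - a| <= `|b - a|) /\
    f b - f a = \sum_i partial i f (xi i) * (b 0 i - a 0 i).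
Proof.
move=> df; pose c (n : nat) : 'rV[R]_d := \row_j (if (j < n)%N then b 0 j else a 0 j).
have cS (i : 'I_d) : c i.+1 = c i + (b 0 i - a 0 i) *: delta_mx 0 i.
  apply/rowP => j; rewrite !mxE eqxx /= ltnS leq_eqVlt.
  have [->|nij] := eqVneq j i; first by rewrite eqxx ltnn mulr1 addrC subrK.
  by rewrite -val_eqE in nij; rewrite (negbTE nij) mulr0 addr0.
have ex (i : 'I_d) : exists x, `|x - a| <= `|b - a| /\
    f (c i.+1) - f (c i) = partial i f x * (b 0 i - a 0 i).
  have [t /andP[t0 t1] Et] := mvt_line (b 0 i - a 0 i) (fun t => df i (c i + t *: _)).
  exists (c i + (t * (b 0 i - a 0 i)) *: delta_mx 0 i); split; last by rewrite cS Et.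
  apply: mx_norm_le_coord => // i' j; rewrite (ord1 i') !mxE eqxx /=.
  have [->|nij] := eqVneq j i.
    rewrite ltnn mulr1 addrAC subrr add0r normrM (ger0_norm t0).
    apply: le_trans (_ : `|b 0 i - a 0 i| <= _); first by rewrite ler_piMl.
    by have := mx_coord_le_norm (b - a) 0 i; rewrite !mxE.
  rewrite mulr0 addr0; case: ifP => _; last by rewrite subrr normr0.
  by have := mx_coord_le_norm (b - a) 0 j; rewrite !mxE.
have [xi Hxi] := fin_all_exists ex.
exists xi; split=> [i|]; first exact: (Hxi i).1.
under eq_bigr do rewrite -(Hxi _).2.
rewrite -(big_mkord predT (fun i => f (c i.+1) - f (c i))) telescope_sumr //.
by congr (f _ - f _); apply/rowP => j; rewrite mxE ?ltn_ord.
Qed.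

Lemma differentiable_of_linear (R : realType) (V W : normedModType R) (f : V -> W)
    (x : V) (df : {linear V -> W}) : continuous df ->
  (forall e : R, 0 < e ->
     \forall h \near (0 : V), `|f (h + x) - f x - df h| <= e * `|h|) ->
  differentiable f x.
Proof.
move=> cdf Hf; have E : f \o shift x = cst (f x) + df +o_ 0 id.
  apply/eqaddoP => e e0; apply: filterS (Hf e e0) => h.
  by rewrite /= opprD addrA.
by apply/diff_locallyP; rewrite (diff_unique cdf E).
Qed.

Section StrictDerivative.
Variables (R : realType) (d : nat) (f : 'rV[R]_d -> R).
Hypothesis df : forall i x, derivable f x (delta_mx 0 i).

Lemma strict_derivative (x : 'rV[R]_d) (e : R) :
  (forall i, {for x, continuous (partial i f)}) -> 0 < e ->
  exists2 r : R, 0 < r & forall a b, `|a - x| < r -> `|b - x| < r ->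
    `|f b - f a - \sum_i partial i f x * (b 0 i - a 0 i)| <= e * `|b - a|.
Proof.
move=> cf e0; pose e' := e / d.+1%:R.
have e'0 : 0 < e' by rewrite divr_gt0.
have : \forall y \near x, forall i, `|partial i f x - partial i f y| <= e'.
  apply: (@filter_forall _ _ (fun i y => `|partial i f x - partial i f y| <= e')
    (nbhs x)) => i.
  by have /cvgrPdist_le := cf i; apply.
(* An intermediate point is within |b - a| + |a - x| of [x], hence within three times the chosen
   radius. *)
move/nbhs_normP => [r /= r0 Hr]; exists (r / 3%:R) => [|a b ax bx].
  by rewrite divr_gt0.
have [xi [xia ->]] := mvt_coord a b df.
rewrite -sumrB; apply: le_trans (ler_norm_sum _ _ _) _.
have -> : e * `|b - a| = \sum_(i < d.+1) e' * `|b - a|.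
  rewrite sumr_const card_ord -mulr_natr mulrAC; congr (_ * _).
  by rewrite divfK.
rewrite big_ord_recr /=; apply: ler_wpDr; first by rewrite mulr_ge0 // ltW.
apply: ler_sum => i _; rewrite -mulrBl normrM ler_pM //; last first.
  by have := mx_coord_le_norm (b - a) 0 i; rewrite !mxE.
rewrite distrC; apply: Hr; rewrite /= distrC.
apply: le_lt_trans (ler_distD a _ _) _.
apply: le_lt_trans (lerD (xia i) (lexx _)) _.
apply: le_lt_trans (lerD (ler_distD x b a) (lexx _)) _.
rewrite [`|x - a|]distrC.
rewrite (_ : r = r / 3%:R + r / 3%:R + r / 3%:R); last by field.
by rewrite !ltrD.
Qed.

Lemma differentiable_partial (x : 'rV[R]_d) :
  (forall i, {for x, continuous (partial i f)}) -> differentiable f x.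
Proof.
move=> cf; pose L (v : 'rV[R]_d) : R^o := \sum_i partial i f x * v 0 i.
have linL : linear L.
  move=> c u v; rewrite /L scaler_sumr -big_split /=; apply: eq_bigr => i _.
  by rewrite !mxE mulrDr; congr (_ + _); rewrite mulrCA.
pose LL := GRing.isLinear.Build _ _ _ _ L linL.
pose lin : {linear 'rV[R]_d -> R^o} := HB.pack L LL.
have cL : continuous lin.
  move=> y; apply: differentiable_continuous.
  rewrite (_ : (lin : _ -> R^o) = \sum_i (partial i f x \*: fun v : 'rV[R]_d => v 0 i)).
    by apply: differentiable_sum => i; apply: differentiableZ; exact: differentiable_coord.
  by apply/funext => v; rewrite fct_sumE.
apply: (differentiable_of_linear cL) => e e0.
have [r r0 Hr] := strict_derivative cf e0.
apply/nbhs_normP; exists r => // h /=; rewrite sub0r normrN => hr.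
have := Hr x (h + x); rewrite subrr normr0 addrK => /(_ r0 hr).
congr (`|_ - _| <= _).
by apply: eq_bigr => i _; rewrite mxE addrK.
Qed.

Lemma derive_partial (x v : 'rV[R]_d) : (forall i, {for x, continuous (partial i f)}) ->
  'D_v f x = \sum_i v 0 i * partial i f x.
Proof.
move=> /differentiable_partial dfx; rewrite deriveE //.
rewrite [v in LHS]row_sum_delta linear_sum; apply: eq_bigr => i _.
by rewrite linearZ /partial deriveE.
Qed.
End StrictDerivative.

(** [u] is only known to be derivable along [v], so it is first restricted to the line through [z]
    in this direction, where derivability amounts to differentiability. *)
Lemma is_derive_comp_row (R : realType) (V : normedModType R) d
    (f : 'rV[R]_d -> R) (u : V -> 'rV[R]_d) (z v : V) :
  (forall i x, derivable f x (delta_mx 0 i)) ->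
  (forall i, {for u z, continuous (partial i f)}) ->
  (forall i, derivable (fun y => u y 0 i) z v) ->
  is_derive z v (f \o u) (\sum_i 'D_v (fun y => u y 0 i) z * partial i f (u z)).
Proof.
move=> df cf du; have dfu := differentiable_partial df cf.
have duzv : derivable u z v by apply/derivable_mxP => i j; rewrite ord1.
pose phi (h : R) := u (h *: v + z).
have phi0 : phi 0 = u z by rewrite /phi scale0r add0r.
have dphi : derivable phi 0 1 by have /derivable1P := duzv.
have diffphi : differentiable phi 0 by move/derivable1_diffP : dphi.
have dcomp : differentiable (f \o phi) 0.
  by apply: differentiable_comp => //; rewrite phi0.
have Dline (W : normedModType R) (g : V -> W) :
    'D_v g z = 'D_1 (fun h : R => g (h *: v + z)) 0.
  rewrite /derive (_ : (fun h : R => h^-1 *: ((g \o shift z) (h *: v) - g z)) =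
    (fun h => h^-1 *: (((fun h : R => g (h *: v + z)) \o shift 0) (h *: (1 : R))
                       - g (0 *: v + z)))) //.
  apply/funext => h /=.
  by rewrite addr0 scale0r add0r [h%:A]mulr1.
apply: DeriveDef.
  by apply/derivable1P; apply/derivable1_diffP.
have Dphi : 'D_1 phi 0 = 'D_v u z by rewrite Dline.
have dfphi : differentiable f (phi 0) by rewrite phi0.
rewrite Dline; transitivity ('d (f \o phi) 0 1); first by rewrite -(deriveE _ dcomp).
rewrite (diff_comp diffphi dfphi) /=.
transitivity ('d f (u z) ('D_v u z)).
  by rewrite -Dphi (deriveE _ diffphi) phi0.
rewrite -(deriveE _ dfu) (derive_partial df _ cf) (derive_mx duzv).
by apply: eq_bigr => i _; rewrite mxE.
Qed.

Lemma is_derive_translate (R : realType) (V W : normedModType R) (f : V -> W)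
    (x v c : V) : derivable f (x + c) v ->
  is_derive x v (fun y => f (y + c)) ('D_v f (x + c)).
Proof.
move=> df.
have E : (fun h : R => h^-1 *: (((fun y => f (y + c)) \o shift x) (h *: v)
    - f (x + c))) =
   (fun h => h^-1 *: ((f \o shift (x + c)) (h *: v) - f (x + c))).
  by apply/funext => h /=; rewrite addrA.
by apply: DeriveDef; rewrite /derivable /derive E.
Qed.

Section Schwarz.
Variables (R : realType) (d : nat) (f : 'rV[R]_d -> R).
Hypothesis df : forall i x, derivable f x (delta_mx 0 i).
Hypothesis ddf : forall i j x, derivable (partial i f) x (delta_mx 0 j).
Let e (i : 'I_d) : 'rV[R]_d := delta_mx 0 i.

Let second_difference (i j : 'I_d) x s : exists t t' : R,
  [/\ 0 <= t <= 1, 0 <= t' <= 1 &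
  f (x + s *: e i + s *: e j) - f (x + s *: e i) - (f (x + s *: e j) - f x) =
  partial j (partial i f) (x + (t * s) *: e i + (t' * s) *: e j) * s * s].
Proof.
pose g y := f (y + s *: e j) - f y.
have dg y : is_derive y (e i) g (partial i f (y + s *: e j) - partial i f y).
  by apply: is_deriveB; [exact: is_derive_translate|exact: derivableP].
have [t t01 Et] := mvt_line s (fun t => @ex_derive _ _ _ _ _ _ _ (dg (x + t *: e i))).
have [t' t'01 Et'] := mvt_line s (fun t' => @ddf i j (x + (t * s) *: e i + t' *: e j)).
exists t, t'; split=> //.
transitivity (g (x + s *: e i) - g x) => //; rewrite Et; congr (_ * _).
transitivity ('D_(e i) g (x + (t * s) *: e i)) => //.
by rewrite (@derive_val _ _ _ _ _ _ _ (dg _)) Et'.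
Qed.

(** The second difference over the sides s e_i and s e_j is symmetric in [i] and [j]; two mean
    values make it s^2 times either mixed derivative at a point near [x]. *)
Lemma partial_sym i j x :
  (forall i j, {for x, continuous (partial i (partial j f))}) ->
  partial i (partial j f) x = partial j (partial i f) x.
Proof.
move=> cf; apply/eqP; rewrite -subr_eq0 -normr_le0.
apply/ler_addgt0Pr => eps eps0; rewrite add0r.
have eps2 : 0 < eps / 2 by rewrite divr_gt0.
have near_part i' j' : exists2 r : R, 0 < r & forall y, `|y - x| < r ->
    `|partial i' (partial j' f) x - partial i' (partial j' f) y| <= eps / 2.
  have /cvgrPdist_le/(_ _ eps2)/nbhs_normP[r /= r0 Hr] := cf i' j'.
  by exists r => // y yx; apply: Hr; rewrite /= distrC.
have [r r0 Hr] := near_part i j; have [r' r'0 Hr'] := near_part j i.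
have [s s0 Es] : exists2 s, 0 < s & Num.min r r' = s + s + s.
  exists (Num.min r r' / 3%:R); last by field.
  by rewrite divr_gt0 // lt_min r0.
have near_x t t' i' j' : 0 <= t <= 1 -> 0 <= t' <= 1 ->
    `|x + (t * s) *: e i' + (t' * s) *: e j' - x| < Num.min r r'.
  move=> /andP[t0 t1] /andP[t'0 t'1].
  rewrite -(addrA x) addrAC subrr add0r; apply: le_lt_trans (_ : s + s < _).
    have es a k : 0 <= a -> a <= 1 -> `|(a * s) *: e k| <= s.
      move=> a0 a1; apply: mx_norm_le_coord => [|i1 l]; first exact: ltW.
      rewrite (ord1 i1).
      rewrite !mxE eqxx /= normrM ger0_norm ?mulr_ge0 // ?(ltW s0) //.
      rewrite -[leRHS]mulr1 ler_pM ?mulr_ge0 ?(ltW s0) //.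
        by rewrite ler_piMl // ltW.
      by case: (_ == _); rewrite ?normr1 ?normr0 ?ler01.
    by apply: le_trans (ler_normD _ _) _; apply: lerD; apply: es.
  by rewrite Es ltrDl.
have [t [t' [t01 t'01 E1]]] := second_difference i j x s.
have [u [u' [u01 u'01 E2]]] := second_difference j i x s.
have E : partial j (partial i f) (x + (t * s) *: e i + (t' * s) *: e j) =
         partial i (partial j f) (x + (u * s) *: e j + (u' * s) *: e i).
  apply: (mulIf (lt0r_neq0 s0)); apply: (mulIf (lt0r_neq0 s0)).
  have swap (a b c c' : R) : a - b - (c - c') = a - c - (b - c') by ring.
  apply: etrans (esym E1) _; apply: etrans _ E2.
  by rewrite (addrAC x) swap.
have := near_x t t' i j t01 t'01; rewrite lt_min => /andP[_ B1].
have := near_x u u' j i u01 u'01; rewrite lt_min => /andP[B2 _].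
rewrite (splitr eps); apply: le_trans (ler_distD (partial i (partial j f)
  (x + (u * s) *: e j + (u' * s) *: e i)) _ _) _.
apply: lerD; first exact: Hr.
by rewrite -E distrC; exact: Hr'.
Qed.
End Schwarz.

Section Smooth.
Variables (R : realType) (d : nat) (f : 'rV[R]_d -> R).
Hypothesis smf : smooth f.

Lemma smooth_derivable i x : derivable f x (delta_mx 0 i).
Proof. by have [_ /(_ i)[df _]] := smf 1; apply: df; rewrite inE. Qed.

Lemma smooth_partial i : smooth (partial i f).
Proof. by move=> r; have [_ /(_ i)[_]] := smf r.+1. Qed.
End Smooth.

Lemma smooth_continuous (R : realType) d (f : 'rV[R]_d -> R) x :
  smooth f -> {for x, continuous f}.
Proof. by move=> smf; have [cf _] := smf 0%N; apply: cf; rewrite inE. Qed.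

Lemma smooth_partial_continuous (R : realType) d (f : 'rV[R]_d -> R) i x :
  smooth f -> {for x, continuous (partial i f)}.
Proof. by move=> smf; apply: smooth_continuous; exact: smooth_partial. Qed.

Lemma smooth_partial_sym (R : realType) d (f : 'rV[R]_d -> R) i j x :
  smooth f -> partial i (partial j f) x = partial j (partial i f) x.
Proof.
move=> smf; apply: partial_sym.
- by move=> a y; exact: smooth_derivable.
- by move=> a b y; apply: smooth_derivable; exact: smooth_partial.
- by move=> a b; apply: smooth_partial_continuous; exact: smooth_partial.
Qed.

Section CellArg.
Variables (R : realType) (p k : nat) (Q : network p k).
Implicit Types (c : 'I_p) (x y : 'cV[R]_p).

Definition cell_arg c x (lam : R) : 'rV[R]_k.+2 :=
  cell_args (x c 0) (fun l => x (Q l c) 0) lam.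

Lemma coupledE f x lam c : coupled Q f x lam c 0 = f (cell_arg c x lam).
Proof. by rewrite mxE. Qed.

Lemma cell_argD c x y lam nu :
  cell_arg c (x + y) (lam + nu) = cell_arg c x lam + cell_arg c y nu.
Proof.
apply/rowP => a; rewrite !mxE; case: unliftP => [i|] // _.
by case: unliftP => [l|] _; rewrite ?mxE.
Qed.

Lemma cell_argZ c x lam t : cell_arg c (t *: x) (t * lam) = t *: cell_arg c x lam.
Proof.
apply/rowP => a; rewrite !mxE; case: unliftP => [i|] // _.
by case: unliftP => [l|] _; rewrite ?mxE.
Qed.

Lemma cell_arg0 c : cell_arg c 0 0 = 0.
Proof.
apply/rowP => a; rewrite !mxE; case: unliftP => [i|] // _.
by case: unliftP => [l|] _; rewrite ?mxE.
Qed.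

Lemma cell_argB c x y lam nu :
  cell_arg c (x - y) (lam - nu) = cell_arg c x lam - cell_arg c y nu.
Proof.
by rewrite -[- y]scaleN1r -[- nu]mulN1r cell_argD cell_argZ scaleN1r.
Qed.

(** Stated for any vector [b]: the gradient of [f] yields the Jacobian, and that of the
    lambda-derivative of [f] the matrix built on [lambda_part]. *)
Lemma cell_arg_sum (b : 'I_k.+2 -> R) c x lam :
  \sum_a cell_arg c x lam 0 a * b a =
  (Defs.jacobian Q (\row_j b (lift ord_max j)) *m x) c 0 + lam * b ord_max.
Proof.
rewrite big_ord_recr /=; congr (_ + _); last by rewrite mxE unlift_none.
rewrite big_ord_recl /= widen_lift mxE liftK unlift_none.
rewrite /Defs.jacobian mulmxDl mulmx_suml mul_scalar_mx mxE.
rewrite [RHS]mxE [X in _ = X + _]mxE mulrC; congr (_ + _); rewrite summxE; apply: eq_bigr => l _.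
rewrite widen_lift !mxE !liftK mulrC (bigD1 (Q l c)) //= big1 => [|j nj].
  by rewrite !mxE eqxx mulr1 addr0.
by rewrite !mxE eq_sym (negbTE nj) mulr0 mul0r.
Qed.
End CellArg.

(** * Derivatives of the Lyapunov-Schmidt reduction *)

Lemma is_derive_affine (R : realType) (V : normedModType R) (L : V -> R)
    (z v : V) (l : R) :
  (forall h : R, L (h *: v + z) = h * l + L z) -> is_derive z v L l.
Proof.
move=> HL; have cv : (fun h : R => h^-1 *: ((L \o shift z) (h *: v) - L z)) @ 0^' --> l.
  apply: cvg_near_cst; near=> h.
  rewrite /= HL addrK -[_ *: _]/(_ * _) mulKf //; near: h; exact: nbhs_dnbhs_neq.
by apply: DeriveDef; [apply/cvg_ex; exists l|exact: cvg_lim].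
Unshelve. all: by end_near. Qed.

Lemma derive_ray0 (R : realType) (V : normedModType R) (L : V -> R) (v : V) :
  (forall s : R, L (s *: v) = 0) -> forall s : R, 'D_v L (s *: v) = 0.
Proof.
move=> HL s; apply: (@derive_val _ _ _ _ _ _ _ (@is_derive_affine _ _ _ _ _ 0 _)) => h.
by rewrite -scalerDl !HL mulr0 addr0.
Qed.

Definition hessian (R : realType) d (f : 'rV[R]_d -> R) : 'M[R]_d :=
  \matrix_(a, b) partial a (partial b f) 0.

Section TrivialBranch.
Variables (R : realType) (k : nat) (f : 'rV[R]_k.+2 -> R).
Hypothesis f0 : forall lam, f (cell_args 0 (fun=> 0) lam) = 0.

Let lam_axis (s : R) : cell_args 0 (fun=> 0) s = s *: delta_mx 0 ord_max :> 'rV_k.+2.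
Proof.
apply/rowP => a; rewrite !mxE /=; case: unliftP => [i|] ->.
  by rewrite eq_sym (negbTE (neq_lift _ _)) mulr0; case: unliftP.
by rewrite eqxx mulr1.
Qed.

Lemma f_origin : f 0 = 0.
Proof. by rewrite -(f0 0) lam_axis scale0r. Qed.

Lemma partial_lambda0 : partial ord_max f 0 = 0.
Proof.
rewrite -[X in partial _ _ X](scale0r (delta_mx 0 ord_max)).
by apply: derive_ray0 => s; rewrite -lam_axis f0.
Qed.

Lemma partial_lambda_lambda0 : partial ord_max (partial ord_max f) 0 = 0.
Proof.
rewrite -[X in partial _ _ X](scale0r (delta_mx 0 ord_max)).
apply: derive_ray0; apply: derive_ray0 => s; by rewrite -lam_axis f0.
Qed.
End TrivialBranch.

Section Reduction.
Variables (R : realType) (p k m : nat) (Q : network p k) (f : 'rV[R]_k.+2 -> R).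
Hypothesis smf : smooth f.
Hypothesis f0 : forall lam, f (cell_args 0 (fun=> 0) lam) = 0.
Notation J := (Defs.jacobian Q (linear_part f)).

Lemma cell_arg_linear c x lam :
  \sum_a cell_arg Q c x lam 0 a * partial a f 0 = (J *m x) c 0.
Proof.
by rewrite cell_arg_sum partial_lambda0 // mulr0 addr0.
Qed.

Variables (V : 'M[R]_(p, m)) (W : 'rV[R]_m.+1 -> 'cV[R]_p) (U : set 'rV[R]_m.+1).
Hypothesis oU : open U.
Hypothesis U0 : U 0.
Hypothesis smW : forall c, smooth_on U (fun z => W z c 0).

Let e j : 'rV[R]_m.+1 := delta_mx 0 j.
Let dW j z : 'cV[R]_p := \col_c partial j (fun y => W y c 0) z.
Let X z : 'cV[R]_p := V *m state_part z + W z.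
Let dX j z : 'cV[R]_p := V *m state_part (e j) + dW j z.
Let u c z := cell_arg Q c (X z) (param_part z).

Let uE c z a : u c z 0 a =
  cell_arg Q c (V *m state_part z) (param_part z) 0 a + cell_arg Q c (W z) 0 0 a.
Proof. by rewrite /u /X -[param_part z in LHS]addr0 cell_argD mxE. Qed.

Let stateD h (v z : 'rV[R]_m.+1) :
  state_part (h *: v + z) = h *: state_part v + state_part z.
Proof. by apply/colP => i; rewrite !mxE. Qed.

Let paramD h (v z : 'rV[R]_m.+1) :
  param_part (h *: v + z) = h * param_part v + param_part z.
Proof. by rewrite /param_part !mxE. Qed.

Let is_derive_cell_arg c (Y : 'rV[R]_m.+1 -> 'cV[R]_p) (dY : 'cV[R]_p) a z j :
  (forall i, is_derive z (e j) (fun y => Y y i 0) (dY i 0)) ->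
  is_derive z (e j) (fun y => cell_arg Q c (Y y) 0 0 a) (cell_arg Q c dY 0 0 a).
Proof.
move=> HY; rewrite /cell_arg /cell_args mxE.
under [X in is_derive _ _ X _]eq_fun do rewrite mxE.
case: unliftP => [b _|_]; last exact: is_derive_cst.
by case: unliftP => [l _|_]; exact: HY.
Qed.

Let derW c j z : U z -> derivable (fun y => W y c 0) z (e j).
Proof. by move=> Uz; have [_ /(_ j)[dw _]] := smW c 1; apply: dw; rewrite inE. Qed.

Let derdW c i j z : U z -> derivable (partial i (fun y => W y c 0)) z (e j).
Proof.
move=> Uz; have [_ /(_ i)[_ [_ /(_ j)[dw _]]]] := smW c 2.
by apply: dw; rewrite inE.
Qed.

Let is_derive_u c j a z : U z ->
  is_derive z (e j) (fun y => u c y 0 a)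
    (cell_arg Q c (dX j z) (param_part (e j)) 0 a).
Proof.
move=> Uz; under [X in is_derive _ _ X _]eq_fun do rewrite uE.
rewrite /dX -[param_part (e j)]addr0 cell_argD mxE; apply: is_deriveD.
  apply: is_derive_affine => h.
  rewrite stateD paramD mulmxDr -scalemxAr cell_argD cell_argZ.
  by rewrite mxE [X in X + _]mxE.
apply: is_derive_cell_arg => i; rewrite mxE.
by apply: derivableP; exact: derW.
Qed.

Let is_derive_lin n (b : 'I_n -> R) (h : 'I_n -> 'rV[R]_m.+1 -> R) dh z v :
  (forall c, is_derive z v (h c) (dh c)) ->
  is_derive z v (fun y => \sum_c b c * h c y) (\sum_c b c * dh c).
Proof.
move=> Hh; rewrite (_ : (fun y => _) = \sum_c (b c \*: h c)); last first.
  by apply/funext => y; rewrite fct_sumE.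
by apply: is_derive_sum => c; apply: is_deriveZ.
Qed.

Let is_derive_fu c j z : U z ->
  is_derive z (e j) (fun y => f (u c y))
    (\sum_a cell_arg Q c (dX j z) (param_part (e j)) 0 a * partial a f (u c z)).
Proof.
move=> Uz.
have HD a := is_derive_u c j a Uz.
have Ea a : 'D_(e j) (fun y => u c y 0 a) z =
  cell_arg Q c (dX j z) (param_part (e j)) 0 a by exact: derive_val.
under eq_bigr do rewrite -Ea.
apply: (@is_derive_comp_row _ _ _ f (u c)) => [i x|i|i].
- exact: smooth_derivable.
- exact: smooth_partial_continuous.
- exact: ex_derive.
Qed.

(** [b] will be a row of the projection [P] in proving that [W] vanishes to first order, and a
    column of [Vs] in computing the derivatives of [g]. *)
Variable b : 'I_p -> R.
Let G z := \sum_c b c * f (u c z).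

Let partial_G j z : U z -> partial j G z = \sum_c b c *
  \sum_a cell_arg Q c (dX j z) (param_part (e j)) 0 a * partial a f (u c z).
Proof.
move=> Uz.
exact: (@derive_val _ _ _ _ _ _ _ (is_derive_lin b (fun c => is_derive_fu c j Uz))).
Qed.

Hypothesis W0 : W 0 = 0.

Let u0 c : u c 0 = 0.
Proof.
rewrite /u /X W0 addr0 (_ : state_part 0 = 0) ?mulmx0; last first.
  by apply/colP => i; rewrite !mxE.
by rewrite /param_part mxE cell_arg0.
Qed.

Lemma reduction_partial j :
  partial j G 0 = \sum_c b c * (J *m dX j 0) c 0.
Proof.
rewrite partial_G //; apply: eq_bigr => c _; congr (_ * _).
by rewrite -(cell_arg_linear c _ (param_part (e j))) u0.
Qed.

Hypothesis dW0 : forall j, dW j 0 = 0.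
Let ddW i j : 'cV[R]_p := \col_c partial i (partial j (fun y => W y c 0)) 0.

(** As [W] vanishes to first order, its second derivatives enter only behind [J]. A combination [b]
    orthogonal to the range of [J] therefore sees only the Hessian of [f] along the kernel and
    lambda. *)
Lemma reduction_partial2 i j :
  partial i (partial j G) 0 = \sum_c b c * ((J *m ddW i j) c 0 +
    (cell_arg Q c (V *m state_part (e i)) (param_part (e i)) *m hessian f *m
     (cell_arg Q c (V *m state_part (e j)) (param_part (e j)))^T) 0 0).
Proof.
have nearG : \forall y \near (0 : 'rV[R]_m.+1), partial j G y = (fun z => \sum_c b c *
    \sum_a cell_arg Q c (dX j z) (param_part (e j)) 0 a * partial a f (u c z)) y.
  near=> z; apply: partial_G; near: z; exact: open_nbhs_nbhs.
rewrite [LHS](near_eq_derive _ nearG).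
have dX0 l : dX l 0 = V *m state_part (e l) by rewrite /dX dW0 addr0.
have dcoef c a : is_derive 0 (e i)
    (fun z => cell_arg Q c (dX j z) (param_part (e j)) 0 a)
    (cell_arg Q c (ddW i j) 0 0 a).
  have -> : (fun z => cell_arg Q c (dX j z) (param_part (e j)) 0 a) =
      cst (cell_arg Q c (V *m state_part (e j)) (param_part (e j)) 0 a) +
      (fun z => cell_arg Q c (dW j z) 0 0 a).
    apply/funext => z; rewrite /dX -[param_part (e j) in LHS]addr0 cell_argD.
    by rewrite mxE.
  rewrite -[X in is_derive _ _ _ X]add0r; apply: is_deriveD.
  apply: is_derive_cell_arg => c'; rewrite mxE.
  under [X in is_derive _ _ X _]eq_fun do rewrite mxE.
  by apply: derivableP; exact: derdW.
have dfa c a : is_derive 0 (e i) (fun z => partial a f (u c z))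
    (\sum_a' cell_arg Q c (dX i 0) (param_part (e i)) 0 a' * hessian f a' a).
  have Ea a' : 'D_(e i) (fun y => u c y 0 a') 0 =
    cell_arg Q c (dX i 0) (param_part (e i)) 0 a'.
    by apply: (@derive_val _ _ _ _ _ _ _ (is_derive_u c i a' U0)).
  under eq_bigr do rewrite -Ea mxE -(u0 c).
  apply: (@is_derive_comp_row _ _ _ (partial a f) (u c)) => [i' x|i'|i'].
  - by apply: smooth_derivable; exact: smooth_partial.
  - by apply: smooth_partial_continuous; exact: smooth_partial.
  - exact: (@ex_derive _ _ _ _ _ _ _ (is_derive_u c i i' U0)).
have dsum c : is_derive 0 (e i) (fun z =>
    \sum_a cell_arg Q c (dX j z) (param_part (e j)) 0 a * partial a f (u c z))
    (\sum_a (cell_arg Q c (dX j 0) (param_part (e j)) 0 a *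
      (\sum_a' cell_arg Q c (dX i 0) (param_part (e i)) 0 a' * hessian f a' a) +
      partial a f (u c 0) * cell_arg Q c (ddW i j) 0 0 a)).
  rewrite (_ : (fun z => _) = \sum_a
     ((fun z => cell_arg Q c (dX j z) (param_part (e j)) 0 a) *
      (fun z => partial a f (u c z)))); last first.
    by apply/funext => z; rewrite fct_sumE.
  by apply: is_derive_sum => a; apply: is_deriveM.
rewrite (@derive_val _ _ _ _ _ _ _ (is_derive_lin b dsum)).
apply: eq_bigr => c _; congr (_ * _); rewrite big_split /= [LHS]addrC; congr (_ + _).
  rewrite -(cell_arg_linear c _ 0); apply: eq_bigr => a _.
  by rewrite u0 mulrC.
rewrite mxE; apply: eq_bigr => a _; rewrite !dX0 mulrC; congr (_ * _).
  by rewrite mxE.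
by rewrite [RHS]mxE.
Unshelve. all: by end_near. Qed.
End Reduction.

(** The second derivative of the coupled system at the origin, as a bilinear map in [(x, lam)] and
    [(y, nu)], without the factor 1/2. *)
Definition second_order (R : realType) p k (Q : network p k)
    (f : 'rV[R]_k.+2 -> R) (x : 'cV[R]_p) (lam : R) (y : 'cV[R]_p) (nu : R) :
  'cV[R]_p := \col_c
    (cell_arg Q c x lam *m hessian f *m (cell_arg Q c y nu)^T) 0 0.

(** What is used of a reduction: its derivatives up to order two. [W] and the complement [C]
    disappear, because [W] vanishes to first order and [Vs^T] kills its second-order
    contribution. *)
Record reduction_data (R : realType) p k (Q : network p k) (f : 'rV[R]_k.+2 -> R)
    m (g : 'I_m -> 'rV[R]_m.+1 -> R) (V Vs : 'M[R]_(p, m)) : Prop := {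
  red_ker : forall y : 'cV[R]_p, Defs.jacobian Q (linear_part f) *m y = 0 ->
    exists c, y = V *m c;
  red_coker : forall y : 'cV[R]_p, y^T *m Defs.jacobian Q (linear_part f) = 0 ->
    exists c, y = Vs *m c;
  red_JV : Defs.jacobian Q (linear_part f) *m V = 0;
  red_VsJ : Vs^T *m Defs.jacobian Q (linear_part f) = 0;
  red_dual : Vs^T *m V = 1%:M;
  red_g0 : forall i, g i 0 = 0;
  red_dg0 : forall i j, partial j (g i) 0 = 0;
  red_ddg0 : forall i a b, partial a (partial b (g i)) 0 =
    (Vs^T *m second_order Q f (V *m state_part (delta_mx 0 a))
        (param_part (delta_mx 0 a)) (V *m state_part (delta_mx 0 b))
        (param_part (delta_mx 0 b))) i 0 }.

Lemma lyapunov_schmidt_data (R : realType) p k (Q : network p k)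
    (f : 'rV[R]_k.+2 -> R) m (g : 'I_m -> 'rV[R]_m.+1 -> R) :
  smooth f -> (forall lam, f (cell_args 0 (fun=> 0) lam) = 0) ->
  lyapunov_schmidt Q f g -> exists V Vs, reduction_data Q f g V Vs.
Proof.
move=> smf f0 [V [Vs [C [P [W []]]]]]; set J := Defs.jacobian _ _.
move=> [HV [HVs VsV]] [_ VC] [PP _ PJ].
move=> [[U [oU U0 smW]] W0 WC PF] gE; exists V, Vs.
have JV : J *m V = 0.
  have JVc (c : 'cV_m) : J *m (V *m c) = 0 by apply/HV; exists c.
  apply/matrixP => i j; transitivity (col j (J *m V) i 0); first by rewrite [RHS]mxE.
  by rewrite colE -mulmxA JVc !mxE.
have VsJ : Vs^T *m J = 0.
  have VsJc (c : 'cV_m) : (Vs *m c)^T *m J = 0 by apply/HVs; exists c.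
  apply/matrixP => i j; transitivity (row i (Vs^T *m J) 0 j); first by rewrite [RHS]mxE.
  by rewrite rowE -[delta_mx _ _]trmxK mulmxA -trmx_mul VsJc !mxE.
have PJJ : P *m J = J.
  have /submxP[D HD] : (J^T <= P^T)%MS by rewrite PJ.
  by rewrite -[J]trmxK HD trmx_mul trmxK mulmxA PP.
have gE' i : g i = fun z => \sum_c Vs c i *
    f (cell_arg Q c (V *m state_part z + W z) (param_part z)).
  apply/funext => z; rewrite gE mxE; apply: eq_bigr => c _.
  by rewrite mxE coupledE.
(* Membership in the complement [C] becomes a linear equation, which can be differentiated at the
   origin. *)
have [K HK WK] : exists2 K : 'M[R]_p, (forall w : 'rV_p, w *m K = 0 -> (w <= C)%MS)
    & \forall z \near (0 : 'rV[R]_m.+1), (W z)^T *m K = 0.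
  exists (cokermx C) => [w wK|]; first by rewrite submxE wK.
  by apply: filterS WC => z; rewrite submxE => /eqP.
(* Differentiating [P F = 0] puts the derivative of [W] in the kernel of [J]; it also lies in [C],
   which meets this kernel trivially. *)
have dW0 j : \col_c partial j (fun y => W y c 0) 0 = 0 :> 'cV[R]_p.
  set w := \col_c _.
  have Jw : J *m w = 0.
    have : J *m (V *m state_part (delta_mx 0 j) + w) = 0.
      rewrite -PJJ -mulmxA; apply/colP => c; rewrite mxE [RHS]mxE.
      rewrite -(reduction_partial Q smf f0 V U0 smW (P c) W0 j).
      rewrite /partial (@near_eq_derive _ _ _ _ (cst 0)) ?derive_cst //.
      apply: filterS PF => z /(congr1 (fun v : 'cV_p => v c 0)).
      rewrite !mxE => Hz; rewrite -[RHS]Hz; apply: eq_bigr => c' _.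
      by rewrite coupledE.
    by rewrite mulmxDr mulmxA JV mul0mx add0r.
  have /HV[c wE] := Jw.
  suff : (w^T <= V^T :&: C)%MS.
    by rewrite VC submx0 => /eqP/(congr1 trmx); rewrite trmxK trmx0.
  rewrite sub_capmx {1}wE trmx_mul submxMl; apply: HK.
  apply/rowP => l; rewrite mxE [RHS]mxE.
  have derW c' : derivable (fun y => W y c' 0) 0 (delta_mx 0 j).
    by have [_ /(_ j)[dw _]] := smW c' 1; apply: dw; rewrite inE.
  have D : is_derive (0 : 'rV[R]_m.+1) (delta_mx 0 j : 'rV[R]_m.+1)
     (\sum_c' (K c' l \*: (fun y => W y c' 0)))
     (\sum_c' (K c' l *: partial j (fun y => W y c' 0) 0)).
    by apply: is_derive_sum => c'; apply: is_deriveZ; exact: derivableP.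
  transitivity ('D_(delta_mx 0 j : 'rV[R]_m.+1)
     (\sum_c' (K c' l \*: (fun y => W y c' 0))) 0).
    rewrite (@derive_val _ _ _ _ _ _ _ D); apply: eq_bigr => c' _.
    by rewrite !mxE mulrC.
  rewrite (@near_eq_derive _ _ _ _ (cst 0)) ?derive_cst //.
  apply: filterS WK => z /rowP/(_ l).
  rewrite mxE [X in _ = X]mxE => Hz; rewrite -[RHS]Hz fct_sumE.
  by apply: eq_bigr => c' _; rewrite mxE mulrC.
split=> //.
- by move=> y /HV.
- by move=> y /HVs.
- move=> i; rewrite gE' big1 // => c _.
  rewrite W0 addr0 (_ : state_part 0 = 0) ?mulmx0; last first.
    by apply/colP => j; rewrite !mxE.
  by rewrite /param_part mxE cell_arg0 f_origin ?mulr0.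
- move=> i j; rewrite gE' (reduction_partial Q smf f0 V U0 smW _ W0).
  rewrite dW0 addr0 mulmxA JV mul0mx big1 // => c _.
  by rewrite mxE mulr0.
- move=> i a b; rewrite gE' (reduction_partial2 Q smf f0 V oU U0 smW _ W0 dW0).
  under eq_bigr do rewrite mulrDr.
  rewrite big_split /=; set x := \col_c _.
  have -> : \sum_c Vs c i * (J *m x) c 0 = (Vs^T *m (J *m x)) i 0.
    by rewrite [RHS]mxE; apply: eq_bigr => c _; rewrite [Vs^T _ _]mxE.
  rewrite mulmxA VsJ mul0mx [X in X + _]mxE add0r [RHS]mxE.
  by apply: eq_bigr => c _; rewrite [Vs^T _ _]mxE [second_order _ _ _ _ _ _ _ _]mxE.
Qed.

(** * Zeros near a nondegenerate direction of a subnetwork *)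

Lemma fin_pos_min (R : realType) n (P : 'I_n -> R -> Prop) :
  (forall i, exists2 d, 0 < d & P i d) ->
  (forall i d d', 0 < d' -> d' <= d -> P i d -> P i d') ->
  exists2 d, 0 < d & forall i, P i d.
Proof.
move=> HP mono; have [D HD] := fin_all_exists2 HP.
exists (\big[Num.min/1]_i D i) => [|i].
  by elim/big_rec: _ => // i x _ x0; rewrite lt_min HD.
apply: mono (_ : _ <= D i) _ => //.
- by elim/big_rec: _ => // j x _ x0; rewrite lt_min HD.
- exact: bigmin_le_cond.
Qed.

Lemma trmx_norm (R : realType) m n (x : 'M[R]_(m, n)) : `|x^T| = `|x|.
Proof.
apply/eqP; rewrite eq_le; apply/andP; split; apply: mx_norm_le_coord => // i j.
  by rewrite mxE mx_coord_le_norm.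
by have := mx_coord_le_norm x^T j i; rewrite mxE.
Qed.

Lemma mulmx_bound (R : realType) m n (A : 'M[R]_(m, n)) :
  exists2 K : R, 0 < K & forall r (x : 'M[R]_(n, r)), `|A *m x| <= K * `|x|.
Proof.
have S0 : 0 <= \sum_i \sum_j `|A i j|.
  by apply: sumr_ge0 => i _; apply: sumr_ge0.
exists (1 + \sum_i \sum_j `|A i j|) => [|r x].
  by rewrite ltr_pwDl.
apply: mx_norm_le_coord => [|i l]; first by rewrite mulr_ge0 // addr_ge0.
rewrite mxE; apply: le_trans (ler_norm_sum _ _ _) _.
apply: (@le_trans _ _ ((\sum_j `|A i j|) * `|x|)).
  rewrite mulr_suml; apply: ler_sum => j _.
  by rewrite normrM ler_wpM2l // mx_coord_le_norm.
rewrite ler_wpM2r // (bigD1 i) //= addrA addrAC ler_wpDl //.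
by apply: addr_ge0 => //; apply: sumr_ge0 => i' _; apply: sumr_ge0.
Qed.

Section GradientExpansion.
Variables (R : realType) (d : nat) (f : 'rV[R]_d -> R).
Hypothesis smf : smooth f.

Lemma gradient_expansion (v : 'rV[R]_d) (e : R) : 0 < e ->
  exists2 r : R, 0 < r & forall i lam (xi : 'rV[R]_d),
    `|lam| < r -> `|xi - lam *: v| <= r * `|lam| ->
    `|partial i f xi - partial i f 0 - lam * (v *m hessian f) 0 i| <= e * `|lam|.
Proof.
move=> e0; pose P (i : 'I_d) (r : R) := forall lam (xi : 'rV[R]_d),
    `|lam| < r -> `|xi - lam *: v| <= r * `|lam| ->
    `|partial i f xi - partial i f 0 - lam * (v *m hessian f) 0 i| <= e * `|lam|.
suff [r r0 Hr] : exists2 r, 0 < r & forall i, P i r by exists r => // i; exact: Hr.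
apply: fin_pos_min => [i|i r r' r'0 le_r HP lam xi lt_lam le_xi]; last first.
  apply: HP; first exact: lt_le_trans le_r.
  by apply: le_trans le_xi _; rewrite ler_wpM2r.
have smi := smooth_partial smf i.
have [K K0 HK] := mulmx_bound (hessian f)^T.
pose e1 := e / 2 / (`|v| + 1).
have v1 : 0 < `|v| + 1 by rewrite ltr_wpDl.
have e10 : 0 < e1 by rewrite !divr_gt0.
have [r r0 Hr] := @strict_derivative _ _ _
  (fun j x => @smooth_derivable _ _ _ smi j x) 0 e1
  (fun j => @smooth_partial_continuous _ _ _ j 0 smi) e10.
(* Half of [e] pays for the first-order expansion of the partial derivative, on |xi| <= |lam| (|v| +
   1); the other half pays for the Hessian applied to xi - lam v. *)
exists (Num.min 1 (Num.min (r / (`|v| + 1)) (e / 2 / K))) => [|lam xi].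
  by rewrite !lt_min ltr01 !divr_gt0.
set r' := Num.min 1 _ => lt_lam le_xi.
have r'1 : r' <= 1 by rewrite ge_min lexx.
have r'r : r' <= r / (`|v| + 1) by rewrite !ge_min lexx orbT.
have r'K : r' <= e / 2 / K by rewrite !ge_min lexx !orbT.
have norm_xi : `|xi| <= `|lam| * (`|v| + 1).
  rewrite -[xi](subrK (lam *: v)); apply: le_trans (ler_normD _ _) _.
  rewrite addrC mulrDr normrZ mulr1 lerD2l; apply: le_trans le_xi _.
  by rewrite ler_piMl.
have lt_xi : `|xi| < r.
  apply: le_lt_trans norm_xi _; rewrite -ltr_pdivlMr //.
  exact: lt_le_trans lt_lam r'r.
have := Hr 0 xi; rewrite subrr normr0 !subr0 => /(_ r0 lt_xi) H1.
have EH : \sum_j partial j (partial i f) 0 * (xi 0 j - (0 : 'rV[R]_d) 0 j) =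
    (xi *m hessian f) 0 i.
  by rewrite mxE; apply: eq_bigr => j _; rewrite !mxE subr0 mulrC.
rewrite EH in H1.
have -> : partial i f xi - partial i f 0 - lam * (v *m hessian f) 0 i =
   (partial i f xi - partial i f 0 - (xi *m hessian f) 0 i) +
   ((xi - lam *: v) *m hessian f) 0 i.
  by rewrite mulmxBl -scalemxAl [((_ - _) : 'rV_d) 0 i]mxE
     [(- (_ *: _) : 'rV_d) 0 i]mxE [(lam *: _ : 'rV_d) 0 i]mxE; ring.
apply: le_trans (ler_normD _ _) _.
rewrite [e in e * _](splitr e) mulrDl; apply: lerD.
  apply: le_trans H1 _; apply: le_trans (ler_wpM2l (ltW e10) norm_xi) _.
  by rewrite /e1 mulrCA mulrC divfK // lt0r_neq0.
have -> : ((xi - lam *: v) *m hessian f) 0 i =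
    ((hessian f)^T *m (xi - lam *: v)^T) i 0 by rewrite -trmx_mul [RHS]mxE.
apply: le_trans (mx_coord_le_norm _ _ _) _; apply: le_trans (HK _ _) _.
rewrite trmx_norm.
apply: le_trans (ler_wpM2l (ltW K0) le_xi) _.
rewrite mulrA; apply: ler_wpM2r => //.
by rewrite mulrC -ler_pdivlMr.
Qed.
End GradientExpansion.

(** [J] controls the component of [w] off its kernel, and on the kernel [lam B] acts through the
    invertible [Vs^T B V]; the weaker of the two bounds is of order [lam]. *)
Lemma pencil_lower_bound (R : realType) p m (J B : 'M[R]_p) (V Vs : 'M[R]_(p, m)) :
  (forall y : 'cV[R]_p, J *m y = 0 -> exists c, y = V *m c) ->
  Vs^T *m J = 0 -> Vs^T *m V = 1%:M -> Vs^T *m B *m V \in unitmx ->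
  exists2 r : R, 0 < r & forall lam (w : 'cV[R]_p), `|lam| < r ->
    r * (`|lam| * `|w|) <= `|(J + lam *: B) *m w|.
Proof.
move=> kerJ VsJ VsV uM; set M := Vs^T *m B *m V in uM.
(* [1 - V Vs^T] vanishes on the kernel of [J], hence factors as [G J]: [G] is a partial inverse of
   [J]. *)
have /submxP[G HG] : (1%:M - V *m Vs^T <= J)%MS.
  rewrite submxE; apply/eqP/matrixP => i j.
  have [c Hc] : exists c, col j (cokermx J) = V *m c.
    by apply: kerJ; rewrite colE mulmxA mulmx_coker mul0mx.
  transitivity (col j ((1%:M - V *m Vs^T) *m cokermx J) i 0); first by rewrite [RHS]mxE.
  rewrite colE -mulmxA -colE Hc mulmxBl mul1mx -!mulmxA (mulmxA Vs^T) VsV mul1mx.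
  by rewrite subrr !mxE.
have [K1 K10 HK1] := mulmx_bound (V *m invmx M *m Vs^T).
have [K2 K20 HK2] := mulmx_bound (V *m invmx M *m (Vs^T *m B)).
have [K3 K30 HK3] := mulmx_bound G.
have [K4 K40 HK4] := mulmx_bound (G *m B).
pose C := K1 + (K2 + 1) * K3; pose D := (K2 + 1) * K4.
have C0 : 0 < C by rewrite addr_gt0 // mulr_gt0 // addr_gt0.
have D0 : 0 < D by rewrite mulr_gt0 // addr_gt0.
have C2 : 0 < 2 * C by rewrite mulr_gt0.
have D2 : 0 < 2 * D by rewrite mulr_gt0.
exists (Num.min 1 (Num.min (2 * D)^-1 (2 * C)^-1)) => [|lam w].
  by rewrite !lt_min ltr01 !invr_gt0 C2 D2.
set r := Num.min 1 _ => lt_lam.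
have r1 : r <= 1 by rewrite ge_min lexx.
have rD : r <= (2 * D)^-1 by rewrite !ge_min lexx orbT.
have rC : r <= (2 * C)^-1 by rewrite !ge_min lexx !orbT.
set u := (J + _) *m w; pose s := G *m u - lam *: (G *m B *m w).
have E1 : w = V *m (Vs^T *m w) + s.
  rewrite /s /u mulmxDl -scalemxAl mulmxDr -scalemxAr !mulmxA addrK -HG.
  by rewrite mulmxBl mul1mx addrC subrK.
have E2 : Vs^T *m u = lam *: (Vs^T *m B *m w).
  by rewrite /u mulmxDl mulmxDr mulmxA VsJ mul0mx add0r -scalemxAl -scalemxAr mulmxA.
have E3 : lam *: (V *m (Vs^T *m w)) = V *m invmx M *m Vs^T *m u
   - lam *: (V *m invmx M *m (Vs^T *m B) *m s).
  rewrite -(mulmxA _ Vs^T u) E2 {2}E1 mulmxDr scalerDr mulmxDr.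
  rewrite -!scalemxAr.
  rewrite (mulmxA (Vs^T *m B)) -/M.
  by rewrite (mulmxA (V *m invmx M) M) mulmxKV // !mulmxA addrK.
have B1 : `|lam| * `|w| <= K1 * `|u| + (K2 + 1) * (`|lam| * `|s|).
  rewrite -normrZ {1}E1 scalerDr E3.
  apply: le_trans (ler_normD _ _) _; rewrite mulrDl mul1r addrA.
  apply: lerD; last by rewrite normrZ.
  apply: le_trans (ler_normB _ _) _; apply: lerD; first exact: HK1.
  by rewrite normrZ [leRHS]mulrCA; apply: ler_wpM2l => //; exact: HK2.
have B2 : `|s| <= K3 * `|u| + K4 * (`|lam| * `|w|).
  apply: le_trans (ler_normB _ _) _; apply: lerD; first exact: HK3.
  by rewrite normrZ [leRHS]mulrCA; apply: ler_wpM2l => //; exact: HK4.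
have lam0 := normr_ge0 lam; have w0 := normr_ge0 w; have u0 := normr_ge0 u.
have lam1 : `|lam| <= 1 by apply: ltW; apply: lt_le_trans r1.
have lamD : `|lam| * (2 * D) <= 1.
  by rewrite -ler_pdivlMr // div1r; apply: ltW; apply: lt_le_trans rD.
have B3 : `|lam| * `|s| <= K3 * `|u| + K4 * (`|lam| * (`|lam| * `|w|)).
  apply: le_trans (ler_wpM2l lam0 B2) _; rewrite mulrDr; apply: lerD.
    by rewrite ler_piMl // mulr_ge0 // ltW.
  by rewrite mulrCA.
(* For |lam| <= 1 / (2 D) the term in [D] is at most half of the left-hand side and is absorbed. *)
have B4 : `|lam| * `|w| <= 2 * C * `|u|.
  have : `|lam| * `|w| <= C * `|u| + D * (`|lam| * (`|lam| * `|w|)).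
    apply: le_trans B1 _; have := ler_wpM2l (ltW (_ : 0 < K2 + 1)) B3.
    rewrite addr_gt0 // => /(_ isT) H; apply: le_trans (lerD (lexx _) H) _.
    by rewrite /C /D; lra.
  have : 2 * (D * (`|lam| * (`|lam| * `|w|))) <= `|lam| * `|w|.
    rewrite (_ : 2 * _ = (`|lam| * (2 * D)) * (`|lam| * `|w|)); last by ring.
    by rewrite ler_piMl // mulr_ge0.
  by lra.
apply: (@le_trans _ _ ((2 * C)^-1 * (`|lam| * `|w|))).
  by rewrite ler_wpM2r // mulr_ge0.
by rewrite mulrC ler_pdivrMr // [leRHS]mulrC.
Qed.

(** * Subnetworks, and zeros close to a direction of a subnetwork *)

Section Fibration.
Variables (R : realType) (p p' k : nat).
Variables (Q : network p k) (Q' : network p' k) (s : 'I_p -> 'I_p').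

(** Graph fibrations, the morphisms of networks: a surjective one presents [Q'] as the quotient of
    [Q] by a synchrony subspace. *)
Definition fibration : Prop := forall l c, Q' l (s c) = s (Q l c).

(** The inclusion of a synchrony subspace, from the coordinates of the quotient to those of the
    cells of [Q]. *)
Definition pullback : 'M[R]_(p, p') := \matrix_(c, c') (s c == c')%:R.

Lemma pullbackE r (x : 'M[R]_(p', r)) c j : (pullback *m x) c j = x (s c) j.
Proof.
rewrite mxE (bigD1 (s c)) //= mxE eqxx mul1r big1 ?addr0 // => c' nc.
by rewrite mxE eq_sym (negbTE nc) mul0r.
Qed.

Lemma pullback_left_inverse : (forall c', exists c, s c = c') ->
  exists L : 'M[R]_(p', p), L *m pullback = 1%:M.
Proof.
move=> surj; have [t Ht] := fin_all_exists surj.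
exists (\matrix_(c', c) (t c' == c)%:R); apply/matrixP => c' d.
rewrite mxE (bigD1 (t c')) //= !mxE eqxx mul1r Ht big1 ?addr0 // => c nc.
by rewrite mxE eq_sym (negbTE nc) mul0r.
Qed.

Hypothesis fib : fibration.

Lemma cell_arg_pullback c x lam :
  cell_arg Q c (pullback *m x) lam = cell_arg Q' (s c) x lam.
Proof.
apply/rowP => a; rewrite mxE [RHS]mxE; case: unliftP => [i|] // _.
by case: unliftP => [l|] _; rewrite pullbackE // fib.
Qed.

Lemma coupled_pullback f x lam :
  coupled Q f (pullback *m x) lam = pullback *m coupled Q' f x lam.
Proof.
apply/colP => c; rewrite pullbackE !coupledE.
by rewrite -cell_arg_pullback.
Qed.

Lemma jacobian_pullback (a : 'rV[R]_k.+1) :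
  Defs.jacobian Q a *m pullback = pullback *m Defs.jacobian Q' a.
Proof.
rewrite /Defs.jacobian mulmxDl mulmxDr mul_scalar_mx mul_mx_scalar.
congr (_ + _); rewrite mulmx_suml mulmx_sumr; apply: eq_bigr => l _.
rewrite -scalemxAl -scalemxAr; congr (_ *: _); apply/matrixP => c c'.
rewrite pullbackE !mxE fib (bigD1 (Q l c)) //= !mxE eqxx mul1r.
by rewrite big1 ?addr0 // => d nd; rewrite mxE eq_sym (negbTE nd) mul0r.
Qed.

Lemma second_order_pullback f x lam y nu :
  second_order Q f (pullback *m x) lam (pullback *m y) nu =
  pullback *m second_order Q' f x lam y nu.
Proof.
by apply/colP => c; rewrite pullbackE [LHS]mxE [RHS]mxE !cell_arg_pullback.
Qed.
End Fibration.

Section SecondOrder.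
Variables (R : realType) (p k : nat) (Q : network p k) (f : 'rV[R]_k.+2 -> R).

Lemma second_orderD x lam y nu y' nu' :
  second_order Q f x lam (y + y') (nu + nu') =
  second_order Q f x lam y nu + second_order Q f x lam y' nu'.
Proof.
apply/colP => c; rewrite mxE [RHS]mxE [X in _ = X + _]mxE [X in _ = _ + X]mxE.
by rewrite cell_argD linearD mulmxDr mxE.
Qed.

Lemma second_orderZ x lam t y nu :
  second_order Q f x lam (t *: y) (t * nu) = t *: second_order Q f x lam y nu.
Proof.
apply/colP => c; rewrite mxE [RHS]mxE [X in _ = _ * X]mxE.
by rewrite cell_argZ linearZ /= -scalemxAr mxE.
Qed.

Lemma hessian_sym : smooth f -> (hessian f)^T = hessian f.
Proof.
by move=> smf; apply/matrixP => a b; rewrite !mxE smooth_partial_sym.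
Qed.

Lemma second_order_sym x lam y nu : smooth f ->
  second_order Q f x lam y nu = second_order Q f y nu x lam.
Proof.
move=> smf; apply/colP => c; rewrite mxE [RHS]mxE.
set u := cell_arg _ _ _ _; set v := cell_arg _ _ _ _.
transitivity ((u *m hessian f *m v^T)^T 0 0); first by rewrite [RHS]mxE.
by rewrite !trmx_mul trmxK hessian_sym // mulmxA.
Qed.

(** The matrix B of the pencil: with [lam = 1], the Jacobian of the system at the point [t x] and
    parameter [t] is [J + t B] to first order in [t]. *)
Definition second_order_mx x lam : 'M[R]_p :=
  \matrix_(c, j) second_order Q f x lam (delta_mx j 0) 0 c 0.

Lemma second_order_mxE x lam w :
  second_order_mx x lam *m w = second_order Q f x lam w 0.
Proof.
have sumE (I : finType) (y : I -> 'cV[R]_p) :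
    second_order Q f x lam (\sum_i y i) 0 = \sum_i second_order Q f x lam (y i) 0.
  elim/big_rec2: _ => [|i u v _ <-].
    transitivity (second_order Q f x lam (0 *: 0) (0 * 0)); last first.
      by rewrite second_orderZ scale0r.
    by rewrite scale0r mul0r.
  by rewrite -[X in second_order _ _ _ _ _ X](addr0 0) second_orderD.
rewrite [w in RHS](_ : w = \sum_j w j 0 *: delta_mx j 0); last first.
  rewrite [LHS]matrix_sum_delta; apply: eq_bigr => j _.
  by rewrite big_ord1.
rewrite sumE; apply/colP => c; rewrite summxE mxE; apply: eq_bigr => j _.
transitivity (second_order Q f x lam (w j 0 *: delta_mx j 0) (w j 0 * 0) c 0).
  by rewrite second_orderZ [RHS]mxE mulrC [X in _ * X]mxE.
by rewrite mulr0.
Qed.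
End SecondOrder.

Lemma cell_arg_norm (R : realType) p k (Q : network p k) c (w : 'cV[R]_p) :
  `|cell_arg Q c w 0| <= `|w|.
Proof.
apply: mx_norm_le_coord => // i a; rewrite mxE.
case: unliftP => [b|] _; last by rewrite normr0.
by case: unliftP => [l|] _; exact: mx_coord_le_norm.
Qed.

Section LocalUniqueness.
Variables (R : realType) (p k : nat) (Q : network p k) (f : 'rV[R]_k.+2 -> R).
Hypothesis smf : smooth f.
Hypothesis f0 : forall lam, f (cell_args 0 (fun=> 0) lam) = 0.
Notation J := (Defs.jacobian Q (linear_part f)).

(** The mean value theorem between [x'] and [x], with the gradient expanded at intermediate points
    of the cone. The factor |lam| in the error is what lets it compete with the lower bound of the
    pencil, itself of order |lam|. *)
Lemma coupled_difference (Y : 'cV[R]_p) (e : R) : 0 < e ->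
  exists2 r : R, 0 < r & forall lam (x x' : 'cV[R]_p), `|lam| < r ->
    `|x - lam *: Y| <= r * `|lam| -> `|x' - lam *: Y| <= r * `|lam| ->
    `|coupled Q f x lam - coupled Q f x' lam
      - (J + lam *: second_order_mx Q f Y 1) *m (x - x')|
    <= e * (`|lam| * `|x - x'|).
Proof.
move=> e0; pose P (c : 'I_p) (r : R) := forall lam (x x' : 'cV[R]_p), `|lam| < r ->
    `|x - lam *: Y| <= r * `|lam| -> `|x' - lam *: Y| <= r * `|lam| ->
    `|(coupled Q f x lam - coupled Q f x' lam
      - (J + lam *: second_order_mx Q f Y 1) *m (x - x')) c 0|
    <= e * (`|lam| * `|x - x'|).
suff [r r0 Hr] : exists2 r, 0 < r & forall c, P c r.
  exists r => // lam x x' lt_lam xY x'Y.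
  apply: mx_norm_le_coord => [|c j]; last by rewrite (ord1 j); apply: Hr.
  by rewrite !mulr_ge0 // ltW.
apply: fin_pos_min => [c|c r r' r'0 le_r HP lam x x' lt_lam le_x le_x']; last first.
  by apply: HP; [exact: lt_le_trans le_r|apply: le_trans le_x _
    |apply: le_trans le_x' _]; rewrite ?ler_wpM2r.
pose v := cell_arg Q c Y 1; pose e' := e / k.+2%:R.
have e'0 : 0 < e' by rewrite divr_gt0.
have [r r0 Hr] := gradient_expansion smf v e'0.
(* An intermediate point is at distance at most |x - lam Y| + 2 |x' - lam Y| from the axis of its
   cone. *)
exists (r / 3) => [|lam x x' lt_lam le_x le_x']; first by rewrite divr_gt0.
set a := cell_arg Q c x' lam; set b := cell_arg Q c x lam.
have abE : b - a = cell_arg Q c (x - x') 0.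
  by rewrite /a /b -cell_argB subrr.
have avE : a - lam *: v = cell_arg Q c (x' - lam *: Y) 0.
  by rewrite /a /v -cell_argZ -cell_argB mulr1 subrr.
have [xi [xi_a Exi]] := mvt_coord a b (fun i x => @smooth_derivable _ _ _ smf i x).
have xi_v i : `|xi i - lam *: v| <= r * `|lam|.
  apply: le_trans (ler_distD a _ _) _.
  apply: le_trans (lerD (xi_a i) (lexx _)) _.
  rewrite abE avE; apply: le_trans (lerD (cell_arg_norm _ _ _) (cell_arg_norm _ _ _)) _.
  apply: le_trans (lerD (ler_distD (lam *: Y) _ _) (lexx _)) _.
  rewrite [X in _ + X + _]distrC.
  by move: le_x le_x'; lra.
have lt_lam_r : `|lam| < r by move: lt_lam r0; lra.
have -> : (coupled Q f x lam - coupled Q f x' lam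
      - (J + lam *: second_order_mx Q f Y 1) *m (x - x')) c 0 =
    \sum_i (partial i f (xi i) - partial i f 0 - lam * (v *m hessian f) 0 i)
           * (b - a) 0 i.
  have EJ : (J *m (x - x')) c 0 = \sum_i partial i f 0 * (b - a) 0 i.
    by rewrite abE -(cell_arg_linear _ f0 _ _ 0); apply: eq_bigr => i _; rewrite mulrC.
  have EB : (second_order_mx Q f Y 1 *m (x - x')) c 0 =
      \sum_i (v *m hessian f) 0 i * (b - a) 0 i.
    rewrite second_order_mxE mxE [LHS]mxE abE; apply: eq_bigr => i _.
    by rewrite [_^T _ _]mxE.
  rewrite [LHS]mxE [X in X + _]mxE [X in _ + X]mxE [X in _ + X - _]mxE.
  rewrite !coupledE -/a -/b mulmxDl -scalemxAl.
  rewrite [(J *m _ + _) c 0]mxE [X in _ - (_ + X)]mxE EJ EB.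
  rewrite Exi mulr_sumr -big_split -sumrB; apply: eq_bigr => i _ /=.
  by rewrite !mxE; ring.
have -> : e * (`|lam| * `|x - x'|) = \sum_(i < k.+2) e' * `|lam| * `|x - x'|.
  have n0 : k.+2%:R != 0 :> R by rewrite pnatr_eq0.
  rewrite sumr_const card_ord -mulr_natl /e'; move: n0.
  by move: (k.+2%:R) => a0 n0; field.
apply: le_trans (ler_norm_sum _ _ _) _; apply: ler_sum => i _.
rewrite normrM ler_pM //; first exact: Hr.
by apply: le_trans (mx_coord_le_norm _ _ _) _; rewrite abE; exact: cell_arg_norm.
Qed.

Variables (m : nat) (V Vs : 'M[R]_(p, m)).
Hypothesis kerJ : forall y : 'cV[R]_p, J *m y = 0 -> exists c, y = V *m c.
Hypothesis VsJ : Vs^T *m J = 0.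
Hypothesis VsV : Vs^T *m V = 1%:M.

(* [S L] projects onto the subnetwork, and [F x - F (S L x)] is in the image of
   [(J + lam B) S] when [F x = 0]; up to an error small with respect to
   [lam * |x - S L x|] it is also [(J + lam B) (x - S L x)], so the pencil bound
   gives [x = S L x]. *)
Lemma zero_in_pullback p' (Q' : network p' k) (s : 'I_p -> 'I_p') (Y' : 'cV[R]_p') :
  fibration Q Q' s -> (forall c', exists c, s c = c') ->
  let Y := pullback R s *m Y' in
  Vs^T *m second_order_mx Q f Y 1 *m V \in unitmx ->
  exists2 r : R, 0 < r & forall lam (x : 'cV[R]_p), lam != 0 -> `|lam| < r ->
    `|x - lam *: Y| <= r * `|lam| -> coupled Q f x lam = 0 ->
    exists x', x = pullback R s *m x'.
Proof.
move=> fib surj; set S := pullback R s; move=> Y uM.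
have [L LS] := pullback_left_inverse R surj.
set B := second_order_mx Q f Y 1 in uM.
have [c c0 Hc] := pencil_lower_bound kerJ VsJ VsV uM.
have [K K0 HK] := mulmx_bound (1%:M - S *m L).
have [K' K'0 HK'] := mulmx_bound (S *m L).
(* Chosen so that the estimates end in |w| <= |w| / 2. *)
have e0 : 0 < c / (2 * K) by rewrite divr_gt0 // mulr_gt0.
have [r r0 Hr] := coupled_difference Y e0.
exists (Num.min c (Num.min r (r / K'))) => [|lam x lam0 lt_lam le_x Fx].
  by rewrite !lt_min c0 r0 divr_gt0.
have lt_c : `|lam| < c by move: lt_lam; rewrite !lt_min => /and3P[].
have lt_r : `|lam| < r by move: lt_lam; rewrite !lt_min => /and3P[].
have abslam : 0 < `|lam| by rewrite normr_gt0.
have le_xr : `|x - lam *: Y| <= r * `|lam|.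
  apply: le_trans le_x _; rewrite ler_wpM2r //.
  by rewrite !ge_min lexx orbT.
pose x' := S *m (L *m x); pose w := x - x'.
have le_x'r : `|x' - lam *: Y| <= r * `|lam|.
  have -> : x' - lam *: Y = S *m L *m (x - lam *: Y).
    rewrite mulmxBr -scalemxAr /Y [S *m L *m (S *m _)]mulmxA.
    by rewrite -[S *m L *m S]mulmxA LS mulmx1 /x' mulmxA.
  apply: le_trans (HK' _ _) _; rewrite -ler_pdivlMl //.
  apply: le_trans le_x _; rewrite mulrCA mulrA ler_wpM2r //.
  by rewrite !ge_min mulrC lexx !orbT.
(* The pencil of the subnetwork: [S] intertwines it with [J + lam B], so the lower bound makes it
   injective, hence invertible. *)
pose T := Defs.jacobian Q' (linear_part f) + lam *: second_order_mx Q' f Y' 1.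
have JS : J *m S = S *m _ := jacobian_pullback fib (linear_part f).
have ST : (J + lam *: B) *m S = S *m T.
  rewrite /T (mulmxDr S (Defs.jacobian Q' _)) (mulmxDl J) JS -scalemxAl -scalemxAr.
  congr (_ + _ *: _).
  apply/matrixP => i j.
  transitivity (col j (B *m S) i 0); first by rewrite [RHS]mxE.
  transitivity (col j (S *m second_order_mx Q' f Y' 1) i 0); last by rewrite [LHS]mxE.
  congr (_ i 0); rewrite !colE -!mulmxA !second_order_mxE.
  by rewrite (second_order_pullback fib).
have inj_T (z : 'cV[R]_p') : T *m z = 0 -> z = 0.
  move=> Tz; have := Hc lam (S *m z) lt_c.
  rewrite mulmxA ST -mulmxA Tz mulmx0 normr0 => H.
  have : `|S *m z| <= 0.
    by move: H; rewrite pmulr_rle0 // pmulr_rle0.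
  rewrite normr_le0 => /eqP Sz; by rewrite -[z]mul1mx -LS -mulmxA Sz mulmx0.
have uT : T \in unitmx.
  rewrite -unitmx_tr -row_free_unit -kermx_eq0; apply/eqP/row_matrixP => i.
  rewrite row0; apply: trmx_inj; rewrite trmx0; apply: inj_T.
  have : row i (kermx T^T) *m T^T = 0 by rewrite -row_mul mulmx_ker row0.
  by move/(congr1 trmx); rewrite trmx_mul trmxK trmx0.
have w0 : w = 0.
  pose z := - (invmx T *m coupled Q' f (L *m x) lam).
  have Eu : coupled Q f x lam - coupled Q f x' lam = (J + lam *: B) *m (S *m z).
    rewrite Fx sub0r /x' (coupled_pullback fib) -/S mulmxA ST -mulmxA /z.
    by rewrite mulmxN mulmxA mulmxV // mul1mx mulmxN.
  have B1 := Hr lam x x' lt_r le_xr le_x'r.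
  rewrite Eu -/w -mulmxBr in B1.
  have B2 := le_trans (Hc lam (S *m z - w) lt_c) B1.
  have B3 : c * `|S *m z - w| <= c / (2 * K) * `|w|.
    by rewrite -(ler_pM2l abslam) mulrCA [leRHS]mulrCA.
  (* [1 - S L] fixes [w] and kills the image of [S], so [w] is controlled by its distance to
     [S z]. *)
  have wE : w = (1%:M - S *m L) *m (w - S *m z).
    have SLS : S *m L *m S = S by rewrite -mulmxA LS mulmx1.
    have SLw : S *m L *m w = 0.
      by rewrite /w mulmxBr /x' !mulmxA SLS subrr.
    rewrite mulmxBl mul1mx [in X in _ - X]mulmxBr SLw (mulmxA (S *m L)) SLS.
    by rewrite sub0r opprK subrK.
  have B4 : `|w| <= K * `|S *m z - w|.
    by rewrite {1}wE distrC; exact: HK.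
  have B5 : `|S *m z - w| <= `|w| / (2 * K).
    rewrite -(ler_pM2l c0); apply: le_trans B3 _.
    by rewrite mulrAC mulrA.
  have : `|w| <= `|w| / 2.
    apply: le_trans B4 _; apply: le_trans (ler_wpM2l (ltW K0) B5) _.
    have Kn := lt0r_neq0 K0.
    by rewrite le_eqVlt; apply/orP; left; apply/eqP; field.
  move=> H; apply/eqP; rewrite -normr_le0.
  by move: H; lra.
exists (L *m x); apply/eqP; rewrite -subr_eq0; apply/eqP; exact: w0.
Qed.
End LocalUniqueness.

(** * Directions of small zeros *)

Lemma is_derive_quadratic (R : realType) (a b t : R) :
  is_derive t (1 : R) (fun s : R => s * a + s * s * (2^-1 * b)) (a + t * b).
Proof.
have Did := is_derive_id t (1 : R).
have D := is_deriveD (is_deriveM Did (is_derive_cst a t (1 : R)))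
  (is_deriveM (is_deriveM Did Did) (is_derive_cst (2^-1 * b) t (1 : R))).
apply: is_derive_eq D _; rewrite !scaler0 !add0r /cst -![_ *: _]/(_ * _).
by field.
Qed.

(** The mean value theorem on [0, 1] for f (t u) minus its quadratic Taylor polynomial in [t]; the
    derivative of this difference is small by the first-order expansion of the gradient. *)
Lemma taylor_order2 (R : realType) d (f : 'rV[R]_d -> R) (e : R) :
  smooth f -> 0 < e ->
  exists2 r : R, 0 < r & forall u : 'rV[R]_d, `|u| < r ->
    `|f u - f 0 - \sum_a u 0 a * partial a f 0 - 2^-1 * (u *m hessian f *m u^T) 0 0|
    <= e * `|u| ^+ 2.
Proof.
move=> smf e0; pose e' := e / d.+1%:R.
have e'0 : 0 < e' by rewrite divr_gt0.
pose P (a : 'I_d) (r : R) := forall xi : 'rV[R]_d, `|xi| < r ->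
   `|partial a f xi - partial a f 0 - (xi *m hessian f) 0 a| <= e' * `|xi|.
have [r r0 Hr] : exists2 r, 0 < r & forall a, P a r.
  apply: fin_pos_min => [a|a r r' _ le_r HP xi lt_xi]; last first.
    by apply: HP; exact: lt_le_trans le_r.
  have sma := smooth_partial smf a.
  have [r r0 Hr] := @strict_derivative _ _ _
    (fun j x => @smooth_derivable _ _ _ sma j x) 0 e'
    (fun j => @smooth_partial_continuous _ _ _ j 0 sma) e'0.
  exists r => // xi lt_xi; have := Hr 0 xi; rewrite subrr normr0 subr0.
  move=> /(_ r0 lt_xi); congr (`|_ - _| <= _).
  by rewrite mxE; apply: eq_bigr => b _; rewrite !mxE subr0 mulrC.
exists r => // u lt_u.
pose A := \sum_a u 0 a * partial a f 0; pose B := (u *m hessian f *m u^T) 0 0.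
pose psi (t : R) := f (0 + t *: u) - (t * A + t * t * (2^-1 * B)).
pose dpsi (t : R) := \sum_a u 0 a *
  (partial a f (0 + t *: u) - partial a f 0 - ((t *: u) *m hessian f) 0 a).
have dpsiP (t : R) : is_derive t (1 : R) psi (dpsi t).
  have D1 : is_derive t (1 : R) (fun s : R => f (0 + s *: u))
      (\sum_a u 0 a * partial a f (0 + t *: u)).
    rewrite -derive_partial; [|by move=> i x; exact: smooth_derivable|
      by move=> i; exact: smooth_partial_continuous].
    apply: is_derive_line; apply: diff_derivable.
    apply: differentiable_partial; first by move=> i x; exact: smooth_derivable.
    by move=> i; exact: smooth_partial_continuous.
  have D2 := is_derive_quadratic A B t.
  apply: (is_derive_eq (is_deriveB D1 D2)).
  rewrite /dpsi; under [RHS]eq_bigr do rewrite !mulrBr.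
  rewrite sumrB sumrB -addrA -opprD; congr (_ - (_ + _)).
  rewrite /B mxE mulr_sumr; apply: eq_bigr => a _.
  by rewrite -scalemxAl [_^T _ _]mxE [(t *: _ : 'rV_d) 0 a]mxE; ring.
have cpsi : {within `[0, 1], continuous psi}.
  apply: derivable_within_continuous => t _.
  exact: (@ex_derive _ _ _ _ _ _ _ (dpsiP t)).
have [t] := @MVT_segment R psi dpsi 0 1 ler01 (fun t _ => dpsiP t) cpsi.
rewrite in_itv /= => /andP[t0 t1].
rewrite subr0 mulr1 /psi scale1r scale0r !add0r !mul1r !mul0r addr0 subr0 => Et.
have -> : f u - f 0 - A - 2^-1 * B = dpsi t by rewrite -Et; ring.
apply: le_trans (ler_norm_sum _ _ _) _.
apply: (@le_trans _ _ (\sum_(a < d) e' * `|u| ^+ 2)).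
  apply: ler_sum => a _; rewrite normrM add0r.
  have norm_tu : `|t *: u| <= `|u| by rewrite normrZ (ger0_norm t0) ler_piMl.
  have /Hr Ha : `|t *: u| < r by exact: le_lt_trans lt_u.
  apply: le_trans (ler_pM _ _ (mx_coord_le_norm u 0 a) (Ha a)) _ => //.
  rewrite mulrCA expr2; apply: ler_wpM2l; first exact: ltW.
  by apply: ler_wpM2l.
rewrite sumr_const card_ord -mulr_natl mulrA; apply: ler_wpM2r; first exact: exprn_ge0.
rewrite /e' mulrCA ler_piMr // ?(ltW e0) // ler_pdivrMr // mul1r ler_nat.
exact: leqnSn.
Qed.

Section StatePart.
Variables (R : realType) (m : nat).
Implicit Types z : 'rV[R]_m.+1.

Lemma state_part_norm z : `|state_part z| <= `|z|.
Proof. by apply: mx_norm_le_coord => // i j; rewrite mxE mx_coord_le_norm. Qed.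

Lemma param_part_norm z : `|param_part z| <= `|z|.
Proof. exact: mx_coord_le_norm. Qed.

Lemma norm_state_param z e : 0 <= e ->
  `|state_part z| <= e -> `|param_part z| <= e -> `|z| <= e.
Proof.
move=> e0 se pe; apply: mx_norm_le_coord => // i j; rewrite (ord1 i).
case: (unliftP ord_max j) => [a|] -> //.
by apply: le_trans _ se; have := mx_coord_le_norm (state_part z) a 0; rewrite mxE.
Qed.

Lemma state_partB z z' : state_part (z - z') = state_part z - state_part z'.
Proof. by apply/colP => i; rewrite !mxE. Qed.

Lemma param_partB z z' : param_part (z - z') = param_part z - param_part z'.
Proof. by rewrite /param_part !mxE. Qed.

Lemma state_partZ a z : state_part (a *: z) = a *: state_part z.
Proof. by apply/colP => i; rewrite !mxE. Qed.

Lemma param_partZ a z : param_part (a *: z) = a * param_part z.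
Proof. by rewrite /param_part !mxE. Qed.

Lemma state_append (x : 'cV[R]_m) lam : state_part (append x^T lam) = x.
Proof. by apply/colP => i; rewrite !mxE liftK mxE. Qed.

Lemma param_append (x : 'cV[R]_m) lam : param_part (append x^T lam) = lam.
Proof. by rewrite /param_part mxE unlift_none. Qed.

End StatePart.

Lemma lipschitz_continuous (R : realType) (V W : normedModType R) (f : V -> W) K :
  0 < K -> (forall x y, `|f x - f y| <= K * `|x - y|) -> continuous f.
Proof.
move=> K0 Hf x; apply/cvgrPdist_le => e e0.
apply/nbhs_normP; exists (e / K) => /=; first by rewrite divr_gt0.
move=> y /= xy; apply: le_trans (Hf _ _) _; apply: ltW.
by rewrite mulrC -ltr_pdivlMr.
Qed.

Section Directions.
Variables (R : realType) (p k : nat) (Q : network p k) (f : 'rV[R]_k.+2 -> R).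
Hypothesis smf : smooth f.
Hypothesis f0 : forall lam, f (cell_args 0 (fun=> 0) lam) = 0.
Notation J := (Defs.jacobian Q (linear_part f)).
Let so (z : 'rV[R]_p.+1) : 'cV[R]_p :=
  second_order Q f (state_part z) (param_part z) (state_part z) (param_part z).

Lemma cell_arg_norm_z c (z : 'rV[R]_p.+1) :
  `|cell_arg Q c (state_part z) (param_part z)| <= `|z|.
Proof.
apply: mx_norm_le_coord => // i a; rewrite mxE.
case: unliftP => [b|] _; last exact: param_part_norm.
apply: le_trans (state_part_norm z).
by case: unliftP => [l|] _; exact: mx_coord_le_norm.
Qed.

Lemma second_order_bound : exists2 K : R, 0 < K & forall z, `|so z| <= K * `|z| ^+ 2.
Proof.
have [K K0 HK] := mulmx_bound (hessian f)^T.
exists (k.+2%:R * K) => [|z]; first by rewrite mulr_gt0.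
apply: mx_norm_le_coord => [|c j]; first by rewrite mulr_ge0 ?exprn_ge0 // mulr_ge0 // ltW.
rewrite (ord1 j) mxE mxE; set u := cell_arg _ _ _ _.
apply: le_trans (ler_norm_sum _ _ _) _.
apply: (@le_trans _ _ (\sum_(a < k.+2) K * `|z| ^+ 2)); last first.
  by rewrite sumr_const card_ord -[leLHS]mulr_natl mulrA lexx.
apply: ler_sum => a _; rewrite normrM [u^T _ _]mxE expr2 mulrA.
have uz : `|u| <= `|z| by exact: cell_arg_norm_z.
apply: ler_pM => //; last exact: le_trans (mx_coord_le_norm _ _ _) uz.
have -> : (u *m hessian f) 0 a = ((hessian f)^T *m u^T) a 0.
  by rewrite -trmx_mul [RHS]mxE.
apply: le_trans (mx_coord_le_norm _ _ _) _; apply: le_trans (HK _ _) _.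
by rewrite trmx_norm ler_wpM2l // ltW.
Qed.

Lemma coupled_taylor (e : R) : 0 < e -> exists2 r : R, 0 < r &
  forall z : 'rV[R]_p.+1, `|z| < r ->
  `|coupled Q f (state_part z) (param_part z) - J *m state_part z - 2^-1 *: so z|
    <= e * `|z| ^+ 2.
Proof.
move=> e0; have [r r0 Hr] := taylor_order2 smf e0.
exists r => // z lt_z; apply: mx_norm_le_coord => [|c j].
  by rewrite mulr_ge0 ?exprn_ge0 // ltW.
rewrite (ord1 j); set u := cell_arg Q c (state_part z) (param_part z).
have uz : `|u| <= `|z| by exact: cell_arg_norm_z.
have Hu := Hr u (le_lt_trans uz lt_z).
have := le_trans Hu (ler_wpM2l (ltW e0) (_ : `|u| ^+ 2 <= `|z| ^+ 2)).
rewrite ler_pXn2r ?nnegrE // => /(_ uz).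
congr (`|_| <= _); rewrite cell_arg_linear // f_origin // subr0.
rewrite [RHS]mxE [X in _ = X + _]mxE [X in _ = _ + X]mxE [X in _ = _ + X - _]mxE.
rewrite coupledE -/u; congr (_ - _ - _).
by rewrite [RHS]mxE [so z _ _]mxE.
Qed.

Lemma continuous_linear_state n (A : 'M[R]_(n, p)) (Y : 'cV[R]_n) :
  continuous (fun z : 'rV[R]_p.+1 => A *m state_part z + param_part z *: Y).
Proof.
have [K K0 HK] := mulmx_bound A.
apply: (@lipschitz_continuous _ _ _ _ (K + `|Y|)); first by rewrite ltr_wpDr.
move=> z z'; rewrite opprD addrACA -mulmxBr -scalerBl -state_partB -param_partB.
apply: le_trans (ler_normD _ _) _; rewrite mulrDl; apply: lerD.
  apply: le_trans (HK _ _) _; apply: ler_wpM2l; first exact: ltW.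
  exact: state_part_norm.
by rewrite normrZ mulrC ler_wpM2l // param_part_norm.
Qed.

Lemma continuous_norm_comp (T : topologicalType) (V : normedModType R) (g : T -> V) :
  continuous g -> continuous (fun z => `|g z|).
Proof. by move=> cg z; apply: continuous_comp; [exact: cg|exact: norm_continuous]. Qed.

Lemma continuous_cell_arg c a :
  continuous (fun z : 'rV[R]_p.+1 => cell_arg Q c (state_part z) (param_part z) 0 a).
Proof.
apply: (@lipschitz_continuous _ _ _ _ 1) => // z z'.
have -> : cell_arg Q c (state_part z) (param_part z) 0 a -
    cell_arg Q c (state_part z') (param_part z') 0 a =
    cell_arg Q c (state_part (z - z')) (param_part (z - z')) 0 a.
  by rewrite state_partB param_partB cell_argB [RHS]mxE [X in _ = _ + X]mxE.
rewrite mul1r; apply: le_trans (mx_coord_le_norm _ _ _) _; exact: cell_arg_norm_z.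
Qed.

Lemma continuous_second_order n (A : 'M[R]_(n, p)) i :
  continuous (fun z : 'rV[R]_p.+1 => (A *m so z) i 0).
Proof.
rewrite (_ : (fun z => _) = (fun z => \sum_c A i c * \sum_b
   (\sum_a cell_arg Q c (state_part z) (param_part z) 0 a * hessian f a b) *
   cell_arg Q c (state_part z) (param_part z) 0 b)); last first.
  apply/funext => z; rewrite mxE; apply: eq_bigr => c _; congr (_ * _).
  rewrite mxE mxE; apply: eq_bigr => b _; rewrite [_^T _ _]mxE; congr (_ * _).
  by rewrite mxE.
have csum (I : finType) (F : I -> 'rV[R]_p.+1 -> R) :
    (forall j, continuous (F j)) -> continuous (fun z => \sum_j F j z).
  by move=> cF; apply: continuous_big => //; exact: add_continuous.
have c1 c b : continuous (fun z : 'rV[R]_p.+1 =>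
    \sum_a cell_arg Q c (state_part z) (param_part z) 0 a * hessian f a b).
  apply: csum => a z; apply: (@cvgM _ _ (nbhs z)); last exact: cvg_cst.
  exact: continuous_cell_arg.
have c2 c : continuous (fun z : 'rV[R]_p.+1 => \sum_b
   (\sum_a cell_arg Q c (state_part z) (param_part z) 0 a * hessian f a b) *
   cell_arg Q c (state_part z) (param_part z) 0 b).
  apply: csum => b z; apply: (@cvgM _ _ (nbhs z)); first exact: c1.
  exact: continuous_cell_arg.
by apply: csum => c z; apply: (@cvgM _ _ (nbhs z)); [exact: cvg_cst|exact: c2].
Qed.
End Directions.

Section ZeroDirections.
Variables (R : realType) (p k m : nat) (Q : network p k) (f : 'rV[R]_k.+2 -> R).
Hypothesis smf : smooth f.
Hypothesis f0 : forall lam, f (cell_args 0 (fun=> 0) lam) = 0.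
Notation J := (Defs.jacobian Q (linear_part f)).
Variables (Vs : 'M[R]_(p, m)) (s : nat) (Y : 'I_s -> 'cV[R]_p).
Hypothesis VsJ : Vs^T *m J = 0.
Hypothesis directions : forall (x : 'cV[R]_p) lam, (x != 0) || (lam != 0) ->
  J *m x = 0 -> Vs^T *m second_order Q f x lam x lam = 0 ->
  lam != 0 /\ exists j, x = lam *: Y j.

Let so (z : 'rV[R]_p.+1) : 'cV[R]_p :=
  second_order Q f (state_part z) (param_part z) (state_part z) (param_part z).

Let soZ a z : so (a *: z) = a ^+ 2 *: so z.
Proof.
rewrite /so state_partZ param_partZ second_orderZ.
by rewrite [X in _ *: X]second_order_sym // second_orderZ scalerA expr2.
Qed.

(** The defect in the leading equations of a zero, one of degree one and one of degree two; as it
    mixes degrees, it is compared on the unit sphere. *)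
Let Psi (z : 'rV[R]_p.+1) : R :=
  `|J *m state_part z| + \sum_i `|(Vs^T *m so z) i 0|.

(** Removing open cones around the directions [(Y j, 1)] leaves a compact part of the unit
    sphere. *)
Let off_cone (e : R) : set 'rV[R]_p.+1 :=
  [set z | `|z| = 1 /\
     forall j, e * `|param_part z| <= `|state_part z - param_part z *: Y j|].

Let continuous_Psi : continuous Psi.
Proof.
have c1 : continuous (fun z : 'rV[R]_p.+1 => `|J *m state_part z|).
  apply: continuous_norm_comp.
  rewrite (_ : (fun z => _) = fun z => J *m state_part z + param_part z *: 0).
    exact: continuous_linear_state.
  by apply/funext => z; rewrite scaler0 addr0.
have c2 : continuous (fun z : 'rV[R]_p.+1 => \sum_i `|(Vs^T *m so z) i 0|).
  apply: continuous_big => [|i _]; first exact: add_continuous.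
  by apply: continuous_norm_comp; exact: continuous_second_order.
by move=> z; apply: (@cvgD _ _ _ (nbhs z)); [exact: c1|exact: c2].
Qed.

Let compact_off_cone e : compact (off_cone e).
Proof.
apply: bounded_closed_compact.
  exists 1; split=> // M M1 z [z1 _] /=; rewrite z1; exact: ltW.
rewrite (_ : off_cone e = [set z | `|z| = 1] `&` \bigcap_(j in [set: 'I_s])
    [set z | 0 <= `|state_part z - param_part z *: Y j| - e * `|param_part z| ]);
    last first.
  apply/seteqP; split=> z /= [z1 Hz]; split=> // j; first by move=> _ /=; rewrite subr_ge0.
  by have := Hz j I; rewrite /= subr_ge0.
have cparam : continuous (fun z : 'rV[R]_p.+1 => param_part z : R).
  apply: (@lipschitz_continuous _ _ _ _ 1) => // z z'.
  by rewrite mul1r -param_partB; exact: param_part_norm.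
apply: closedI; last apply: closed_bigI => j _.
  rewrite (_ : mkset _ = (fun z : 'rV[R]_p.+1 => `|z|) @^-1` [set x | x = 1]) //.
  by apply: closed_comp => [z _|]; [exact: norm_continuous|exact: closed_eq].
rewrite (_ : mkset _ = (fun z : 'rV[R]_p.+1 =>
    `|state_part z - param_part z *: Y j| - e * `|param_part z|)
    @^-1` [set x | 0 <= x]) //.
apply: closed_comp => [z _|]; last exact: closed_ge.
apply: (@cvgB _ _ _ (nbhs z)).
  have cz : continuous (fun z : 'rV[R]_p.+1 => state_part z - param_part z *: Y j).
    rewrite (_ : (fun z => _) =
        fun z => 1%:M *m state_part z + param_part z *: (- Y j)).
      exact: continuous_linear_state.
    by apply/funext => z'; rewrite mul1mx scalerN.
  exact: (continuous_norm_comp cz).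
apply: (@cvgM _ _ (nbhs z)); first exact: cvg_cst.
exact: (continuous_norm_comp cparam).
Qed.

Let Psi_gt0 e z : 0 < e -> off_cone e z -> 0 < Psi z.
Proof.
move=> e0 [z1 Hz].
have Psi0 : 0 <= Psi z by apply: addr_ge0 => //; apply: sumr_ge0.
rewrite lt_def Psi0 andbT; apply/eqP => /eqP.
rewrite paddr_eq0 //; last by apply: sumr_ge0.
rewrite normr_eq0 psumr_eq0 // => /andP[/eqP Jz /allP Vz].
have zn : (state_part z != 0) || (param_part z != 0).
  rewrite -negb_and; apply/negP => /andP[/eqP s0 /eqP p0].
  have : `|z| <= 0 by apply: norm_state_param; rewrite ?s0 ?p0 ?normr0.
  by rewrite z1 ler10.
have [|lam0 [j Ej]] := directions zn Jz.
  apply/colP => i; rewrite [RHS]mxE; apply/eqP; rewrite -normr_eq0.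
  exact: (Vz i (mem_index_enum i)).
have := Hz j; rewrite Ej subrr normr0 pmulr_rle0 // normr_le0.
by rewrite (negbTE lam0).
Qed.

(** A zero of norm rho has J x = O(rho^2) and, since [Vs^T] kills [J], a quadratic part that is
    o(rho^2) under [Vs^T]. After scaling to norm 1 both defects are small, whereas [Psi] has a
    positive minimum off the cones. *)
Lemma zero_directions (e : R) : 0 < e -> exists2 d : R, 0 < d &
  forall (x : 'cV[R]_p) lam, `|x| < d -> `|lam| < d -> lam != 0 ->
    coupled Q f x lam = 0 -> exists j, `|x - lam *: Y j| <= e * `|lam|.
Proof.
move=> e0.
have [eta eta0 Heta] : exists2 eta, 0 < eta & forall z, off_cone e z -> eta <= Psi z.
  have [[z0 Sz0]|S0] := pselect (off_cone e !=set0); last first.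
    by exists 1 => // z Sz; case: S0; exists z.
  have [c cS cmin] := @EVT_min_rV R p.+1 Psi (off_cone e)
    (ex_intro _ z0 Sz0) (@compact_off_cone e) (continuous_subspaceT continuous_Psi).
  exists (Psi c); first by apply: Psi_gt0 e0 _; rewrite inE in cS.
  by move=> z Sz; apply: cmin; rewrite inE.
have [K K0 HK] := second_order_bound Q f.
have [L L0 HL] := mulmx_bound Vs^T.
(* The defects will stay below 3/8 of [eta]: one eighth from [J x], two eighths from the quadratic
   part. Using [m.+1] avoids a zero denominator when [m = 0]. *)
pose e1 := eta / 8 / (m.+1%:R * L).
have e10 : 0 < e1 by rewrite !divr_gt0 // mulr_gt0.
have [r r0 Hr] := coupled_taylor Q smf f0 e10.
exists (Num.min r (eta / 8 / (e1 + K))) => [|x lam lt_x lt_lam lam0 Fx].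
  by rewrite lt_min r0 !divr_gt0 // addr_gt0.
pose z := append x^T lam; pose rho := `|z|.
have zs : state_part z = x by exact: state_append.
have zp : param_part z = lam by exact: param_append.
have rho0 : 0 < rho.
  by rewrite normr_gt0; apply: contra_neq lam0 => z0; rewrite -zp z0 /param_part mxE.
have x0 := normr_ge0 x; have l0 := normr_ge0 lam.
have lt_rho : rho < Num.min r (eta / 8 / (e1 + K)).
  apply: le_lt_trans (_ : Num.max `|x| `|lam| < _); last by rewrite gt_max lt_x.
  by apply: norm_state_param; rewrite ?zs ?zp le_max ?lexx ?orbT ?x0.
have lt_r : rho < r by move: lt_rho; rewrite lt_min => /andP[].
have lt_K : rho * (e1 + K) < eta / 8.
  by rewrite -ltr_pdivlMr ?addr_gt0 //; move: lt_rho; rewrite lt_min => /andP[].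
have [[j Hj]|Hno] := pselect (exists j, `|x - lam *: Y j| <= e * `|lam|).
  by exists j.
pose zn := rho^-1 *: z.
have rhoV0 : 0 < rho^-1 by rewrite invr_gt0.
have rhoN : `|rho^-1| = rho^-1 by rewrite gtr0_norm.
have zn_off : off_cone e zn.
  split; first by rewrite /zn normrZ rhoN mulVf // lt0r_neq0.
  move=> j; rewrite /zn state_partZ param_partZ zs zp -scalerA -scalerBr.
  rewrite normrM normrZ rhoN mulrCA ler_pM2l //.
  rewrite leNgt; apply/negP => lt_e; apply: Hno; exists j; exact: ltW.
have := Heta _ zn_off; rewrite /Psi /zn state_partZ soZ -scalemxAr normrZ rhoN.
have soE : so z = second_order Q f x lam x lam by rewrite /so zs zp.
have Tz := Hr z lt_r; rewrite zs zp Fx sub0r -soE in Tz.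
have B1 : `|J *m x| <= (e1 + K) * rho ^+ 2.
  rewrite -[J *m x]opprK normrN -[- (J *m x)](subrK (2^-1 *: so z)).
  apply: le_trans (ler_normD _ _) _; rewrite mulrDl; apply: lerD; first exact: Tz.
  rewrite normrZ; apply: le_trans (_ : 1 * `|so z| <= _); last by rewrite mul1r; exact: HK.
  apply: ler_wpM2r => //; rewrite ger0_norm ?invr_ge0 // invf_le1 //.
  by rewrite ler1n.
have B2 i : `|(Vs^T *m so z) i 0| <= 2 * (L * (e1 * rho ^+ 2)).
  have -> : Vs^T *m so z = - (2 *: (Vs^T *m (- (J *m x) - 2^-1 *: so z))).
    rewrite mulmxBr mulmxN mulmxA VsJ mul0mx oppr0 sub0r -scalemxAr scalerN opprK.
    by rewrite scalerA mulfV ?scale1r.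
  rewrite mxE normrN; apply: le_trans (mx_coord_le_norm _ _ _) _.
  rewrite normrZ (ger0_norm (ler0n _ 2)) ler_wpM2l //.
  by apply: le_trans (HL _ _) _; rewrite ler_wpM2l // ltW.
rewrite leNgt => /negP[]; rewrite zs.
apply: (@le_lt_trans _ _ (rho * (e1 + K) + m%:R * (2 * (L * e1)))).
  apply: lerD.
    rewrite mulrC ler_pdivrMr //; apply: le_trans B1 _.
    by rewrite expr2 mulrCA mulrA.
  rewrite (_ : m%:R * _ = \sum_(i < m) 2 * (L * e1)); last first.
    by rewrite sumr_const card_ord mulr_natl.
  apply: ler_sum => i _; rewrite -scalemxAr mxE normrM normrX rhoN.
  rewrite exprVn mulrC ler_pdivrMr ?exprn_gt0 //.
  by apply: le_trans (B2 i) _; rewrite !mulrA.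
have e1E : m.+1%:R * (L * e1) = eta / 8.
  rewrite /e1 mulrA mulrC divfK // mulf_neq0 // ?lt0r_neq0 //.
have : m%:R * (2 * (L * e1)) <= 2 * (eta / 8).
  rewrite -e1E mulrCA ler_wpM2l //; apply: ler_wpM2r; last by rewrite ler_nat.
  by apply: mulr_ge0; exact: ltW.
by move: lt_K eta0; lra.
Qed.
End ZeroDirections.

(** * Genericity and synchrony subspaces *)

Section Generic.
Variables (R : realType) (k : nat).
Notation space := ('rV[R]_k.+2 -> R).
Implicit Types (X : set space) (P : space -> Prop).

Lemma generically_sub X X' P : X' `<=` X -> generically X P -> generically X' P.
Proof. by move=> sX [q [c Hc]]; exists q, c => f /sX; exact: Hc. Qed.

Lemma generically_mono X P P' : (forall f, X f -> P f -> P' f) ->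
  generically X P -> generically X P'.
Proof. by move=> PP' [q [c Hc]]; exists q, c => f Xf Hf; apply: PP' => //; exact: Hc. Qed.

Lemma generically_nd X c : generically X (fun f => nd_holds c f).
Proof. by exists 1, (fun=> c) => f _ /(_ ord0). Qed.

Lemma generically_and X P P' : generically X P -> generically X P' ->
  generically X (fun f => P f /\ P' f).
Proof.
move=> [q [c Hc]] [q' [c' Hc']].
exists (q + q')%N, (fun i => match fintype.split i with inl j => c j | inr j => c' j end).
move=> f Xf Hf; split.
  by apply: Hc => // j; have := Hf (lshift q' j); rewrite (unsplitK (inl j)).
by apply: Hc' => // j; have := Hf (rshift q j); rewrite (unsplitK (inr j)).
Qed.

Lemma generically_forall X n (P : 'I_n -> space -> Prop) :
  (forall i, generically X (P i)) -> generically X (fun f => forall i, P i f).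
Proof.
elim: n P => [|n IHn] P HP.
  have c : 'I_0 -> nondegeneracy R k by case.
  by exists 0%N, c => f _ _ [].
apply: generically_mono (generically_and (HP ord0) (IHn _ (fun i => HP (lift ord0 i)))).
by move=> f _ [P0 PS] i; case: (unliftP ord0 i) => [j|] ->.
Qed.
End Generic.

Section Synchrony.
Variables (R : realType) (n k : nat) (N : network n k).
Implicit Types (D : synchrony R N).

Lemma sync_setP D (x : 'cV[R]_n) :
  sync_set D x <-> exists x', x = pullback R (cell_class D) *m x'.
Proof.
split=> [Dx|[x' ->] i j Eij]; last by rewrite !pullbackE Eij.
have [t Ht] := fin_all_exists (@class_surj _ _ _ _ D).
exists (\col_c x (t c) 0); apply/colP => i; rewrite pullbackE mxE.
by apply: Dx; rewrite Ht.
Qed.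

(** Invariance is tested on the indicator of the class of [N l j], because [A_l x] has the
    coordinate [x (N l a)] at [a]. *)
Lemma class_edge D l i j : cell_class D i = cell_class D j ->
  cell_class D (N l i) = cell_class D (N l j).
Proof.
move=> Eij; pose x : 'cV[R]_n := \col_a (cell_class D a == cell_class D (N l j))%:R.
have Dx : polydiagonal (cell_class D) x by move=> a a' Ea; rewrite !mxE Ea.
have Ax a : (adjacency R N l *m x) a 0 = x (N l a) 0.
  rewrite mxE (bigD1 (N l a)) //= mxE eqxx mul1r big1 ?addr0 // => b nb.
  by rewrite mxE eq_sym (negbTE nb) mul0r.
have := @class_invariant _ _ _ _ D l x Dx i j Eij; rewrite !Ax !mxE eqxx.
by case: eqP => // _ /eqP; rewrite eq_sym oner_eq0.
Qed.

Lemma quotient_fibration D : fibration N (quotient D) (cell_class D).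
Proof.
move=> l i; rewrite /quotient; case: pickP => [j /eqP Ej|/(_ i)]; last by rewrite eqxx.
exact: class_edge.
Qed.

(** The indicator of a class of [D'] lies in [sync_set D'], so it is constant on the classes of
    [D]. *)
Lemma class_factor D D' : sync_set D' `<=` sync_set D ->
  exists s : 'I_(nclass D) -> 'I_(nclass D'),
    forall i, cell_class D' i = s (cell_class D i).
Proof.
move=> sub; have [t Ht] := fin_all_exists (@class_surj _ _ _ _ D).
exists (fun c => cell_class D' (t c)) => i.
pose x : 'cV[R]_n := \col_a (cell_class D' a == cell_class D' i)%:R.
have D'x : sync_set D' x by move=> a a' Ea; rewrite !mxE Ea.
have := sub _ D'x i (t (cell_class D i)) (esym (Ht _)); rewrite !mxE eqxx.
by case: eqP => // _ /eqP; rewrite oner_eq0.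
Qed.

Lemma factor_fibration D D' (s : 'I_(nclass D) -> 'I_(nclass D')) :
  (forall i, cell_class D' i = s (cell_class D i)) ->
  fibration (quotient D) (quotient D') s.
Proof.
move=> Hs l c; have [i <-] := class_surj (s := D) c.
by rewrite -Hs !quotient_fibration Hs.
Qed.

Lemma factor_surj D D' (s : 'I_(nclass D) -> 'I_(nclass D')) :
  (forall i, cell_class D' i = s (cell_class D i)) -> forall c', exists c, s c = c'.
Proof.
by move=> Hs c'; have [i <-] := class_surj (s := D') c'; exists (cell_class D i).
Qed.

Lemma kernel_classes (T : eqType) (h : 'I_n -> T) :
  exists p (c : 'I_n -> 'I_p), (forall a, exists i, c i = a) /\
    forall i j, c i = c j <-> h i = h j.
Proof.
pose s := undup (codom h).
have hs i : (index (h i) s < size s)%N by rewrite index_mem mem_undup codom_f.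
exists (size s), (fun i => Ordinal (hs i)); split=> [a|i j].
  have [i Ei] : exists i, h i = tnth (in_tuple s) a.
    have : tnth (in_tuple s) a \in codom h by rewrite -mem_undup mem_tnth.
    by case/codomP => i ->; exists i.
  exists i; apply: val_inj; rewrite /= Ei (tnth_nth (h i)) /=.
  by rewrite index_uniq ?undup_uniq.
split=> [/(congr1 val) /= Eij|Eij]; last by apply: val_inj; rewrite /= Eij.
have hin l : h l \in s by rewrite mem_undup codom_f.
by rewrite -(nth_index (h i) (hin i)) Eij nth_index.
Qed.

(** The classes are the connected components of the union of the two equivalences, numbered through
    their roots. *)
Lemma sync_intersection D D' : exists D'' : synchrony R N,
  sync_set D'' = sync_set D `&` sync_set D'.
Proof.
pose e : rel 'I_n := fun i j =>
  (cell_class D i == cell_class D j) || (cell_class D' i == cell_class D' j).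
have sym_e : ssrbool.symmetric e by move=> i j; rewrite /e eq_sym [X in _ || X]eq_sym.
have csym : connect_sym e by exact: sym_connect_sym.
have [p [c [surj Hc]]] := kernel_classes (fingraph.root e).
have polyE : polydiagonal c = sync_set D `&` sync_set D' :> set 'cV[R]_n.
  apply/seteqP; split=> x.
    move=> cx; split=> i j Eij; apply: cx; apply/Hc/eqP; rewrite (root_connect csym);
    by apply: connect1; rewrite /e Eij eqxx ?orbT.
  move=> [Dx D'x] i j /Hc/eqP; rewrite (root_connect csym) => /connectP[s].
  elim: s i => [|a s IHs] i /=; first by move=> _ ->.
  move=> /andP[eia path_s] Ej; rewrite -(IHs a path_s Ej).
  by case/orP: eia => /eqP; [exact: Dx|exact: D'x].
have inv l (x : 'cV[R]_n) : polydiagonal c x -> polydiagonal c (adjacency R N l *m x).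
  rewrite polyE => -[Dx D'x]; split.
    exact: (@class_invariant _ _ _ _ D).
  exact: (@class_invariant _ _ _ _ D').
by exists (Synchrony surj inv).
Qed.

Lemma kernel_eigenvalue D (a : 'rV[R]_k.+1) (u : 'cV[R]_n) :
  sync_set D u -> u != 0 -> Defs.jacobian N a *m u = 0 ->
  eigenvalue (jacobianC (quotient D) a) 0.
Proof.
move=> /sync_setP[u' ->] nz; set S := pullback R _.
rewrite mulmxA (jacobian_pullback (@quotient_fibration D)) -mulmxA => SJ.
have [L LS] := pullback_left_inverse R (@class_surj _ _ _ _ D).
have Ju : Defs.jacobian (quotient D) a *m u' = 0.
  by rewrite -[LHS]mul1mx -LS -mulmxA SJ mulmx0.
have u'0 : u' != 0 by apply: contraNneq nz => ->; rewrite mulmx0.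
have detJ : \det (Defs.jacobian (quotient D) a) = 0.
  rewrite -det_tr; apply/eqP/det0P; exists u'^T.
    by rewrite -trmx0 (inj_eq trmx_inj).
  by rewrite -trmx_mul Ju trmx0.
rewrite eigenvalue_root_char rootE horner_coef0 char_poly_det.
by rewrite /jacobianC det_map_mx detJ rmorph0 mulr0.
Qed.
End Synchrony.

(** * Zeros of the reduced quadratic map *)

Lemma second_order_lambda (R : realType) p k (Q : network p k)
    (f : 'rV[R]_k.+2 -> R) x :
  second_order Q f x 0 0 1 = Defs.jacobian Q (lambda_part f) *m x.
Proof.
apply/colP => c; rewrite mxE; set v := (cell_arg Q c 0 1)^T.
have -> : v = delta_mx ord_max 0.
  apply/colP => a; rewrite [v _ _]mxE mxE [RHS]mxE.
  case: unliftP => [i|] ->; rewrite ?eqxx //.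
  rewrite [_ == ord_max]eq_sym (negbTE (neq_lift _ _)).
  by case: unliftP => [l|] _; rewrite mxE.
rewrite -mulmxA -colE mxE.
transitivity (\sum_a cell_arg Q c x 0 0 a * partial a (partial ord_max f) 0).
  by apply: eq_bigr => a _; rewrite [col _ _ _ _]mxE [hessian f _ _]mxE.
by rewrite cell_arg_sum mul0r addr0.
Qed.

Lemma second_order_lambda2 (R : realType) p k (Q : network p k)
    (f : 'rV[R]_k.+2 -> R) : (forall lam, f (cell_args 0 (fun=> 0) lam) = 0) ->
  second_order Q f 0 1 0 1 = 0.
Proof.
move=> f0; apply/colP => c; rewrite mxE [RHS]mxE.
have -> : cell_arg Q c (0 : 'cV[R]_p) 1 = delta_mx 0 ord_max.
  apply/rowP => a; rewrite mxE [RHS]mxE.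
  case: unliftP => [i|] ->; rewrite ?eqxx //.
  rewrite [_ == ord_max]eq_sym (negbTE (neq_lift _ _)).
  by case: unliftP => [l|] _; rewrite mxE.
by rewrite -rowE trmx_delta -colE !mxE partial_lambda_lambda0.
Qed.

Lemma second_order_quadratic (R : realType) p k (Q : network p k)
    (f : 'rV[R]_k.+2 -> R) x t : smooth f ->
  (forall lam, f (cell_args 0 (fun=> 0) lam) = 0) ->
  second_order Q f (t *: x) 1 (t *: x) 1 =
  t ^+ 2 *: second_order Q f x 0 x 0 + (2 * t) *: (Defs.jacobian Q (lambda_part f) *m x).
Proof.
move=> smf f0.
have split1 y lam : second_order Q f y lam (t *: x) 1 =
    t *: second_order Q f y lam x 0 + second_order Q f y lam 0 1.
  by rewrite -second_orderZ -second_orderD mulr0 addr0 add0r.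
have E1 : second_order Q f (t *: x) 1 x 0 =
    t *: second_order Q f x 0 x 0 + second_order Q f x 0 0 1.
  by rewrite second_order_sym // split1.
have E2 : second_order Q f (t *: x) 1 0 1 = t *: second_order Q f x 0 0 1.
  rewrite second_order_sym // split1 second_order_lambda2 // addr0.
  by congr (_ *: _); exact: second_order_sym.
rewrite split1 E1 E2 -second_order_lambda scalerDr scalerA -expr2 -addrA.
by congr (_ + _); rewrite -scalerDl -mulr2n mulr_natl.
Qed.

(** The left kernel of [J] annihilates [1 - v w^T], whose columns therefore lie in the range of
    [J]. *)
Lemma left_kernel_complement (R : realType) p (J : 'M[R]_p) (v w : 'cV[R]_p) :
  (forall y : 'cV[R]_p, y^T *m J = 0 -> exists c : 'M[R]_1, y = w *m c) ->
  w^T *m v = 1%:M -> exists G, 1%:M - v *m w^T = J *m G.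
Proof.
move=> coker wv; have vw : v^T *m w = 1%:M.
  by rewrite -[LHS]trmxK trmx_mul trmxK wv trmx1.
suff /submxP[G HG] : ((1%:M - v *m w^T)^T <= J^T)%MS.
  by exists G^T; rewrite -[LHS]trmxK HG trmx_mul trmxK.
rewrite submxE; apply/eqP/matrixP => i j.
have [c Hc] : exists c : 'M[R]_1, col j (cokermx J^T) = w *m c.
  apply: coker; rewrite -[J]trmxK -trmx_mul trmxK colE mulmxA mulmx_coker.
  by rewrite mul0mx trmx0.
transitivity (col j ((1%:M - v *m w^T)^T *m cokermx J^T) i 0); first by rewrite [RHS]mxE.
rewrite colE -mulmxA -colE Hc linearB /= trmx1 trmx_mul trmxK mulmxBl mul1mx.
by rewrite -!mulmxA (mulmxA v^T) vw mul1mx subrr !mxE.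
Qed.

Section LineZero.
Variables (R : realType) (p p' k m : nat).
Variables (Q : network p k) (Q' : network p' k) (s : 'I_p -> 'I_p').
Hypothesis fib : fibration Q Q' s.
Hypothesis surj : forall c', exists c, s c = c'.
Variable f : 'rV[R]_k.+2 -> R.
Hypothesis smf : smooth f.
Hypothesis f0 : forall lam, f (cell_args 0 (fun=> 0) lam) = 0.
Variables (g : 'I_m -> 'rV[R]_m.+1 -> R) (V Vs : 'M[R]_(p, m)).
Variables (g' : 'I_1 -> 'rV[R]_2 -> R) (v w : 'cV[R]_p').
Hypothesis dataQ : reduction_data Q f g V Vs.
Hypothesis dataQ' : reduction_data Q' f g' v w.
Hypothesis g'2 : partial ord0 (partial ord0 (g' ord0)) 0 <> 0.
Hypothesis g'lam : (w^T *m Defs.jacobian Q' (lambda_part f) *m v) 0 0 <> 0.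

Lemma line_zero : exists y : 'cV[R]_m, [/\ y != 0,
  Vs^T *m second_order Q f (V *m y) 1 (V *m y) 1 = 0 &
  exists u, V *m y = pullback R s *m u].
Proof.
set S := pullback R s.
have JS := jacobian_pullback fib (linear_part f) : _ *m S = _.
have [e He] : exists e, S *m v = V *m e.
  apply: (red_ker dataQ); rewrite mulmxA JS -mulmxA (red_JV dataQ').
  exact: mulmx0.
have [G HG] := left_kernel_complement (red_coker dataQ') (red_dual dataQ').
(* Modulo the range of the Jacobian of [Q'], which [S] carries into the range of [J], [u] is a
   multiple of [v]. This is why the reduced map sends the line of [e] to itself. *)
have VsS (u : 'cV[R]_p') : Vs^T *m (S *m u) = (w^T *m u) 0 0 *: e.
  have uE : u = v *m (w^T *m u) + Defs.jacobian Q' (linear_part f) *m (G *m u).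
    by rewrite [X in _ + X]mulmxA -HG mulmxBl mul1mx !mulmxA addrC subrK.
  transitivity (Vs^T *m (S *m v) *m (w^T *m u) +
      Vs^T *m Defs.jacobian Q (linear_part f) *m (S *m (G *m u))).
    rewrite {1}uE (mulmxDr S) (mulmxDr Vs^T (S *m _)) !mulmxA; congr (_ + _).
    by rewrite -(mulmxA Vs^T _ S) JS !mulmxA.
  rewrite (red_VsJ dataQ) mul0mx addr0 He (mulmxA Vs^T V) (red_dual dataQ) mul1mx.
  by rewrite {1}[w^T *m u]mx11_scalar mul_mx_scalar.
pose A := (w^T *m second_order Q' f v 0 v 0) 0 0.
pose B := (w^T *m Defs.jacobian Q' (lambda_part f) *m v) 0 0.
have A0 : A != 0.
  apply/eqP => A0; apply: g'2; rewrite (red_ddg0 dataQ') -[RHS]A0.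
  have -> : param_part (delta_mx 0 ord0 : 'rV[R]_2) = 0.
    by rewrite /param_part mxE.
  have -> : v *m state_part (delta_mx 0 ord0) = v.
    rewrite [state_part _](_ : _ = 1%:M) ?mulmx1 //.
    by apply/matrixP => i j; rewrite !mxE !ord1.
  by rewrite (ord1 ord0).
have B0 : B != 0 by apply/eqP.
(* The nonzero root of t (A t + 2 B). *)
pose t := - (2 * B) / A.
have t0 : t != 0 by rewrite mulf_neq0 ?invr_eq0 // oppr_eq0 mulf_neq0 // pnatr_eq0.
have e0 : e != 0.
  apply/eqP => e0; have [L LS] := pullback_left_inverse R surj.
  have v0 : v = 0 by rewrite -[v]mul1mx -LS -mulmxA -/S He e0 !mulmx0.
  have := red_dual dataQ'; rewrite v0 mulmx0 => /matrixP/(_ 0 0)/eqP.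
  by rewrite !mxE eq_sym oner_eq0.
exists (t *: e); rewrite -scalemxAr -He scalemxAr; split.
- by rewrite scaler_eq0 negb_or t0.
- rewrite (second_order_pullback fib) VsS.
  rewrite second_order_quadratic // mulmxDr -!scalemxAr mulmxA.
  rewrite [X in X *: _](_ : _ = t ^+ 2 * A + 2 * t * B); last first.
    by rewrite mxE [X in X + _]mxE [X in _ + X]mxE.
  rewrite (_ : _ + _ = 0) ?scale0r // /t.
  by field.
- by exists (t *: v).
Qed.
End LineZero.

(** * The reduction as a system of quadratic forms *)

Lemma meval_mderiv_mvar (R : realType) d (v : 'I_d -> R) i j :
  meval v (mderiv j (mvar R i)) = (i == j)%:R.
Proof.
rewrite mderivX mevalZ mnm1E; case: eqP => [->|_]; last by rewrite mul0r.
by rewrite mul1r mevalX big1 // => l _; rewrite mnmBE subnn.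
Qed.

Section ReducedForm.
Variables (R : realType) (p k m : nat) (Q : network p k) (f : 'rV[R]_k.+2 -> R).
Hypothesis smf : smooth f.
Variables (g : 'I_m -> 'rV[R]_m.+1 -> R) (V Vs : 'M[R]_(p, m)).
Hypothesis data : reduction_data Q f g V Vs.

Definition reduced_form (i : 'I_m) : 'M[R]_m.+1 :=
  2^-1 *: \matrix_(a, b) partial a (partial b (g i)) 0.

(** Twice the polarisation of [h], hence its differential, in a form that refers to the network
    instead of the derivatives of [g]. *)
Definition reduced_second_order (z z' : 'rV[R]_m.+1) : 'cV[R]_m :=
  Vs^T *m second_order Q f (V *m state_part z) (param_part z)
                           (V *m state_part z') (param_part z').
Notation B := reduced_second_order.

Lemma reduced_second_orderC z z' : B z z' = B z' z.
Proof. by rewrite /B second_order_sym. Qed.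

Lemma reduced_second_order_sum z z' : B z z' = \sum_b z' 0 b *: B z (delta_mx 0 b).
Proof.
have BD y y' : B z (y + y') = B z y + B z y'.
  rewrite /B -mulmxDr -second_orderD -mulmxDr.
  congr (_ *m second_order _ _ _ _ (V *m _) _); rewrite /param_part ?mxE //.
  by apply/colP => i; rewrite !mxE.
have BZ t y : B z (t *: y) = t *: B z y.
  by rewrite /B state_partZ param_partZ -scalemxAr second_orderZ -scalemxAr.
have B0 : B z 0 = 0 by rewrite -(scale0r 0) BZ scale0r.
rewrite {1}[z']row_sum_delta (big_morph _ BD B0).
by apply: eq_bigr => b _; rewrite BZ.
Qed.

Lemma reduced_second_orderE z z' i :
  (B z z') i 0 = \sum_a \sum_b z 0 a * z' 0 b * partial a (partial b (g i)) 0.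
Proof.
rewrite exchange_big reduced_second_order_sum summxE; apply: eq_bigr => b _ /=.
rewrite mxE reduced_second_orderC reduced_second_order_sum summxE mulr_sumr.
apply: eq_bigr => a _; rewrite mxE reduced_second_orderC (red_ddg0 data) -/(B _ _).
by rewrite mulrCA mulrA.
Qed.

Lemma reduced_form_sym i : (reduced_form i)^T = reduced_form i.
Proof.
apply/matrixP => a b; rewrite !mxE !(red_ddg0 data).
by rewrite second_order_sym.
Qed.

Lemma bform_reduced i z z' : bform (reduced_form i) z z' = (B z z') i 0.
Proof.
rewrite reduced_second_orderE exchange_big bformE; apply: eq_bigr => b _.
rewrite mulr_suml; apply: eq_bigr => a _.
have -> : reduced_form i b a = reduced_form i a b by rewrite -[in LHS]reduced_form_sym mxE.
by rewrite -mulr2n !mxE; field.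
Qed.

Lemma qform_reduced i z : qform (reduced_form i) z = 2^-1 * (B z z) i 0.
Proof. by rewrite -bform_reduced bform_diag mulrA mulVf ?mul1r ?pnatr_eq0. Qed.

Lemma peval_taylor2 i z : peval (taylor2 (g i)) z = qform (reduced_form i) z.
Proof.
rewrite qform_reduced reduced_second_orderE /peval /taylor2 !mevalD mevalC.
rewrite (red_g0 data) add0r big1 ?rmorph0 ?add0r => [|j _]; last first.
  by rewrite (red_dg0 data) scale0r.
rewrite mevalZ raddf_sum; congr (_ * _); apply: eq_bigr => a _ /=.
rewrite raddf_sum; apply: eq_bigr => b _ /=.
by rewrite mevalZ mevalM !mevalXU mulrC.
Qed.

(** Translates the rank hypothesis on [h] into the surjectivity that [regular_zero] asks for. *)
Lemma poly_jacobian_taylor2 z w i :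
  (poly_jacobian (fun i => taylor2 (g i)) z *m w^T) i 0 = bform (reduced_form i) z w.
Proof.
rewrite bform_reduced reduced_second_orderE exchange_big mxE.
apply: eq_bigr => b _; rewrite [w^T _ _]mxE [X in X * _]mxE.
transitivity ((\sum_a z 0 a * partial a (partial b (g i)) 0) * w 0 b); last first.
  by rewrite mulr_suml; apply: eq_bigr => a _; rewrite mulrAC.
congr (_ * _); rewrite /peval /taylor2 !mderivD mderivC add0r.
rewrite big1 ?raddf0 ?add0r => [|j _]; last by rewrite (red_dg0 data) scale0r.
rewrite mderivZ mevalZ (raddf_sum (mderiv b)) raddf_sum /=.
have sym a c : partial a (partial c (g i)) 0 = partial c (partial a (g i)) 0.
  by rewrite !(red_ddg0 data) second_order_sym.
transitivity (2^-1 * \sum_a \sum_c partial a (partial c (g i)) 0 *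
    ((a == b)%:R * z 0 c + (c == b)%:R * z 0 a)).
  congr (_ * _); apply: eq_bigr => a _; rewrite (raddf_sum (mderiv b)) raddf_sum /=.
  apply: eq_bigr => c _.
  rewrite mderivZ mevalZ mderivM mevalD !mevalM !meval_mderiv_mvar !mevalXU.
  by rewrite [X in _ + X]mulrC.
have E : \sum_a \sum_c partial a (partial c (g i)) 0 * ((a == b)%:R * z 0 c) =
    \sum_a z 0 a * partial a (partial b (g i)) 0.
  rewrite (bigD1 b) //= [X in _ + X]big1 ?addr0 => [|a /negbTE ab].
    by apply: eq_bigr => c _; rewrite eqxx mul1r sym mulrC.
  by rewrite big1 // => c _; rewrite ab mul0r mulr0.
have E' : \sum_a \sum_c partial a (partial c (g i)) 0 * ((c == b)%:R * z 0 a) =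
    \sum_a z 0 a * partial a (partial b (g i)) 0.
  rewrite -E exchange_big; apply: eq_bigr => a _; apply: eq_bigr => c _.
  by rewrite sym.
rewrite (_ : \sum_a _ = \sum_a z 0 a * partial a (partial b (g i)) 0 *+ 2).
  by rewrite sumrMnl -[X in _ * X]mulr_natl mulKf ?pnatr_eq0.
transitivity (\sum_a (\sum_c partial a (partial c (g i)) 0 * ((a == b)%:R * z 0 c) +
   \sum_c partial a (partial c (g i)) 0 * ((c == b)%:R * z 0 a))).
  by apply: eq_bigr => a _; rewrite -big_split; apply: eq_bigr => c _; rewrite mulrDr.
by rewrite big_split /= E E' sumrMnl -mulr2n.
Qed.
End ReducedForm.

Lemma append_last (R : realType) m (x : 'rV[R]_m) lam : append x lam 0 ord_max = lam.
Proof. by rewrite mxE unlift_none. Qed.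

Lemma surjective_unitmx (F : fieldType) m (M : 'M[F]_m) :
  (forall r : 'cV[F]_m, exists s, M *m s = r) -> M \in unitmx.
Proof.
move=> surj; have [S HS] := fin_all_exists (fun j : 'I_m => surj (delta_mx j 0)).
suff : M *m (\matrix_(i, j) S j i 0) = 1%:M by case/mulmx1_unit.
apply/matrixP => i j; transitivity ((M *m S j) i 0).
  by rewrite !mxE; apply: eq_bigr => l _; rewrite mxE.
by rewrite HS !mxE andbT.
Qed.

Lemma singular_kernel (F : fieldType) m (M : 'M[F]_m) : M \notin unitmx ->
  exists2 w : 'cV[F]_m, w != 0 & M *m w = 0.
Proof.
rewrite unitmxE -det_tr unitfE negbK => /det0P[v v0 vM]; exists v^T.
  by rewrite -trmx0 (inj_eq trmx_inj).
by rewrite -[M]trmxK -trmx_mul vM trmx0.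
Qed.

Section ZeroCount.
Variables (R : realType) (p k m r : nat) (Q : network p k) (f : 'rV[R]_k.+2 -> R).
Hypothesis smf : smooth f.
Variables (g : 'I_m -> 'rV[R]_m.+1 -> R) (V Vs : 'M[R]_(p, m)).
Hypothesis data : reduction_data Q f g V Vs.
Variable y : 'I_r.+1 -> 'cV[R]_m.
Hypothesis Er : r.+1 = (2 ^ m)%N.
Hypothesis y0 : y ord0 = 0.
Hypothesis y_inj : injective y.
Hypothesis y_zero : forall j, Vs^T *m second_order Q f (V *m y j) 1 (V *m y j) 1 = 0.
Hypothesis y_rank : forall j, j != ord0 ->
  \rank (poly_jacobian (fun i => taylor2 (g i)) (append (y j)^T 1)) = m.

Local Notation q := (reduced_form g).
Local Notation B := (reduced_second_order Q f V Vs).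
Local Notation point c := (append c^T 1).

Lemma reduced_point (c : 'cV[R]_m) z : B (point c) z =
  Vs^T *m second_order Q f (V *m c) 1 (V *m state_part z) (param_part z).
Proof. by rewrite /B state_append param_append. Qed.

Lemma reduced_state (c w : 'cV[R]_m) : B (point c) (append w^T 0) =
  Vs^T *m second_order_mx Q f (V *m c) 1 *m V *m w.
Proof.
by rewrite reduced_point state_append param_append -second_order_mxE !mulmxA.
Qed.

Lemma bform_eq z z' (u : 'cV[R]_m) :
  (forall i, bform (q i) z z' = u i 0) <-> B z z' = u.
Proof.
split=> [H|<- i]; last by rewrite (bform_reduced smf data).
by apply/colP => i; rewrite -H (bform_reduced smf data).
Qed.

Lemma qform_eq0 z : B z z = 0 -> forall i, qform (q i) z = 0.
Proof. by move=> Bz i; rewrite (qform_reduced smf data) Bz mxE mulr0. Qed.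

Lemma point_zero j : B (point (y j)) (point (y j)) = 0.
Proof. by rewrite /B state_append param_append y_zero. Qed.

Lemma rank_regular j : j != ord0 -> regular_zero q (point (y j)).
Proof.
move=> /y_rank rk; split; first by apply: qform_eq0; exact: point_zero.
move=> u; set P := poly_jacobian _ _ in rk.
have PP : P *m pinvmx P = 1%:M by rewrite mulmxVp // /row_free rk.
exists (pinvmx P *m (\col_i u i))^T => i.
by rewrite -(poly_jacobian_taylor2 smf data) trmxK mulmxA PP mul1mx mxE.
Qed.

(** Regularity gives surjectivity on pairs (x, lambda). By Euler's identity the zero itself is in
    the kernel of the differential, and subtracting a multiple of it removes the lambda
    component. *)
Lemma regular_unitmx j : regular_zero q (point (y j)) ->
  Vs^T *m second_order_mx Q f (V *m y j) 1 *m V \in unitmx.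
Proof.
move=> [_ reg]; apply: surjective_unitmx => u.
have [w /bform_eq Hw] := reg (fun i => u i 0).
set Z := append (y j)^T 1 in Hw.
pose w' := w - param_part w *: Z.
exists (state_part w'); rewrite -reduced_state -/Z.
have -> : append (state_part w')^T 0 = w'.
  apply/rowP => a; rewrite mxE; case: unliftP => [b|] ->; first by rewrite !mxE.
  have : param_part Z = 1 by exact: append_last.
  rewrite /param_part => Z1; rewrite [RHS]mxE [X in _ + X]mxE [X in - X]mxE Z1.
  by rewrite mulr1 subrr.
rewrite -Hw.
have /bform_eq Hz := point_zero j.
apply/bform_eq => i; rewrite -(bform_reduced smf data) /w' -scaleNr bformD bformZ.
by rewrite Hz mxE mulr0 addr0.
Qed.

Lemma separated_points (c c' : 'cV[R]_m) : c <> c' -> separated (point c) (point c').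
Proof.
move=> cc'; have [a Ha] : exists a, c' a 0 <> c a 0.
  by apply: contra_notP cc' => /forallNP H; apply/colP => a; apply/esym; apply: contrapT; exact: H.
apply: (@separated_affine _ _ _ _ (lift ord_max a)); first exact: append_last.
by rewrite append_last mul1r !mxE liftK !mxE.
Qed.

(** The rank condition is only available at nonzero points, so regularity at the origin comes from
    the count: a kernel vector [w] would make (0, 1) a double zero along (w, 0), too much beside the
    2^m - 1 others. *)
Lemma origin_unitmx : Vs^T *m second_order_mx Q f 0 1 *m V \in unitmx.
Proof.
apply/contraT => /singular_kernel[w w0 Mw].
have [a wa] : exists a, w a 0 != 0.
  by apply: contraNP w0 => /forallNP H; apply/eqP/colP => a; rewrite mxE; apply/eqP/negPn/negP/H.
have nz j : lift ord0 j != ord0 :> 'I_r.+1 by rewrite eq_sym neq_lift.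
suff : False by [].
apply: (@bezout_double _ _ q r (fun j => point (y (lift ord0 j))) (point (y ord0))
  (append w^T 0)) => //.
- apply/eqP => /rowP/(_ ord_max); rewrite [X in _ = X]mxE.
  rewrite append_last => /eqP.
  by rewrite oner_eq0.
- by move=> j; apply: rank_regular.
- by apply: qform_eq0; exact: point_zero.
- by move=> i; rewrite (bform_reduced smf data) reduced_state y0 mulmx0 Mw mxE.
- apply: (@separated_affine _ _ _ _ (lift ord_max a)); first exact: append_last.
  rewrite append_last mul0r !mxE liftK mxE.
  exact/eqP.
- by move=> j j' jj'; apply: separated_points => /y_inj/lift_inj/eqP; rewrite (negbTE jj').
- move=> j; split; apply: separated_points => /y_inj/eqP; rewrite ?(negbTE (nz j)) //.
Qed.

Lemma zero_regular j : regular_zero q (point (y j)).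
Proof.
have [->|j0] := eqVneq j ord0; last exact: rank_regular.
split; first by apply: qform_eq0; exact: point_zero.
move=> u; set M := Vs^T *m second_order_mx Q f 0 1 *m V.
exists (append (invmx M *m (\col_i u i))^T 0) => i.
rewrite (bform_reduced smf data) reduced_state y0 mulmx0 -/M.
by rewrite mulKVmx ?origin_unitmx // mxE.
Qed.

Lemma zero_unitmx j : Vs^T *m second_order_mx Q f (V *m y j) 1 *m V \in unitmx.
Proof. by apply: regular_unitmx; exact: zero_regular. Qed.

Lemma zero_affine c : Vs^T *m second_order Q f (V *m c) 1 (V *m c) 1 = 0 ->
  exists j, c = y j.
Proof.
move=> c0; apply: contrapT => /forallNP nc.
apply: (@bezout _ _ q r.+1 (fun j => point (y j)) (point c)) => //.
- apply/eqP => /rowP/(_ ord_max); rewrite [X in _ = X]mxE.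
  rewrite append_last => /eqP.
  by rewrite oner_eq0.
- exact: zero_regular.
- by apply: qform_eq0; rewrite reduced_point state_append param_append.
- by move=> j j' jj'; apply: separated_points => /y_inj/eqP; rewrite (negbTE jj').
- by move=> j; split; apply: separated_points => // /esym; exact: nc.
Qed.

(** A nonzero [c] would give a further projective zero (c, 0), distinct from the 2^m regular ones
    with last coordinate 1. *)
Lemma zero_infinity c : Vs^T *m second_order Q f (V *m c) 0 (V *m c) 0 = 0 -> c = 0.
Proof.
move=> Bc; apply: contrapT => c0.
have [a ca] : exists a, c a 0 <> 0.
  by apply: contra_notP c0 => /forallNP H; apply/colP => a; rewrite mxE; apply: contrapT; exact: H.
have last0 : append c^T 0 0 ord_max = 0 by exact: append_last.
have lift_c : append c^T 0 0 (lift ord_max a) = c a 0 by rewrite mxE liftK mxE.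
apply: (@bezout _ _ q r.+1 (fun j => point (y j)) (append c^T 0)) => //.
- by apply/eqP => /rowP/(_ (lift ord_max a)); rewrite lift_c mxE.
- exact: zero_regular.
- by apply: qform_eq0; rewrite /reduced_second_order state_append param_append.
- by move=> j j' jj'; apply: separated_points => /y_inj/eqP; rewrite (negbTE jj').
- move=> j; split; last by apply: separated_infinity => //; exact: append_last.
  apply: (@separated_affine _ _ _ _ (lift ord_max a)); first exact: append_last.
  by rewrite last0 mul0r lift_c.
Qed.

Lemma zero_direction_exists x lam : (x != 0) || (lam != 0) ->
  Defs.jacobian Q (linear_part f) *m x = 0 ->
  Vs^T *m second_order Q f x lam x lam = 0 ->
  lam != 0 /\ exists j, x = lam *: (V *m y j).
Proof.
move=> nz /(red_ker data)[c xE]; rewrite xE => B0.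
have [l0|l0] := eqVneq lam 0.
  move: nz; rewrite l0 eqxx orbF xE; rewrite l0 in B0.
  by rewrite (zero_infinity B0) mulmx0 eqxx.
split=> //; have [|j Hj] := @zero_affine (lam^-1 *: c).
  have E : second_order Q f (V *m c) lam (V *m c) lam =
      (lam * lam) *: second_order Q f (V *m (lam^-1 *: c)) 1 (V *m (lam^-1 *: c)) 1.
    rewrite -scalerA -second_orderZ second_order_sym // -second_orderZ.
    by rewrite scalemxAr scalerA divff // scale1r mulr1.
  move: B0; rewrite E -scalemxAr => /eqP; rewrite scaler_eq0 mulf_eq0 (negbTE l0) /=.
  by move/eqP.
by exists j; rewrite -Hj scalemxAr scalerA divff // scale1r.
Qed.
End ZeroCount.

(** * Branches *)

Lemma branch_domain_segment (R : realType) (I : set R) t s :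
  branch_domain I -> I t -> 0 <= s <= 1 -> I (s * t).
Proof.
move=> [/connected_intervalP cI I0 _] It /andP[s0 s1].
have [t0|t0] := leP 0 t.
  by apply: (cI 0 t) => //; rewrite mulr_ge0 // ler_piMl.
by apply: (cI t 0) => //; apply/andP; split; nra.
Qed.

Lemma segment_domain (R : realType) (t : R) : t != 0 ->
  branch_domain [set s * t | s in `[0, 1]].
Proof.
move=> t0; split.
- apply: connected_continuous_connected; first exact/connected_intervalP/interval_is_interval.
  by apply: continuous_subspaceT => s; apply: cvgM => //; exact: cvg_cst.
- by exists 0; rewrite ?mul0r //= in_itv /= lexx ler01.
- by exists t => //; exists 1; rewrite ?mul1r //= in_itv /= lexx ler01.
Qed.

Section BranchDirection.
Variables (R : realType) (p r : nat) (Y : 'I_r -> 'cV[R]_p) (I : set R).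
Variable x : R -> 'cV[R]_p.
Hypothesis Y_inj : injective Y.
Hypothesis domI : branch_domain I.
Hypothesis contx : {within I, continuous x}.
Hypothesis x0 : x 0 = 0.
Hypothesis dirs : forall e : R, 0 < e -> exists2 d : R, 0 < d &
  forall t, I t -> t != 0 -> `|x t| < d -> `|t| < d ->
  exists j, `|x t - t *: Y j| <= e * `|t|.

Lemma branch_segment_cvg (t s : R) : I t -> 0 <= s <= 1 ->
  x (u * t) @[u --> within `[0, 1] (nbhs s)] --> x (s * t).
Proof.
move=> It s01.
have cx := (subspace_continuousP _ _).1 contx _ (branch_domain_segment domI It s01).
apply: (cvg_comp _ _ _ cx) => P /= HP.
have ct : (u * t @[u --> s] --> s * t) by apply: cvgM => //; exact: cvg_cst.
have := ct _ HP; apply: (@filterS _ (nbhs s)) => u /= Pu u01; apply: Pu.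
exact: branch_domain_segment.
Qed.

Lemma branch_small (d : R) : 0 < d -> exists t, [/\ t != 0, I t &
  forall s, 0 <= s <= 1 -> `|x (s * t)| < d /\ `|s * t| < d].
Proof.
move=> d0; have [_ _ [t It t0]] := domI.
have := branch_segment_cvg It (_ : 0 <= 0 <= 1); rewrite lexx ler01 mul0r x0.
move=> /(_ isT) /cvgrPdist_lt/(_ _ d0) /=; rewrite near_withinE.
move=> /nbhs_ballP[r' /= r'0 Hr].
pose a := Num.min 1 (Num.min (r' / 2) (d / (2 * `|t|))).
have nt : 0 < `|t| by rewrite normr_gt0.
have a0 : 0 < a by rewrite !lt_min ltr01 !divr_gt0 // mulr_gt0.
have [a1 ar ad] : [/\ a <= 1, a <= r' / 2 & a <= d / (2 * `|t|)].
  by split; rewrite !ge_min lexx ?orbT.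
have s_a s : 0 <= s <= 1 -> 0 <= s * a <= a.
  by move=> /andP[s0 s1]; rewrite mulr_ge0 //= ?ler_piMl ?(ltW a0).
exists (a * t); split.
- by rewrite mulf_neq0 // gt_eqF.
- by apply: branch_domain_segment => //; rewrite ltW.
move=> s /s_a/andP[sa0 sa]; rewrite mulrA; split.
  have := Hr (s * a); rewrite /ball /= sub0r normrN (ger0_norm sa0).
  rewrite in_itv /= sa0 (le_trans sa a1) sub0r normrN; apply=> //.
  by apply: le_lt_trans (le_trans sa ar) _; lra.
rewrite normrM (ger0_norm sa0).
apply: le_lt_trans (_ : d / (2 * `|t|) * `|t| < d).
  by rewrite ler_wpM2r // (le_trans sa).
by rewrite invfM mulrA mulfVK ?gt_eqF //; lra.
Qed.

(** Thin cones around distinct [Y j] meet only at 0, so along a segment from 0 the branch cannot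
    pass from one to another. The tolerance depends on the direction, as does the radius of local
    uniqueness. *)
Lemma branch_direction (eps : 'I_r -> R) : (forall j, 0 < eps j) ->
  exists j I', [/\ I' `<=` I, branch_domain I' &
    forall t, I' t -> t != 0 -> `|t| < eps j /\ `|x t - t *: Y j| <= eps j * `|t|].
Proof.
move=> eps0.
(* With directions at least 3e apart, a point within e of one is at least 2e away from the others,
   in units of the parameter. *)
have [e e0 He] : exists2 e : R, 0 < e & forall ij : 'I_r * 'I_r,
    e <= eps ij.1 /\ (ij.1 != ij.2 -> 3 * e <= `|Y ij.1 - Y ij.2|).
  pose P (ij : 'I_r * 'I_r) e := e <= eps ij.1 /\
    (ij.1 != ij.2 -> 3 * e <= `|Y ij.1 - Y ij.2|).
  have Pmin (a : 'I_#|{: 'I_r * 'I_r}|) : exists2 e, 0 < e & P (enum_val a) e.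
    case: (enum_val a) => i j; rewrite /P /=.
    have [->|ij] := eqVneq i j; first by exists (eps j).
    have Yij : 0 < `|Y i - Y j| by rewrite normr_gt0 subr_eq0 (inj_eq Y_inj).
    exists (Num.min (eps i) (`|Y i - Y j| / 3)).
      by rewrite lt_min eps0 divr_gt0.
    by rewrite ge_min lexx; split=> // _; rewrite mulrC -ler_pdivlMr // ge_min lexx orbT.
  have [|e e0 He] := fin_pos_min Pmin.
    move=> a d d' d'0 d'd [H1 H2]; split=> [|ij]; first exact: le_trans H1.
    by apply: le_trans (H2 ij); rewrite ler_pM2l.
  by exists e => // ij; have := He (enum_rank ij); rewrite enum_rankK.
have [d d0 Hd] := dirs e0.
have [|t [t0 It Ht]] := @branch_small (Num.min d e); first by rewrite lt_min d0.
have dirs_t s : 0 < s <= 1 -> exists j, `|x (s * t) - (s * t) *: Y j| <= e * `|s * t|.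
  move=> /andP[s0 s1]; have s01 : 0 <= s <= 1 by rewrite ltW.
  have [] := Ht s s01; rewrite !lt_min => /andP[xd _] /andP[td _].
  by apply: Hd => //; [exact: branch_domain_segment|rewrite mulf_neq0 // gt_eqF].
have far j j' s : 0 < s -> j != j' ->
    `|x (s * t) - (s * t) *: Y j'| <= e * `|s * t| ->
    2 * e * `|s * t| <= `|x (s * t) - (s * t) *: Y j|.
  move=> s0 jj' close; have st : 0 < `|s * t| by rewrite normr_gt0 mulf_neq0 // gt_eqF.
  have : 3 * e * `|s * t| <= `|(s * t) *: (Y j - Y j')|.
    rewrite (normrZ (s * t) (_ : 'cV_p)) [leRHS]mulrC ler_pM2r //.
    by have [_ /(_ jj')] := He (j, j').
  have -> : (s * t) *: (Y j - Y j') = (x (s * t) - (s * t) *: Y j') - (x (s * t) - (s * t) *: Y j).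
    by rewrite scalerBr opprB [RHS]addrC addrA subrK.
  move=> /le_trans/(_ (ler_normB _ _)) H.
  by move: H close; lra.
have [|j Hj] := dirs_t 1; first by rewrite ltr01 lexx.
have const s : 0 < s <= 1 -> `|x (s * t) - (s * t) *: Y j| <= e * `|s * t|.
  move=> /andP[s0 s1]; have [|j' Hj'] := dirs_t s; first by rewrite s0.
  have [<- //|jj'] := eqVneq j' j; exfalso.
  (* 3/2 lies between the ratios at most 1 inside the cone of [Y j] and at least 2 inside the other
     cones; a zero of [G] would be a point of the branch in no cone. *)
  pose G u := `|x (u * t) - (u * t) *: Y j| - 3 / 2 * e * `|u * t|.
  have cG : {within `[s, 1], continuous G}.
    apply/subspace_continuousP => u /=; rewrite in_itv /= => /andP[su u1].
    have sub : within `[s, 1] (nbhs u) `=>` within `[0, 1] (nbhs u).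
      move=> P; apply: (@filterS _ (nbhs u)) => v Pv /=; rewrite in_itv /= => /andP[sv v1].
      by apply: Pv; rewrite /= in_itv /= v1 (le_trans (ltW s0) sv).
    have cu : (v * t @[v --> within `[s, 1] (nbhs u)] --> u * t).
      by apply: cvg_within_filter; apply: cvgM => //; exact: cvg_cst.
    have cx : (x (v * t) @[v --> within `[s, 1] (nbhs u)] --> x (u * t)).
      apply: cvg_trans (branch_segment_cvg It _); last by rewrite u1 (le_trans (ltW s0)).
      by move=> P; exact: sub.
    apply: cvgB.
      by apply: cvg_norm; apply: cvgB => //; apply: cvgZl.
    by apply: cvgMr; exact: cvg_norm.
  have st u : 0 < u -> 0 < `|u * t| by move=> u0; rewrite normr_gt0 mulf_neq0 // gt_eqF.
  have Gs : 0 <= G s.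
    have := far j j' s s0; rewrite eq_sym jj' => /(_ isT Hj').
    have := mulr_gt0 e0 (st s s0).
    by rewrite /G; lra.
  have G1 : G 1 <= 0.
    have := mulr_gt0 e0 (st 1 ltr01); move: Hj.
    by rewrite /G; lra.
  have [|c /andP[]] := IVT s1 cG (_ : _ <= 0 <= _).
    by rewrite ge_min le_max Gs G1 orbT.
  rewrite !bnd_simp => sc c1 /eqP; rewrite subr_eq0 => /eqP Gc.
  have c0 := lt_le_trans s0 sc.
  have [|j'' Hc] := dirs_t c; first by rewrite c0.
  have ec := mulr_gt0 e0 (st c c0).
  have [Ej|jj''] := eqVneq j j''.
    by move: Hc; rewrite -Ej Gc; lra.
  by have := far j j'' c c0 jj'' Hc; rewrite Gc; lra.
have e_eps : e <= eps j by have [] := He (j, j).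
exists j, [set s * t | s in `[0, 1]]; split.
- by move=> u [s /=]; rewrite in_itv => s01 <-; exact: branch_domain_segment.
- exact: segment_domain.
move=> u [s /=]; rewrite in_itv /= => /andP[s0 s1] <- st0.
have s_gt0 : 0 < s by rewrite lt_neqAle s0 andbT eq_sym; apply: contraNneq st0 => ->; rewrite mul0r.
split.
  have [] := Ht s; first by rewrite s0.
  by move=> _; rewrite lt_min => /andP[_ te]; exact: lt_le_trans te e_eps.
apply: le_trans (const s _) _; first by rewrite s_gt0.
by rewrite ler_wpM2r.
Qed.
End BranchDirection.

(** * Generic conditions, and the conclusion *)

Lemma mup_map (F F' : fieldType) (h : {rmorphism F -> F'}) (q : {poly F}) a :
  q != 0 -> mup (h a) (map_poly h q) = mup a q.
Proof.
move=> q0; have hq0 : map_poly h q != 0 by rewrite map_poly_eq0.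
have dvd_h l : (('X - (h a)%:P) ^+ l %| map_poly h q) = (('X - a%:P) ^+ l %| q).
  by rewrite -(dvdp_map h) rmorphXn rmorphB /= map_polyX map_polyC.
apply/eqP; rewrite eqn_leq; apply/andP; split.
  by rewrite mup_leq // dvd_h -mup_leq.
by rewrite mup_geq // dvd_h -mup_geq.
Qed.

Section Genericity.
Variables (R : realType) (n k : nat) (N : network n k) (mu : 'rV[R]_k.+1 -> R[i]).
Implicit Types D : synchrony R N.

Lemma smooth_generically P :
  generically (@smooth R k.+2) P -> generically (bifurcation_problems mu) P.
Proof. by apply: generically_sub => f []. Qed.

(** Simplicity concerns the complex Jacobian at [mu]. On a bifurcation problem [mu] is 0, whose
    multiplicity is the same for the real Jacobian, as [simple_derivative_generic] requires. *)
Lemma simple_determined_generic D : mu_simple mu D -> determined mu D 2 ->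
  generically (bifurcation_problems mu) (fun f =>
    exists g (v w : 'cV[R]_(nclass D)),
    [/\ reduction_data (quotient D) f g v w,
        partial ord0 (partial ord0 (g ord0)) 0 <> 0 &
        (w^T *m Defs.jacobian (quotient D) (lambda_part f) *m v) 0 0 <> 0]).
Proof.
move=> [_ simple] [det _]; have [c Hc] := simple_derivative_generic R (quotient D).
apply: generically_mono (generically_and (generically_nd _ c)
  (generically_and det (smooth_generically simple))).
move=> f [smf mu0 _ f0] [ndc [[g [LS g2]] [_ [mup1 _]]]].
have [v [w data]] := lyapunov_schmidt_data smf f0 LS.
exists g, v, w; split=> //; apply: (Hc f ndc).
- exact: red_ker data.
- exact: red_coker data.
- exact: red_dual data.
- exact: red_VsJ data.
rewrite -[RHS]mup1 mu0 /jacobianC -map_char_poly.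
rewrite -[X in mup X (map_poly _ _)](rmorph0 (real_complex R)).
by rewrite mup_map // monic_neq0 ?char_poly_monic.
Qed.

(* The intersection of two distinct maximal subspaces is strictly smaller than
   one of them, so [mu] is not an eigenvalue of it. *)
Lemma maximal_kernel_generic D D' : mu_maximal mu D -> mu_maximal mu D' ->
  sync_set D <> sync_set D' ->
  generically (bifurcation_problems mu) (fun f =>
    forall u : 'cV[R]_n, sync_set D u -> sync_set D' u ->
    Defs.jacobian N (linear_part f) *m u = 0 -> u = 0).
Proof.
move=> [_ maxD] [_ maxD'] DD'; have [I IE] := sync_intersection D D'.
have : generically (@smooth R k.+2) (fun f =>
    ~~ eigenvalue (jacobianC (quotient I) (linear_part f)) (mu (linear_part f))).
  have [DI|DI] := pselect (sync_set D `<=` sync_set I); last first.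
    by apply: maxD; split=> //; rewrite IE; exact: subIsetl.
  apply: maxD'; split; first by rewrite IE; exact: subIsetr.
  move=> D'I; apply: DD'; apply/seteqP; split=> x.
    by move=> /DI; rewrite IE => -[].
  by move=> /D'I; rewrite IE => -[].
move=> /smooth_generically; apply: generically_mono => f [_ mu0 _ _] ne u Du D'u Ju.
apply/eqP; apply: contraNT ne => u0; rewrite mu0.
by apply: (kernel_eigenvalue _ u0 Ju); rewrite IE.
Qed.
End Genericity.

Theorem theorem3p3 (R : realType) (n k m : nat) (N : network n k)
    (mu : 'rV[R]_k.+1 -> R[i]) (Delta : synchrony R N) :
  connected_network N ->
  network_eigenvalue N mu ->
  mu_semisimple mu Delta m ->
  mu_submaximal mu Delta (2 ^ m - 1) ->
  (forall D : synchrony R N,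
     mu_simple mu D -> mu_maximal mu D -> sync_set D `<=` sync_set Delta ->
     determined mu D 2) ->
  generically (bifurcation_problems mu) (fun f =>
    forall g : 'I_m -> 'rV[R]_m.+1 -> R,
    lyapunov_schmidt (quotient Delta) f g ->
    let h := fun i => taylor2 (g i) in
    (forall y : 'rV[R]_m, y != 0 ->
       (forall lam i, peval (h i) (append (lam *: y) lam) = 0) ->
       \rank (poly_jacobian h (append y 1)) = m) ->
    ~ common_factor h ->
    ~ exists (I : set R) (b : R -> 'cV[R]_n),
        bifurcation_branch N f I b /\ branch_synchrony I b Delta).
Proof.
move=> _ _ _ [r1 _ [Ds [Ds_inj Ds_max]] _] det2.
pose generic_line f i := exists g (v w : 'cV[R]_(nclass (Ds i))),
  [/\ reduction_data (quotient (Ds i)) f g v w,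
      partial ord0 (partial ord0 (g ord0)) 0 <> 0 &
      (w^T *m Defs.jacobian (quotient (Ds i)) (lambda_part f) *m v) 0 0 <> 0].
pose transverse f i j := i != j -> forall u : 'cV[R]_n,
  sync_set (Ds i) u -> sync_set (Ds j) u ->
  Defs.jacobian N (linear_part f) *m u = 0 -> u = 0.
have gen : generically (bifurcation_problems mu) (fun f =>
    (forall i, generic_line f i) /\ forall i j, transverse f i j).
  apply: generically_and.
    apply: generically_forall => i; have [simp max [sub _]] := Ds_max i.
    by apply: simple_determined_generic => //; exact: det2.
  apply: generically_forall => i; apply: generically_forall => j.
  have [_ maxi _] := Ds_max i; have [_ maxj _] := Ds_max j.
  (* For [i = j] nothing is asked, so an empty list of conditions will do. *)
  rewrite /transverse; have [_|ij] := eqVneq i j.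
    by exists 0%N, (fun o : 'I_0 => match o with Ordinal _ H => False_rect _ (notF H) end).
  by apply: generically_mono (maximal_kernel_generic maxi maxj (Ds_inj _ _ ij)).
apply: generically_mono gen => f [smf mu0 _ f0] [lines trans] g LS h rank_h _.
move=> [I [b [[domI [contb b0] _ zerob] syncb]]].
have [V [Vs data]] := lyapunov_schmidt_data smf f0 LS.
set Q := quotient Delta in LS data; set S := pullback R (cell_class Delta).
have [L LS1] := pullback_left_inverse R (@class_surj _ _ _ _ Delta).
have fibN := @quotient_fibration _ _ _ _ Delta.
have V0 (z : 'cV[R]_m) : z != 0 -> V *m z != 0.
  apply: contraNN => /eqP Vy; rewrite -[z]mul1mx -(red_dual data) -mulmxA Vy.
  by rewrite mulmx0.
have zeros i : exists y : 'cV[R]_m, [/\ y != 0,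
    Vs^T *m second_order Q f (V *m y) 1 (V *m y) 1 = 0 &
    exists s : 'I_(nclass Delta) -> 'I_(nclass (Ds i)),
      (forall a, cell_class (Ds i) a = s (cell_class Delta a)) /\
      exists u, V *m y = pullback R s *m u].
  have [_ _ [sub _]] := Ds_max i; have [s Hs] := class_factor sub.
  have [g' [v [w [data' g'2 g'lam]]]] := lines i.
  have [y [y0 zy uy]] := line_zero (factor_fibration Hs) (factor_surj Hs) smf f0
    data data' g'2 g'lam.
  by exists y; split=> //; exists s.
have [y Hy] := fin_all_exists zeros.
(* The trivial zero is put at [ord0], which brings the number of zeros to 2^m. *)
pose y' (j : 'I_(2 ^ m - 1).+1) := if unlift ord0 j is Some i then y i else 0.
have SsE i s x : (forall a, cell_class (Ds i) a = s (cell_class Delta a)) ->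
    S *m (pullback R s *m x) = pullback R (cell_class (Ds i)) *m x :> 'cV[R]_n.
  by move=> Hs; apply/colP => a; rewrite !pullbackE Hs.
have y'0 : y' ord0 = 0 by rewrite /y' unlift_none.
have y_inj : injective y.
  move=> i j Eij; apply/eqP/contraT => ij.
  have [y0 _ [s [Hs [u Hu]]]] := Hy i; have [_ _ [s' [Hs' [u' Hu']]]] := Hy j.
  have : S *m (V *m y i) = 0.
    apply: (trans i j ij).
    - by apply/sync_setP; exists u; rewrite Hu SsE.
    - by apply/sync_setP; exists u'; rewrite Eij Hu' SsE.
    - rewrite mulmxA (jacobian_pullback fibN) -mulmxA (mulmxA _ V) (red_JV data).
      by rewrite mul0mx mulmx0.
  move=> /(congr1 (mulmx L)); rewrite mulmxA LS1 mul1mx mulmx0 => /eqP.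
  by rewrite (negbTE (V0 _ y0)).
have y'_inj : injective y'.
  move=> i j; rewrite /y'.
  case: (unliftP ord0 i) => [i'|] ->; case: (unliftP ord0 j) => [j'|] -> //.
  - by move=> /y_inj ->.
  - by move=> Ey; have [] := Hy i'; rewrite Ey eqxx.
  - by move=> Ey; have [] := Hy j'; rewrite -Ey eqxx.
have y'_zero j : Vs^T *m second_order Q f (V *m y' j) 1 (V *m y' j) 1 = 0.
  rewrite /y'; case: unliftP => [i|] _; first by have [] := Hy i.
  by rewrite !mulmx0 second_order_lambda2 // mulmx0.
have y'_rank j : j != ord0 ->
    \rank (poly_jacobian (fun i => taylor2 (g i)) (append (y' j)^T 1)) = m.
  move=> j0; apply: rank_h => [|lam i].
    rewrite -trmx0 (inj_eq trmx_inj); apply: contraNneq j0 => yj.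
    by apply/eqP/y'_inj; rewrite y'0.
  rewrite /h (peval_taylor2 smf data).
  have -> : append (lam *: (y' j)^T) lam = lam *: append (y' j)^T 1.
    by apply/rowP => a; rewrite !mxE; case: unliftP => [c|] _; rewrite ?mxE ?mulr1.
  rewrite qformZ (qform_reduced smf data) /reduced_second_order state_append.
  by rewrite param_append y'_zero mxE !mulr0.
have Er : (2 ^ m - 1).+1 = (2 ^ m)%N by rewrite subn1 prednK ?expn_gt0.
(* The branch in the cell coordinates of the quotient; no information is lost, since the branch lies
   in [Delta]. *)
pose x t := L *m b t.
have bS t : I t -> b t = S *m x t.
  move=> It; have [sub _] := syncb I (@subset_refl _ I) domI.
  have /sync_setP[x' E] : sync_set Delta (b t) by apply: sub; exists t.
  by rewrite /x E (mulmxA L) LS1 mul1mx.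
have zerox t : I t -> coupled Q f (x t) t = 0.
  move=> It; rewrite -[LHS]mul1mx -LS1 -mulmxA -(coupled_pullback fibN) -bS //.
  by rewrite zerob // mulmx0.
(* For a nonzero direction this is the subspace it comes from. For the zero direction any [Ds i]
   will do, and one exists because the order 2^m - 1 is at least 1. *)
have local j : exists D : synchrony R N, ~ (sync_set Delta `<=` sync_set D) /\
    exists2 e : R, 0 < e & forall t z, t != 0 -> `|t| < e ->
      `|z - t *: (V *m y' j)| <= e * `|t| -> coupled Q f z t = 0 ->
      sync_set D (S *m z).
  have unit_j := zero_unitmx smf data Er y'0 y'_inj y'_zero y'_rank j.
  have [i [s [Hs [u Hu]]]] : exists i (s : 'I_(nclass Delta) -> 'I_(nclass (Ds i))),
      (forall a, cell_class (Ds i) a = s (cell_class Delta a)) /\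
      exists u, V *m y' j = pullback R s *m u.
    rewrite /y'; case: unliftP => [i|] _.
      by have [_ _ [s Hs]] := Hy i; exists i, s.
    have [_ _ [s [Hs _]]] := Hy (Ordinal r1); exists (Ordinal r1), s; split=> //.
    by exists 0; rewrite !mulmx0.
  exists (Ds i); split; first by have [_ _ []] := Ds_max i.
  rewrite Hu in unit_j.
  have [e e0 He] := zero_in_pullback smf f0 (red_ker data) (red_VsJ data) (red_dual data)
    (factor_fibration Hs) (factor_surj Hs) unit_j.
  exists e => // t z t0 te; rewrite Hu => zt /(He _ _ t0 te zt)[z' ->].
  by apply/sync_setP; exists z'; rewrite SsE.
have [D HD] := fin_all_exists local.
have [eps eps0 Heps] := fin_all_exists2 (fun j => (HD j).2).
have contx : {within I, continuous x}.
  apply/subspace_continuousP => t It.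
  have cb := (subspace_continuousP _ _).1 contb _ It.
  have [K K0 HK] := mulmx_bound L.
  have cL : continuous (fun z : 'cV[R]_n => L *m z).
    by apply: (lipschitz_continuous K0) => z z'; rewrite -mulmxBr; exact: HK.
  exact: (cvg_comp _ _ cb (cL _)).
have Vy'_inj : injective (fun j => V *m y' j).
  move=> i j /(congr1 (mulmx Vs^T)); rewrite !mulmxA (red_dual data) !mul1mx.
  exact: y'_inj.
have x0 : x 0 = 0 by rewrite /x b0 mulmx0.
have dirs (e : R) : 0 < e -> exists2 d : R, 0 < d &
    forall t, I t -> t != 0 -> `|x t| < d -> `|t| < d ->
    exists j, `|x t - t *: (V *m y' j)| <= e * `|t|.
  move=> e0; have [d d0 Hd] := zero_directions smf f0 (red_VsJ data)
    (zero_direction_exists smf data Er y'0 y'_inj y'_zero y'_rank) e0.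
  by exists d => // t It t0 xd td; apply: Hd => //; exact: zerox.
have [j [I' [sub domI' close]]] := branch_direction Vy'_inj domI contx x0 dirs
  eps0.
(* Synchrony is required on every smaller domain, so the piece over [I'] must still generate
   [Delta], although it lies in [D j]. *)
have [_ smallest] := syncb I' sub domI'.
apply: (HD j).1; apply: smallest => _ [t I't <-].
have [->|t0] := eqVneq t 0; first by rewrite b0 => i i' _; rewrite !mxE.
have It := sub _ I't; have [te xt] := close t I't t0.
by rewrite bS //; apply: Heps xt (zerox t It).
Qed.
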